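(* Let $\varphi:\Sigma\to\mathbb{R}$ be continuous. There exists some $\alpha\in A(\varphi)$ satisfying $\dim_{\mathcal P}E_\varphi(\alpha)=\dim_{\mathcal P}\Lambda$ if and only if $\int\varphi\,d\mu_1=\int\varphi\,d\mu_2=\cdots=\int\varphi\,d\mu_d$ for some $\mu_1,\dots,\mu_d\in\mathcal{M}_\sigma(\Sigma)$ such that $\mu_j\circ\chi_j^{-1}=\mathbf{b}_j$ for each $j=1,\dots,d$.
   Context: Let $a_1>a_2>\cdots>a_d\ge2$ be natural numbers, $\mathcal{D}\subseteq\prod_{q=1}^d\{0,\dots,a_q-1\}$ a digit set, $\Sigma=\mathcal{D}^{\mathbb{N}}$ with the product topology, and $\sigma:\Sigma\to\Sigma$ the left shift. The map $\Pi:\Sigma\to\mathbb{T}^d=\mathbb{R}^d/\mathbb{Z}^d$ is $\Pi((\omega_\nu)_{\nu\in\mathbb{N}})=\left(\sum_{\nu\in\mathbb{N}}i_j(\nu)a_j^{-\nu}\right)_{j=1}^d$ where $\omega_\nu=(i_j(\nu))_{j=1}^d$; $\Lambda=\Pi(\Sigma)$ is the self-affine Sierpiński sponge. For $1\le k\le d$ let $\eta_k$ be the map $(i_j)_{j=1}^d\mapsto(i_j)_{j=k}^d$ on $\mathcal{D}$, $\Sigma_k=\eta_k(\mathcal{D})^{\mathbb{N}}$, $\sigma_k$ the left shift on $\Sigma_k$, and $\chi_k:\Sigma\to\Sigma_k$, $(\omega_\nu)_\nu\mapsto(\eta_k(\omega_\nu))_\nu$. $\mathbf{b}_k$ denotes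 the measure of maximal entropy of $(\Sigma_k,\sigma_k)$. $\mathcal{M}_\sigma(\Sigma)$ is the set of $\sigma$-invariant Borel probability measures on $\Sigma$. $E_\varphi(\alpha)=\Pi\left(\{\omega\in\Sigma:\lim_{n\to\infty}\frac1n\sum_{l=0}^{n-1}\varphi(\sigma^l\omega)=\alpha\}\right)$ and $A(\varphi)=\{\int\varphi\,d\mu:\mu\in\mathcal{M}_\sigma(\Sigma)\}$. $\dim_{\mathcal P}$ denotes packing dimension. *)

(* Defs.v *)
From HB Require Import structures.
From mathcomp Require Import all_boot all_order all_algebra generic_quotient.
From mathcomp Require Import all_classical all_reals all_analysis.

Set Implicit Arguments.
Unset Strict Implicit.
Unset Printing Implicit Defensive.

Import Order.TTheory GRing.Theory Num.Theory.
Import numFieldNormedType.Exports.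

Local Open Scope classical_set_scope.
Local Open Scope quotient_scope.
Local Open Scope ring_scope.

Definition int_lattice_rel (R : realType) (d : nat) (x y : 'rV[R]_d) : bool :=
  [forall j, x ord0 j - y ord0 j \is a Num.int].

Lemma int_lattice_refl (R : realType) (d : nat) :
  reflexive (@int_lattice_rel R d).
Proof. by move=> x; apply/forallP => j; rewrite subrr rpred0. Qed.

Lemma int_lattice_sym (R : realType) (d : nat) :
  symmetric (@int_lattice_rel R d).
Proof.
by move=> x y; apply: eq_forallb => j; rewrite -rpredN opprB.
Qed.

Lemma int_lattice_trans (R : realType) (d : nat) :
  transitive (@int_lattice_rel R d).
Proof.
move=> y x z /forallP xy /forallP yz; apply/forallP => j.
by rewrite -(subrK (y ord0 j) (x ord0 j)) -addrA rpredD.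
Qed.

Canonical int_lattice_equiv (R : realType) (d : nat) :=
  EquivRel (@int_lattice_rel R d) (@int_lattice_refl R d)
    (@int_lattice_sym R d) (@int_lattice_trans R d).

Definition torus (R : realType) (d : nat) : Type :=
  {eq_quot (@int_lattice_rel R d)}.

HB.instance Definition _ (R : realType) (d : nat) := Choice.on (torus R d).

Definition to_torus (R : realType) (d : nat) (x : 'rV[R]_d) : torus R d :=
  (\pi_({eq_quot (@int_lattice_rel R d)}) x)%qT.

Lemma to_torus_eq (R : realType) (d : nat) (x y : 'rV[R]_d) :
  to_torus x = to_torus y <-> int_lattice_rel x y.
Proof.
split=> [/eqmodP//|xy]; exact/eqmodP.
Qed.

Lemma to_torus_surj (R : realType) (d : nat) (p : torus R d) :
  exists x, to_torus x = p.
Proof. by exists (repr (p : {eq_quot _})); rewrite /to_torus reprK. Qed.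

(* The norm is the sup norm of ['rV[R]_d]; the Euclidean norm gives a
   bi-Lipschitz equivalent metric, hence the same packing dimensions. *)
Definition torus_dists (R : realType) (d : nat) (p q : torus R d) : set R :=
  [set r | exists x y : 'rV[R]_d,
     [/\ to_torus x = p, to_torus y = q & r = `|x - y|]].

Definition torus_dist (R : realType) (d : nat) (p q : torus R d) : R :=
  inf (torus_dists p q).

Lemma torus_dists_has_inf (R : realType) (d : nat) (p q : torus R d) :
  has_inf (torus_dists p q).
Proof.
split; last by exists 0 => _ [x [y [_ _ ->]]].
have [x xp] := to_torus_surj p; have [y yq] := to_torus_surj q.
by exists `|x - y|, x, y.
Qed.

Lemma torus_dist_ge0 (R : realType) (d : nat) (p q : torus R d) :
  0 <= torus_dist p q.
Proof.
apply: lb_le_inf; first exact: (torus_dists_has_inf p q).1.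
by move=> _ [x [y [_ _ ->]]].
Qed.

Lemma torus_dist_le (R : realType) (d : nat) (x y : 'rV[R]_d) :
  torus_dist (to_torus x) (to_torus y) <= `|x - y|.
Proof.
by apply: ge_inf; [exact: (torus_dists_has_inf _ _).2|exists x, y].
Qed.

Lemma torus_dist_approx (R : realType) (d : nat) (x : 'rV[R]_d)
    (q : torus R d) (e : R) : 0 < e ->
  exists2 y, to_torus y = q & `|x - y| < torus_dist (to_torus x) q + e.
Proof.
move=> e0; have [_ [x' [y [xx' yq ->]]] lte] :=
  inf_adherent e0 (torus_dists_has_inf (to_torus x) q).
exists (y + (x - x')); last by rewrite opprD opprB addrC -addrA subrK addrC.
move/to_torus_eq/forallP : xx' => xx'.
rewrite -yq; apply/to_torus_eq/forallP => j; rewrite !mxE addrAC subrr add0r.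
by rewrite -rpredN opprB.
Qed.

Lemma torus_distxx (R : realType) (d : nat) (p : torus R d) :
  torus_dist p p = 0.
Proof.
have [x <-] := to_torus_surj p.
apply/le_anti; rewrite torus_dist_ge0 andbT.
by rewrite (le_trans (torus_dist_le _ _))// subrr normr0.
Qed.

Lemma torus_dist_sym (R : realType) (d : nat) (p q : torus R d) :
  torus_dist p q = torus_dist q p.
Proof.
congr inf; apply/seteqP; split=> _ [x [y [xp yq ->]]];
  by exists y, x; split=> //; rewrite distrC.
Qed.

Lemma torus_dist_triangle (R : realType) (d : nat) (q p r : torus R d) :
  torus_dist p r <= torus_dist p q + torus_dist q r.
Proof.
apply/ler_addgt0Pl => e e0.
have [x xp] := to_torus_surj p.
have e20 : 0 < e / 2 by rewrite divr_gt0.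
have [y yq xy] := torus_dist_approx x q e20.
have [z zr yz] := torus_dist_approx y r e20.
move: xy yz; rewrite yq xp => xy yz.
rewrite -xp -zr (le_trans (torus_dist_le _ _))// xp zr.
rewrite (le_trans (ler_distD y _ _))// (le_trans (lerD (ltW xy) (ltW yz)))//.
by rewrite addrACA -splitr addrC.
Qed.

Lemma torus_dist_eq0 (R : realType) (d : nat) (p q : torus R d) :
  torus_dist p q = 0 -> p = q.
Proof.
have [x <-] := to_torus_surj p => xq0.
have approx e : 0 < e -> exists2 y, to_torus y = q & `|x - y| < e.
  by move=> e0; have [y yq] := torus_dist_approx x q e0;
     rewrite xq0 add0r; exists y.
have h0 : 0 < 2^-1 :> R by rewrite invr_gt0.
have [y yq xy] := approx _ h0.
suff -> : x = y by [].
apply/subr0_eq/normr0_eq0/le_anti; rewrite normr_ge0 andbT.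
apply/ler_addgt0Pl => e e0; rewrite addr0.
have [z zq xz] : exists2 z, to_torus z = q & `|x - z| < Num.min e 2^-1.
  by apply: approx; rewrite lt_min e0 h0.
move: xz; rewrite lt_min => /andP[xze xz2].
suff -> : y = z by rewrite ltW.
have /to_torus_eq/forallP yzint : to_torus y = to_torus z by rewrite yq zq.
have yz1 : `|y - z| < 1.
  rewrite (le_lt_trans (ler_distD x _ _))// (splitr 1) !mul1r.
  by rewrite ltrD// distrC.
have yzE (j : 'I_d) : `|y ord0 j - z ord0 j| <= `|y - z|.
  rewrite [leRHS]/Num.norm /= mx_normrE; apply/bigmax_geP; right => /=.
  by exists (ord0, j) => //; rewrite !mxE.
apply/rowP => j; apply/eqP; rewrite -subr_eq0; apply: contraT => yz0.
have := norm_intr_ge1 (yzint j) yz0.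
by rewrite leNgt (le_lt_trans (yzE j)).
Qed.

HB.instance Definition _ (R : realType) (d : nat) :=
  isMetric.Build R (torus R d) (@torus_distxx R d) (@torus_dist_eq0 R d)
    (@torus_dist_sym R d) (@torus_dist_triangle R d).

Definition mball (R : realType) (T : metricType R) (x : T) (r : R) : set T :=
  [set y | mdist x y <= r].

(* Countable (possibly finite, indexed by [I]) families of pairwise disjoint
   closed balls with centres in [F] and radii at most [delta]; a ball of
   radius [r] contributes [(2 r)^s]. *)
Definition packing_size (R : realType) (T : metricType R) (s delta : R)
    (F : set T) : \bar R :=
  ereal_sup [set v | exists (I : set nat) (c : nat -> T) (r : nat -> R),
    [/\ forall i, I i -> F (c i),
        forall i, I i -> 0 < r i <= delta,
        trivIset I (fun i => mball (c i) (r i)) &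
        v = (\esum_(i in I) ((2 * r i) `^ s)%:E)%E]].

(* [packing_size] is nondecreasing in [delta], so the infimum is the limit as
   [delta] tends to 0. *)
Definition packing_premeasure (R : realType) (T : metricType R) (s : R)
    (F : set T) : \bar R :=
  ereal_inf [set packing_size s delta F | delta in [set delta : R | 0 < delta]].

Definition packing_measure (R : realType) (T : metricType R) (s : R)
    (F : set T) : \bar R :=
  ereal_inf [set (\sum_(0 <= i <oo) packing_premeasure s (G i))%E |
    G in [set G : nat -> set T | F `<=` \bigcup_i G i]].

Definition packing_dim (R : realType) (T : metricType R) (F : set T) : \bar R :=
  ereal_inf [set s%:E | s in
    [set s : R | 0 <= s /\ packing_measure s F = 0%E]].

Definition invariant_measure (R : realType) (disp : measure_display)
    (X : measurableType disp) (f : X -> X) (mu : probability X R) : Prop :=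
  forall A, measurable A -> mu (f @^-1` A) = mu A.

(* A finite measurable partition is given by its labelling [xi : X -> 'I_m]. *)
Definition finite_partition (disp : measure_display) (X : measurableType disp)
    (m : nat) (xi : X -> 'I_m) : Prop :=
  forall i, measurable (xi @^-1` [set i]).

(* The atoms of the join of [xi], [f^-1 xi], up to [f^-(n-1) xi] are coded by
   words [w] of length [n] in the labels; some of them may be empty. *)
Definition join_atom (X : Type) (f : X -> X) (m : nat) (xi : X -> 'I_m)
    (n : nat) (w : n.-tuple 'I_m) : set X :=
  [set x | forall i : 'I_n, xi (iter i f x) = tnth w i].

(* [ln 0 = 0], so empty or null atoms contribute 0. *)
Definition join_entropy (R : realType) (disp : measure_display)
    (X : measurableType disp) (f : X -> X) (mu : probability X R)
    (m : nat) (xi : X -> 'I_m) (n : nat) : R :=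
  - \sum_(w : n.-tuple 'I_m)
      fine (mu (join_atom f xi w)) * ln (fine (mu (join_atom f xi w))).

(* The limit exists by subadditivity when [mu] is invariant and [xi] is
   measurable. *)
Definition partition_entropy (R : realType) (disp : measure_display)
    (X : measurableType disp) (f : X -> X) (mu : probability X R)
    (m : nat) (xi : X -> 'I_m) : R :=
  limn (fun n => join_entropy f mu xi n / n%:R).

Definition entropy (R : realType) (disp : measure_display)
    (X : measurableType disp) (f : X -> X) (mu : probability X R) : \bar R :=
  ereal_sup [set h | exists (m : nat) (xi : X -> 'I_m),
    finite_partition xi /\ h = (partition_entropy f mu xi)%:E].

Definition max_entropy_measure (R : realType) (disp : measure_display)
    (X : measurableType disp) (f : X -> X) (mu : probability X R) : Prop :=
  invariant_measure f mu /\
  forall nu : probability X R, invariant_measure f nu ->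
    (entropy f nu <= entropy f mu)%E.

Definition fullshift (X : pointedType) : Type :=
  prod_topology (fun _ : nat => discrete_topology X).

HB.instance Definition _ (X : pointedType) :=
  Topological.copy (fullshift X)
    (prod_topology (fun _ : nat => discrete_topology X)).
HB.instance Definition _ (X : pointedType) :=
  isPointed.Build (fullshift X) (fun _ => point).

HB.instance Definition _ (X : pointedType) := Measurable.copy (fullshift X)
  (g_sigma_algebraType (@open (fullshift X))).

Definition left_shift (X : pointedType) (w : fullshift X) : fullshift X :=
  fun n => w n.+1.

(* The nonemptiness proof is part of the type because the measurable types of
   the library are pointed. *)
Definition alphabet (T : finType) (A : {set T}) (A0 : A != finset.set0) : Type :=
  {x : T | x \in A}.

HB.instance Definition _ (T : finType) (A : {set T}) (A0 : A != finset.set0) :=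
  Finite.on (alphabet A0).

Definition alphabet_point (T : finType) (A : {set T}) (A0 : A != finset.set0) :
  alphabet A0 :=
  let e := elimT (set0Pn A) A0 in exist _ (xchoose e) (xchooseP e).

HB.instance Definition _ (T : finType) (A : {set T}) (A0 : A != finset.set0) :=
  isPointed.Build (alphabet A0) (alphabet_point A0).

(* Coordinates are numbered from 0, so [eta k] for [k = 0] is the identity up to
   the renaming of the index type. *)
Definition digit (d : nat) (a : 'I_d -> nat) : finType :=
  {dffun forall q : 'I_d, 'I_(a q)}.

Definition tail_digit (d : nat) (a : 'I_d -> nat) (k : 'I_d) : finType :=
  {dffun forall q : {q : 'I_d | (k <= q)%N}, 'I_(a (val q))}.

Definition eta (d : nat) (a : 'I_d -> nat) (k : 'I_d) (i : digit a) :
  tail_digit a k := [ffun q => i (val q)].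

Lemma eta_imset_neq0 (d : nat) (a : 'I_d -> nat) (D : {set digit a})
    (D0 : D != finset.set0) (k : 'I_d) : @eta d a k @: D != finset.set0.
Proof.
by have /set0Pn[i iD] := D0; apply/set0Pn; exists (eta k i); exact: imset_f.
Qed.

Definition Sigma (d : nat) (a : 'I_d -> nat) (D : {set digit a})
    (D0 : D != finset.set0) : Type := fullshift (alphabet D0).

Definition Sigma_ (d : nat) (a : 'I_d -> nat) (D : {set digit a})
    (D0 : D != finset.set0) (k : 'I_d) : Type :=
  fullshift (alphabet (eta_imset_neq0 D0 k)).

Definition eta_alphabet (d : nat) (a : 'I_d -> nat) (D : {set digit a})
    (D0 : D != finset.set0) (k : 'I_d) (i : alphabet D0) :
  alphabet (eta_imset_neq0 D0 k) :=
  exist _ (eta k (val i)) (imset_f (@eta d a k) (valP i)).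

Definition chi (d : nat) (a : 'I_d -> nat) (D : {set digit a})
    (D0 : D != finset.set0) (k : 'I_d) (w : Sigma D0) : Sigma_ D0 k :=
  fun n => eta_alphabet k (w n).

(* Sequences are indexed from 0, whereas the digit expansions start at
   [a_q ^ -1], so the [n]-th digit has weight [a_q ^ -(n+1)]. *)
Definition Pi (R : realType) (d : nat) (a : 'I_d -> nat) (D : {set digit a})
    (D0 : D != finset.set0) (w : Sigma D0) : torus R d :=
  to_torus (\row_(q < d)
    limn (series (fun n => (val (w n) q)%:R / (a q)%:R ^+ n.+1 : R))).

Definition sponge (R : realType) (d : nat) (a : 'I_d -> nat)
    (D : {set digit a}) (D0 : D != finset.set0) : set (torus R d) :=
  range (@Pi R d a D D0).

Definition birkhoff_average (R : realType) (X : pointedType)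
    (phi : fullshift X -> R) (n : nat) (w : fullshift X) : R :=
  n%:R^-1 * \sum_(l < n) phi (iter l (@left_shift X) w).

Definition level_set (R : realType) (d : nat) (a : 'I_d -> nat)
    (D : {set digit a}) (D0 : D != finset.set0) (phi : Sigma D0 -> R)
    (alpha : R) : set (torus R d) :=
  @Pi R d a D D0 @`
    [set w | (fun n => birkhoff_average phi n w) @ \oo --> alpha].

Definition attainable (R : realType) (X : pointedType)
    (phi : fullshift X -> R) : set R :=
  [set alpha | exists2 mu : probability (fullshift X) R,
     invariant_measure (@left_shift X) mu & \int[mu]_w phi w = alpha].

(* Main.v *)
Require Import Defs.
From HB Require Import structures.
From mathcomp Require Import all_boot all_order all_algebra.
From mathcomp Require Import all_classical all_reals all_analysis measurable_realfun.
From mathcomp Require Import ring lra zify.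

(** Write [N_j] for the number of letters of [eta_j(D)], let [e_j] pick one
    digit in each class of [eta_j], and let
      t = sum_j (1 / log2 a_j - 1 / log2 a_(j-1)) log2 N_j,
    where the term [1 / log2 a_0] is 0 for the first index.  At the scale [2^-n]
    a point of the sponge is located, up to bounded multiplicity, by its [q]-th
    digits up to a level [L_q(n)] close to [n / log2 a_q].  These levels increase
    with [q], so the digits at the positions between [L_(j-1)(n)] and [L_j(n)]
    are seen only through [eta_j], and [t] is the exponent of the number of
    codes ([box_dim]).

    Dimensions and measures are compared through a condition on words,
    [upper_mean e_j phi alpha]: for every [k], if [c] is drawn uniformly among
    the [N_j^k] words over the letters fixed by [e_j], then the mean of the
    largest [k]-th Birkhoff sum of [phi] on the sequences lying over [c] is at
    least [k * alpha].  Say that [alpha] is full if this holds for all [j], both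
    for [phi], [alpha] and for [-phi], [-alpha].

    A measure of maximal entropy of a full shift gives the same mass to all the
    words of a given length ([max_entropy_uniform]).  Otherwise some finite
    distribution of words is not uniform, and the Gibbs inequality keeps the
    entropy away from the value reached by the uniform measure.  So [mu_j]
    projects to [b_j] exactly when the words over the [j]-th factor have mass
    [N_j^-k].  Integrating Birkhoff sums against such an invariant [mu_j] gives
    the two conditions for [alpha] equal to the integral of [phi]
    ([upper_mean_integral]).  Conversely, averaging along the orbit segments of
    extremal lifts of all words, and passing to the limit along an ultrafilter,
    turns the two conditions into such a [mu_j] ([invariant_of_upper_mean]).
    Hence [alpha] is full exactly when measures [mu_j] over the [b_j] exist whose
    integrals of [phi] all equal [alpha].

    If a condition fails for some [j] and [k], then by a Chernoff bound all but
    an exponentially small proportion of the long words over the [j]-th factor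
    only have lifts whose Birkhoff sums are too small.  The points of the level
    set are exceptional on the positions between [L_(j-1)(n)] and [L_j(n)] at
    every scale, and this lowers the exponent of the number of codes below [t]
    ([level_set_dim_lt]).

    If [alpha] is full, then at least half of the long words over each factor
    have a lift whose Birkhoff average is close to [alpha] ([good_words]).  By
    the Chernoff bound, most words have a lift with a large enough sum and one
    with a small enough sum, and one can interpolate between the two.  Given
    [s < t] and countably many sets of finite packing premeasure of exponent
    [s], a finite prefix is extended by good words so as to leave the first set:
    the extensions contain too many separated points for all of them to be met
    by it ([avoid_exists]).  Iterating with better and better words yields a
    point of the level set in none of the sets, so the level set has packing
    dimension at least [t] ([level_set_dim_ge]).  For [phi = 0] this computes
    the dimension of the sponge, which is [t] ([packing_dim_sponge]).

    When [t = 0] all the [N_j] are 1, and then every invariant measure projects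
    to [b_j]. *)

Set Implicit Arguments.
Unset Strict Implicit.
Unset Printing Implicit Defensive.
Import Order.TTheory GRing.Theory Num.Theory.
Import numFieldNormedType.Exports.
Local Open Scope classical_set_scope.
Local Open Scope ring_scope.

(** * Cylinders of a full shift *)

Section shift.
Variables (T : finType) (S : {set T}) (S0 : S != finset.set0).
Local Notation A := (alphabet S0).
Local Notation Sh := (fullshift A).

Definition agree n (w w' : Sh) := forall i, (i < n)%N -> w i = w' i.

Definition head_word n (w : Sh) : {ffun 'I_n -> A} := [ffun i : 'I_n => w i].

Definition ext n (u : {ffun 'I_n -> A}) : Sh :=
  fun i => if insub i is Some j then u j else point.

Lemma head_word_agree n w w' : head_word n w = head_word n w' <-> agree n w w'.
Proof.
split=> [/ffunP ww' i lin|ww'].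
  by have := ww' (Ordinal lin); rewrite !ffunE.
by apply/ffunP => i; rewrite !ffunE ww'.
Qed.

Lemma extK n : cancel (@ext n) (head_word n).
Proof. by move=> u; apply/ffunP => i; rewrite ffunE /ext valK. Qed.

Lemma head_word_mkseq n (w w' : Sh) :
  head_word n w = head_word n w' <-> mkseq w n = mkseq w' n.
Proof.
rewrite head_word_agree; split=> [h|h i lin].
  by apply/eq_in_map => i; rewrite mem_iota => /h.
by rewrite -(nth_mkseq point w lin) -(nth_mkseq point w' lin) h.
Qed.

Lemma agree_sym n w w' : agree n w w' -> agree n w' w.
Proof. by move=> ww' i lin; rewrite ww'. Qed.

Lemma agree_trans n w2 w1 w3 : agree n w1 w2 -> agree n w2 w3 -> agree n w1 w3.
Proof. by move=> h1 h2 i lin; rewrite h1 ?h2. Qed.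

Lemma agree_leq m n w w' : (m <= n)%N -> agree n w w' -> agree m w w'.
Proof. by move=> lemn h i lim; apply: h; exact: leq_trans lemn. Qed.

(** The product topology is the supremum of the topologies pulled back from the
    coordinates, and the filter of cylinders refines each of them. *)
Lemma nbhs_agree (w : Sh) (U : set Sh) :
  nbhs w U -> exists n, forall w', agree n w w' -> U w'.
Proof.
pose F : set_system Sh := filter_from setT (fun n => [set w' | agree n w w']).
have FF : Filter F.
  apply: filter_from_filter; first by exists 0%N.
  move=> m n _ _; exists (maxn m n) => // w' h; split; apply: agree_leq h.
    exact: leq_maxl.
  exact: leq_maxr.
have Fw : F --> w.
  apply/cvg_sup => N V [W] [[Q oQ <-]] QwN QV.
  exists N.+1 => // w' h; apply: QV; rewrite /= -h//.
by move=> /Fw[n _ nU]; exists n => w' h; exact: nU.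
Qed.

Lemma open_coord (i : nat) (c : A) : open [set w : Sh | w i = c].
Proof.
pose p (w : Sh) : discrete_topology A := w i.
have pc : continuous p.
  exact: (@proj_continuous nat (fun _ => discrete_topology A) i).
exact: (@open_comp _ _ p [set c] (fun x _ => @pc x) (discrete_open _)).
Qed.

Lemma open_agree n w : open [set w' : Sh | agree n w w'].
Proof.
elim: n => [|n IH].
  by rewrite (_ : mkset _ = setT)//; [exact: openT|apply/seteqP; split].
rewrite (_ : mkset _ = [set w' | agree n w w'] `&` [set w' | w' n = w n]).
  by apply: openI => //; exact: open_coord.
apply/seteqP; split=> w' /=.
  by move=> h; split; [exact: agree_leq h|rewrite h].
move=> [h hn] i; rewrite ltnS leq_eqVlt => /orP[/eqP->//|]; exact: h.
Qed.

Lemma fullshift_compact : compact [set: Sh].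
Proof.
have := @tychonoff nat (fun _ => discrete_topology A) (fun=> setT).
rewrite (_ : [set f | _] = setT); last by apply/seteqP; split.
apply=> i; apply: finite_compact.
exact: (@finite_finset A).
Qed.

(** Compactness turns a rank of agreement that depends on the point into a uniform
    one; uniform continuity is an instance. *)
Lemma agree_compact_unif (P : nat -> Sh -> Prop) :
  (forall w, exists N, forall n w', (N <= n)%N -> agree N w w' -> P n w') ->
  exists n, forall w, P n w.
Proof.
move=> HP; have /compact_near_coveringP := fullshift_compact.
move=> /(_ nat \oo P _) [].
  move=> w _; have [N HN] := HP w.
  exists ([set w' | agree N w w'], [set n | (N <= n)%N]) => /=.
    split; last by exists N.
    by apply: open_nbhs_nbhs; split=> //; exact: open_agree.
  by move=> [w' n] /= [h1 h2]; exact: HN.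
by move=> N _ HN; exists N => w; exact: (HN N (leqnn N) w I).
Qed.

Section unif.
Variables (R : realType) (phi : Sh -> R).
Hypothesis phi_cont : continuous phi.

Lemma continuous_unif e : 0 < e ->
  exists n, forall w w', agree n w w' -> `|phi w - phi w'| < e.
Proof.
move=> e0.
have [n Hn] : exists n, forall w, forall w', agree n w w' ->
    `|phi w - phi w'| < e.
  apply: (@agree_compact_unif
    (fun n w => forall w', agree n w w' -> `|phi w - phi w'| < e)) => w.
  have e20 : 0 < e / 2 by rewrite divr_gt0.
  have /cvgrPdist_lt /(_ _ e20) := @phi_cont w.
  move=> /nbhs_agree[N HN]; exists N => n w1 Nn ww1 w2 w12.
  rewrite (le_lt_trans (ler_distD (phi w) _ _))// (splitr e) ltrD//.
    by rewrite distrC; exact: HN.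
  by apply: HN; apply: agree_trans ww1 _; exact: agree_leq w12.
by exists n => w; exact: Hn.
Qed.

Lemma continuous_bounded : exists2 B, 0 < B & forall w, `|phi w| <= B.
Proof.
have [n Hn] := continuous_unif (@ltr01 R).
exists (1 + \sum_(u : {ffun 'I_n -> A}) `|phi (ext u)|).
  by rewrite ltr_pwDl// sumr_ge0.
move=> w; rewrite -(subrK (phi (ext (head_word n w))) (phi w)).
rewrite (le_trans (ler_normD _ _))// lerD//.
  by apply/ltW/Hn/head_word_agree; rewrite extK.
by rewrite (bigD1 (head_word n w))//= lerDl sumr_ge0.
Qed.
End unif.

Definition fin_determined (C : set Sh) :=
  exists n, forall w w', agree n w w' -> C w -> C w'.

Lemma measurable_agree n w : measurable [set w' : Sh | agree n w w'].
Proof. by apply: sub_sigma_algebra; exact: open_agree. Qed.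

Lemma measurable_head_word n (P : set {ffun 'I_n -> A}) :
  measurable (head_word n @^-1` P).
Proof.
rewrite (_ : _ @^-1` _ = \bigcup_(u in P) [set w | agree n (ext u) w]).
  apply: fin_bigcup_measurable => [|u _]; first exact: finite_finset.
  exact: measurable_agree.
apply/seteqP; split=> [w Pw|w [u Pu uw]].
  by exists (head_word n w) => //; apply/head_word_agree; rewrite extK.
by move/head_word_agree : uw; rewrite extK /preimage /= => <-.
Qed.

Lemma fin_determinedE (C : set Sh) : fin_determined C ->
  exists n (P : set {ffun 'I_n -> A}), C = head_word n @^-1` P.
Proof.
move=> [n Hn]; exists n, [set u | C (ext u)]; apply/seteqP; split => w /=.
  by apply: Hn; apply/head_word_agree; rewrite extK.
by apply: Hn; apply/head_word_agree; rewrite extK.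
Qed.

Lemma fin_determinedI : setI_closed fin_determined.
Proof.
move=> C D [m Hm] [n Hn]; exists (maxn m n) => w w' h [Cw Dw]; split.
  by apply: Hm Cw; apply: agree_leq h; exact: leq_maxl.
by apply: Hn Dw; apply: agree_leq h; exact: leq_maxr.
Qed.

(** The shift is second countable: an open set is the union over [n] of the
    cylinders of length [n] that it contains. *)
Lemma borel_fin_determined : @measurable _ Sh = <<s fin_determined >>.
Proof.
have sF : sigma_algebra setT <<s (@fin_determined) >>.
  exact: smallest_sigma_algebra.
have sM : sigma_algebra setT (@measurable _ Sh).
  by split=> [|E mE|F mF]; [exact: measurable0|rewrite setTD; exact: measurableC|
    exact: bigcupT_measurable].
apply/seteqP; split.
  apply: (smallest_sub sF) => O oO.
  rewrite (_ : O = \bigcup_n [set w | forall w', agree n w w' -> O w']).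
    case: sF => _ _; apply=> n.
    apply: sub_sigma_algebra; exists n => w w' ww' h w2 w'2.
    by apply: h; exact: agree_trans w'2.
  apply/seteqP; split=> [w Ow|w [n _]]; last exact.
  have /nbhs_agree[n Hn] : nbhs w O by apply: open_nbhs_nbhs.
  by exists n.
by apply: (smallest_sub sM) => C /fin_determinedE[n [P ->]]; exact: measurable_head_word.
Qed.
End shift.

(** * Finitely valued random variables *)

Section fin_valued.
Variables (R : realType) (disp : measure_display) (X : measurableType disp).
Variable mu : probability X R.

(** Real-valued masses, so that sums and logarithms stay in [R]. *)
Definition Pr (E : set X) : R := fine (mu E).

Lemma PrE E : measurable E -> mu E = (Pr E)%:E.
Proof. by move=> mE; rewrite /Pr fineK// fin_num_measure. Qed.

Lemma Pr_ge0 E : 0 <= Pr E. Proof. exact/fine_ge0/measure_ge0. Qed.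

Lemma PrT : Pr setT = 1. Proof. by rewrite /Pr probability_setT. Qed.

Lemma Pr0 : Pr set0 = 0. Proof. by rewrite /Pr measure0. Qed.

Lemma Pr_le E F : measurable E -> measurable F -> E `<=` F -> Pr E <= Pr F.
Proof.
move=> mE mF EF; rewrite -lee_fin -!PrE//.
by apply: le_measure; rewrite ?inE.
Qed.

Definition fin_measurable (I : finType) (V : X -> I) :=
  forall i, measurable (V @^-1` [set i]).

Lemma fin_measurable_set (I : finType) (V : X -> I) (P : set I) :
  fin_measurable V -> measurable (V @^-1` P).
Proof.
move=> mV; rewrite (_ : _ @^-1` _ = \bigcup_(i in P) V @^-1` [set i]).
  by apply: fin_bigcup_measurable => //; exact: finite_finset.
apply/seteqP; split=> [x Px|x [i Pi /= ->//]].
by exists (V x).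
Qed.

Lemma fin_measurable_comp (I J : finType) (V : X -> I) (g : I -> J) :
  fin_measurable V -> fin_measurable (g \o V).
Proof. by move=> mV j; rewrite comp_preimage; exact: fin_measurable_set. Qed.

Lemma fin_measurable_pair (I J : finType) (V : X -> I) (W : X -> J) :
  fin_measurable V -> fin_measurable W ->
  fin_measurable (fun x => (V x, W x)).
Proof.
move=> mV mW [i j].
rewrite (_ : _ @^-1` _ = V @^-1` [set i] `&` W @^-1` [set j]).
  by apply: measurableI.
by apply/seteqP; split=> x /= => [[-> ->]|[-> ->]].
Qed.

(** Total probability over the values of a finite random variable. *)
Lemma Pr_split (I : finType) (V : X -> I) (E : set X) :
  fin_measurable V -> measurable E ->
  Pr E = \sum_i Pr (E `&` V @^-1` [set i]).
Proof.
move=> mV mE; apply: EFin_inj; rewrite -PrE// -sumEFin.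
have mEi i : measurable (E `&` V @^-1` [set i]) by exact: measurableI.
under eq_bigr do rewrite -PrE//.
rewrite {1}(_ : E = \bigcup_(i in [set: I]) (E `&` V @^-1` [set i])).
  rewrite measure_fin_bigcup//; first last.
  - apply/trivIsetP => i j _ _ ij; apply/seteqP; split => // x /=.
    by move=> [[_ Vi] [_ Vj]]; move: ij; rewrite -Vi -Vj eqxx.
  - exact: finite_finset.
  rewrite (fsbigE (index_enum I)) ?index_enum_uniq//.
    by apply: eq_bigl => i; rewrite in_setT.
  by move=> i _; rewrite mem_index_enum.
by apply/seteqP; split=> [x Ex|x [i _ []//]]; exists (V x).
Qed.
End fin_valued.

(** * Measures with prescribed cylinder masses *)

Section leb01.
Variable R : realType.

Definition leb01 := mrestr (@lebesgue_measure R) (measurable_itv `[(0:R), 1[).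
HB.instance Definition _ := Measure.on leb01.

Lemma leb01_itv (x y : R) : 0 <= x -> x <= y -> y <= 1 ->
  leb01 `[x, y[%classic = (y - x)%:E.
Proof.
move=> x0 xy y1; rewrite /leb01 /mrestr /= (_ : _ `&` _ = `[x, y[%classic).
  rewrite lebesgue_measure_itv /= lte_fin.
  have [_|yx] := ltP x y; first by rewrite EFinB.
  by rewrite (@le_anti _ _ x y) ?xy// subrr.
apply/seteqP; split=> z /=; first by case.
rewrite !in_itv /= => /andP[xz zy]; rewrite xz zy; split=> //.
by rewrite (le_trans x0 xz) (lt_le_trans zy y1).
Qed.

Lemma leb01T : leb01 setT = 1%E.
Proof.
rewrite /leb01 /mrestr setTI -[LHS]/(lebesgue_measure _) lebesgue_measure_itv.
by rewrite /= lte_fin ltr01 oppr0 adde0.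
Qed.
HB.instance Definition _ := @Measure_isProbability.Build _ _ R leb01 leb01T.
End leb01.

Section cylinder_masses.
Variables (R : realType) (T : finType) (S : {set T}) (S0 : S != finset.set0).
Local Notation A := (alphabet S0).
Local Notation Sh := (fullshift A).
Variable m : seq A -> R.
Hypothesis m_ge0 : forall s, 0 <= m s.
Hypothesis m_nil : m [::] = 1.
Hypothesis m_rcons : forall s, m s = \sum_(a : A) m (rcons s a).

Let cum s k := \sum_(a : A | (enum_rank a < k)%N) m (rcons s a).

Let cum0 s : cum s 0 = 0. Proof. exact: big_pred0. Qed.

Let cumS s (a : A) : cum s (enum_rank a).+1 = cum s (enum_rank a) + m (rcons s a).
Proof.
rewrite /cum (bigD1 a)//= addrC; congr (_ + _); apply: eq_bigl => b.
rewrite ltnS [RHS]ltn_neqAle andbC; congr (_ && _).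
by rewrite (inj_eq val_inj) (inj_eq enum_rank_inj).
Qed.

Let cumN s : cum s #|{: A}| = m s.
Proof. by rewrite m_rcons /cum; apply: eq_bigl => a; rewrite ltn_ord. Qed.

Let cum_le s i j : (i <= j)%N -> cum s i <= cum s j.
Proof.
move=> ij; rewrite /cum [leRHS](bigID (fun a : A => (enum_rank a < i)%N))/=.
rewrite (eq_bigl (fun a : A => (enum_rank a < j)%N && (enum_rank a < i)%N)).
  by rewrite lerDl sumr_ge0.
by move=> a; case: (ltnP _ i) => ai; rewrite ?andbF// (leq_trans ai ij).
Qed.

Let selP s y (a : A) := cum s (enum_rank a) <= y < cum s (enum_rank a).+1.

Let sel_ex s y : 0 <= y < m s -> exists a, selP s y a.
Proof.
move=> /andP[y0 ys].
have ex : exists k, y < cum s k by exists #|{: A}|; rewrite cumN.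
case: (ex_minnP ex) => -[|k] yk kmin; first by move: yk; rewrite cum0 ltNge y0.
have kA : (k < #|{: A}|)%N by apply: kmin; rewrite cumN.
exists (enum_val (Ordinal kA)); rewrite /selP enum_valK /= yk andbT leNgt.
by apply/negP => /kmin; rewrite ltnn.
Qed.

Let sel_uniq s y a b : selP s y a -> selP s y b -> a = b.
Proof.
move=> /andP[a1 a2] /andP[b1 b2]; apply: enum_rank_inj; apply: val_inj.
apply/eqP; rewrite eqn_leq; apply/andP; split; rewrite leqNgt; apply/negP.
  by move=> /(cum_le s)/le_trans /(_ a1); rewrite leNgt b2.
by move=> /(cum_le s)/le_trans /(_ b1); rewrite leNgt a2.
Qed.

Let sel s y : A := odflt point [pick a | selP s y a].

Let selE s y a : selP s y a -> sel s y = a.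
Proof.
move=> h; rewrite /sel; case: pickP => [b hb|/(_ a)]; last by rewrite h.
exact: sel_uniq hb h.
Qed.

(** The real component is the position of the point relative to the left end of
    its current interval. *)
Let next (p : seq A * R) : seq A * R :=
  (rcons p.1 (sel p.1 p.2), p.2 - cum p.1 (enum_rank (sel p.1 p.2))).

(** Points outside [0, 1) are sent to the code of 0, to have a total function. *)
Let state (x : R) n := iter n next ([::], if 0 <= x < 1 then x else 0).

Let code (x : R) : Sh := fun n => sel (state x n).1 (state x n).2.

Let state_code x n : (state x n).1 = mkseq (code x) n.
Proof. by elim: n => // n IH; rewrite mkseqS -IH. Qed.

Let state_itv s : exists f, [/\ 0 <= f, f + m s <= 1 &
  forall x, 0 <= x < 1 ->
    ((state x (size s)).1 = s <-> f <= x < f + m s) /\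
    ((state x (size s)).1 = s -> (state x (size s)).2 = x - f)].
Proof.
elim/last_ind: s => [|s a [f [f0 f1 Hf]]].
  exists 0; rewrite m_nil add0r; split => // x x01; rewrite /= x01 subr0.
  by split.
have cm : cum s (enum_rank a).+1 <= m s.
  by rewrite -(cumN s); apply: cum_le; exact: ltn_ord.
have c0 : 0 <= cum s (enum_rank a) by rewrite -(cum0 s) cum_le.
exists (f + cum s (enum_rank a)); split.
- by rewrite addr_ge0.
- by rewrite -addrA -cumS (le_trans _ f1)// lerD2l.
move=> x x01; have [iffx yx] := Hf _ x01.
have lastE : (state x (size s).+1).1 = rcons s a <->
    (state x (size s)).1 = s /\ sel s (x - f) = a.
  split=> /=.
    move=> /rcons_inj[e1 e2]; split=> //; by move: e2; rewrite e1 yx.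
  by move=> [e1 <-]; rewrite e1 yx.
rewrite size_rcons; split.
  split=> [/lastE[e1 e2]|/andP[h1 h2]].
    have := iffx.1 e1 => /andP[fx xf].
    have [b hb] : exists b, selP s (x - f) b.
      by apply: sel_ex; rewrite subr_ge0 fx ltrBlDl.
    move: hb (selE hb); rewrite e2 => hb eb; move: hb; rewrite -eb /selP.
    by rewrite cumS lerBrDl ltrBlDl addrA.
  have hs : selP s (x - f) a by rewrite /selP cumS lerBrDl ltrBlDl addrA h1.
  apply/lastE; split; last exact: selE.
  apply/iffx; rewrite (le_trans _ h1) ?lerDl//=.
  by rewrite (lt_le_trans h2)// -addrA -cumS lerD2l.
move=> /[dup] h /lastE[e1 e2]; move: h => /=.
by rewrite e1 yx// e2 => _; rewrite opprD addrA.
Qed.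

Let code_itv s : exists f, [/\ 0 <= f, f + m s <= 1 &
  forall x, 0 <= x < 1 -> mkseq (code x) (size s) = s <-> f <= x < f + m s].
Proof.
have [f [f0 f1 Hf]] := state_itv s; exists f; split => // x x01.
by rewrite -state_code; have [] := Hf _ x01.
Qed.

Let measurable_code_cyl s :
  measurable [set x : measurableTypeR R | mkseq (code x) (size s) = s].
Proof.
have [f [f0 f1 Hf]] := code_itv s.
rewrite (_ : mkset _ = (`[f, (f + m s)[%classic `&` `[0, 1[%classic) `|`
  (~` `[0, 1[%classic `&` [set _ | mkseq (code 0) (size s) = s])); last first.
  apply/seteqP; split => x /=; rewrite !in_itv /=.
    have [x01|x01] := boolP (0 <= x < 1).
      by move=> /(Hf _ x01) h; left.
    move=> h; right; split; first by apply/negP.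
    by move: h; rewrite /code /state (negbTE x01) lexx ltr01.
  move=> [[h x01]|[/negP x01 h]]; first by apply/Hf.
  by move: h; rewrite /code /state (negbTE x01) lexx ltr01.
apply: measurableU; first by apply: measurableI; exact: measurable_itv.
apply: measurableI; first by apply: measurableC; exact: measurable_itv.
case: (pselect (mkseq (code 0) (size s) = s)) => h.
  rewrite (_ : mkset _ = setT); first exact: measurableT.
  by apply/seteqP; split.
rewrite (_ : mkset _ = set0); first exact: measurable0.
by apply/seteqP; split.
Qed.

Let measurable_code : measurable_fun setT (code : measurableTypeR R -> Sh).
Proof.
apply: (measurability (@fin_determined _ _ S0)).
  exact: borel_fin_determined.
move=> _ [_ /fin_determinedE[n [P ->]] <-].
rewrite setTI (_ : _ @^-1` _ =
  \bigcup_(u in P) [set x | mkseq (code x) n = mkseq (ext u) n]).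
  apply: fin_bigcup_measurable => [|u _]; first exact: finite_finset.
  have := measurable_code_cyl (mkseq (ext u) n).
  by rewrite size_mkseq.
apply/seteqP; split=> x /=.
  by move=> Px; exists (head_word n (code x)) => //; apply/head_word_mkseq; rewrite extK.
by move=> [u Pu /head_word_mkseq]; rewrite extK => ->.
Qed.

(** Inverse distribution function: [0, 1) is cut into consecutive intervals of
    lengths [m [:: a]], each of these again in the proportions of its successors,
    and so on.  The point [x] is sent to the sequence of the labels of the
    intervals that contain it, and Lebesgue measure is pushed forward. *)
Lemma measure_of_masses : exists mu : probability Sh R,
  forall s, Pr mu [set w | mkseq w (size s) = s] = m s.
Proof.
pose X : {mfun measurableTypeR R >-> Sh} :=
  @mfun_Sub _ _ (measurableTypeR R) Sh code (mem_set measurable_code).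
exists (distribution (@leb01 R : probability _ R) X) => s.
rewrite /Pr /distribution /pushforward /=.
have [f [f0 f1 Hf]] := code_itv s.
rewrite (_ : leb01 _ = leb01 `[f, (f + m s)[%classic).
  by rewrite leb01_itv// ?lerDl// addrAC subrr add0r.
rewrite /leb01 /mrestr; congr (lebesgue_measure _).
apply/seteqP; split=> x /= [h]; rewrite !in_itv /= => x01; split=> //.
  exact/Hf.
by apply/Hf.
Qed.
End cylinder_masses.

(** * The Gibbs inequality and finite entropies *)

Section gibbs.
Variable R : realType.

Lemma ln_le_sub1 (x : R) : 0 < x -> ln x <= x - 1.
Proof.
move=> x0; have e : 1 + (x - 1) = x by rewrite addrC subrK.
by rewrite -[X in ln X]e le_ln1Dx// ltrBrDl subrr.
Qed.

(** From [ln x <= x - 1] applied to [q i / p i]. *)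
Lemma gibbs (I : finType) (p q : I -> R) :
  (forall i, 0 <= p i) -> (forall i, 0 < q i) -> \sum_i q i <= \sum_i p i ->
  - \sum_i p i * ln (p i) <= - \sum_i p i * ln (q i).
Proof.
move=> p0 q0 qp; rewrite lerN2 -subr_ge0 -sumrB.
apply: (@le_trans _ _ (\sum_i (p i - q i))).
  by rewrite sumrB subr_ge0.
apply: ler_sum => i _; rewrite -mulrBr.
have := p0 i; rewrite le_eqVlt => /orP[/eqP<-|pi0].
  by rewrite mul0r sub0r oppr_le0 ltW.
have -> : ln (p i) - ln (q i) = - ln (q i / p i).
  by rewrite lnM ?posrE ?invr_gt0// lnV ?posrE// opprD opprK addrC.
rewrite mulrN lerNr opprB.
rewrite (le_trans (ler_wpM2l (p0 i) (ln_le_sub1 _)))// ?divr_gt0//.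
by rewrite mulrBr mulr1 mulrCA divff ?gt_eqF// mulr1.
Qed.

(** Mixing [p] with the uniform distribution makes the comparison distribution
    positive everywhere, and still gives a cross entropy strictly smaller than
    the uniform one does. *)
Lemma gibbs_uniform_strict (I : finType) (p : I -> R) (u : R) :
  0 < u -> (forall i, 0 <= p i) -> \sum_i p i = \sum_(i : I) u ->
  (exists i, p i != u) ->
  - \sum_i p i * ln ((p i + u) / 2) < - \sum_i p i * ln u.
Proof.
move=> u0 p0 pu [i0 pi0]; rewrite ltrN2 -subr_gt0 -sumrB.
have pu0 i : 0 < p i + u by rewrite ltr_wpDl.
apply: (@lt_le_trans _ _ (\sum_i ((p i - u) / 2 + (p i - u) ^+ 2 / (2 * (p i + u))))).
  rewrite big_split/= -mulr_suml sumrB pu subrr mul0r add0r.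
  rewrite (bigD1 i0)//= ltr_pwDl//.
    apply: divr_gt0; last by rewrite mulr_gt0.
    by rewrite exprn_even_gt0//= subr_eq0.
  rewrite sumr_ge0// => i _; apply: divr_ge0; first exact: sqr_ge0.
  by rewrite mulr_ge0// ltW.
apply: ler_sum => i _; rewrite -mulrBr.
have -> : ln ((p i + u) / 2) - ln u = - ln (u / ((p i + u) / 2)).
  rewrite [ln (u / _)]lnM ?posrE ?invr_gt0 ?divr_gt0//.
  by rewrite lnV ?posrE ?divr_gt0// opprD opprK addrC.
rewrite mulrN lerNr.
rewrite (le_trans (ler_wpM2l (p0 i) (ln_le_sub1 _)))// ?divr_gt0//.
rewrite le_eqVlt; apply/orP; left; apply/eqP.
by have := pu0 i; move=> /gt_eqF/negbT ?; field.
Qed.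
End gibbs.

Section expectation.
Variables (R : realType) (disp : measure_display) (X : measurableType disp).
Variable mu : probability X R.
Local Notation Pr := (Pr mu).

Definition Ev (I : finType) (V : X -> I) (g : I -> R) :=
  \sum_i Pr (V @^-1` [set i]) * g i.

Lemma Pr_sum1 (I : finType) (V : X -> I) : fin_measurable V ->
  \sum_i Pr (V @^-1` [set i]) = 1.
Proof.
move=> mV; rewrite -[RHS](PrT mu) (Pr_split mu mV)//.
by apply: eq_bigr => i _; rewrite setTI.
Qed.

Lemma Pr_comp (I J : finType) (V : X -> I) (h : I -> J) j : fin_measurable V ->
  Pr ((h \o V) @^-1` [set j]) = \sum_(i | h i == j) Pr (V @^-1` [set i]).
Proof.
move=> mV; rewrite (Pr_split mu mV); last exact: fin_measurable_comp.
rewrite [RHS]big_mkcond/=; apply: eq_bigr => i _.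
case: eqP => [<-|hij].
  by congr Pr; apply/seteqP; split=> x /=; [case|move=> ->].
rewrite -[RHS](Pr0 mu); congr Pr; apply/seteqP; split=> x //= [hx Vi].
by apply: hij; rewrite -Vi.
Qed.

Lemma Ev_comp (I J : finType) (V : X -> I) (h : I -> J) (g : J -> R) :
  fin_measurable V -> Ev V (g \o h) = Ev (h \o V) g.
Proof.
move=> mV; rewrite /Ev (partition_big h predT)//=; apply: eq_bigr => j _.
rewrite Pr_comp// mulr_suml; apply: eq_bigr => i /eqP <-//.
Qed.

Lemma Ev_eq (I : finType) (V W : X -> I) g : (V =1 W) -> Ev V g = Ev W g.
Proof. by move=> /funext ->. Qed.

(** A joint law has smaller masses than its marginal. *)
Lemma entropy_le_joint (I J : finType) (V : X -> I) (W : X -> J) :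
  fin_measurable V -> fin_measurable W ->
  - Ev V (fun i => ln (Pr (V @^-1` [set i]))) <=
  - Ev (fun x => (V x, W x))
      (fun ij => ln (Pr ((fun x => (V x, W x)) @^-1` [set ij]))).
Proof.
move=> mV mW; have mVW := fin_measurable_pair mV mW.
have -> : Ev V (fun i => ln (Pr (V @^-1` [set i]))) =
    Ev (fun x => (V x, W x)) ((fun i => ln (Pr (V @^-1` [set i]))) \o fst).
  by rewrite Ev_comp.
rewrite lerN2; apply: ler_sum => -[i j] _ /=.
have := Pr_ge0 mu ((fun x => (V x, W x)) @^-1` [set (i, j)]).
rewrite le_eqVlt => /orP[/eqP<-|h]; first by rewrite !mul0r.
rewrite ler_pM2l// ler_ln ?posrE//.
  by apply: Pr_le => // x /= [].
by rewrite (lt_le_trans h)//; apply: Pr_le => // x /= [].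
Qed.
End expectation.

(** * Approximating Borel sets by cylinders *)

Section approximation.
Variables (R : realType) (T : finType) (S : {set T}) (S0 : S != finset.set0).
Local Notation A := (alphabet S0).
Local Notation Sh := (fullshift A).
Variable mu : probability Sh R.
Local Notation Pr := (Pr mu).

Lemma PrU_le (E F : set Sh) : measurable E -> measurable F ->
  Pr (E `|` F) <= Pr E + Pr F.
Proof.
move=> mE mF; rewrite -lee_fin EFinD -!PrE//; last exact: measurableU.
exact: measureU2.
Qed.

Lemma PrD (E F : set Sh) : measurable E -> measurable F -> F `<=` E ->
  Pr (E `\` F) = Pr E - Pr F.
Proof.
move=> mE mF FE; apply: EFin_inj; rewrite EFinB -!PrE//; last exact: measurableD.
rewrite measureD//; first by rewrite (setIidr FE).
by rewrite ltey_eq fin_num_measure.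
Qed.

Definition approximable (E : set Sh) := measurable E /\
  forall e, 0 < e -> exists2 C, fin_determined C & Pr ((E `\` C) `|` (C `\` E)) < e.

Lemma fin_determined_measurable (C : set Sh) : fin_determined C -> measurable C.
Proof. by move=> /fin_determinedE[n [P ->]]; exact: measurable_head_word. Qed.

Lemma approximable_det C : fin_determined C -> approximable C.
Proof.
move=> dC; have mC := fin_determined_measurable dC; split => // e e0.
by exists C; rewrite ?setDv ?setU0 ?Pr0.
Qed.

Lemma approximableC E : approximable E -> approximable (~` E).
Proof.
move=> [mE aE]; split; first exact: measurableC.
move=> e /aE[C [n Hn] EC]; exists (~` C).
  by exists n => w w' /agree_sym ww' Cw /(Hn _ _ ww').
by rewrite !setDE !setCK setUC (setIC (~` C)) (setIC (~` E)) -!setDE.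
Qed.

Lemma approximableU E F : approximable E -> approximable F ->
  approximable (E `|` F).
Proof.
move=> [mE aE] [mF aF]; split; first exact: measurableU.
move=> e e0; have e20 : 0 < e / 2 by rewrite divr_gt0.
have [C dC EC] := aE _ e20; have [D dD FD] := aF _ e20.
have mC := fin_determined_measurable dC; have mD := fin_determined_measurable dD.
move: dC dD => [m Hm] [n Hn]; exists (C `|` D).
  exists (maxn m n) => w w' ww' [Cw|Dw]; [left|right].
    by apply: Hm Cw; apply: agree_leq ww'; exact: leq_maxl.
  by apply: Hn Dw; apply: agree_leq ww'; exact: leq_maxr.
have mX : measurable ((E `\` C) `|` (C `\` E)).
  by apply: measurableU; exact: measurableD.
have mY : measurable ((F `\` D) `|` (D `\` F)).
  by apply: measurableU; exact: measurableD.
rewrite (@le_lt_trans _ _ (Pr (((E `\` C) `|` (C `\` E)) `|`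
  ((F `\` D) `|` (D `\` F)))))//.
  apply: Pr_le; [|exact: measurableU|].
    by apply: measurableU; apply: measurableD; exact: measurableU.
  by move=> w /=; tauto.
by rewrite (le_lt_trans (PrU_le _ _))// (splitr e) ltrD.
Qed.

Lemma approximable_bigcup (E : nat -> set Sh) :
  (forall n, approximable (E n)) -> approximable (\bigcup_n E n).
Proof.
move=> aE; pose F n := \big[setU/set0]_(i < n) E i.
have aF n : approximable (F n).
  rewrite /F; elim/big_ind: _ => //; last exact: approximableU.
  by apply: approximable_det; exists 0%N.
have mU : measurable (\bigcup_n E n).
  by apply: bigcupT_measurable => n; have [] := aE n.
have FE : \bigcup_n F n = \bigcup_n E n.
  apply/seteqP; split=> w [n _ Ew]; first exact: bigsetU_bigcup Ew.
  by exists n.+1 => //; rewrite /F -bigcup_mkord; exists n => /=.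
split=> // e e0; have e20 : 0 < e / 2 by rewrite divr_gt0.
have cvgF : (Pr \o F) x @[x --> \oo] --> Pr (\bigcup_n E n).
  apply: fine_cvg; rewrite -PrE// -FE.
  apply: nondecreasing_cvg_mu.
  - by move=> n; have [] := aF n.
  - by rewrite FE.
  - by move=> m n mn; apply/subsetPset; exact: subset_bigsetU.
have [n Hn] : exists n, Pr (\bigcup_n E n) - Pr (F n) < e / 2.
  move/cvgrPdist_lt : cvgF => /(_ _ e20)[n _ /(_ n (leqnn n))] /= h.
  by exists n; rewrite (le_lt_trans (ler_norm _)).
have [mF /(_ _ e20)[C dC FC]] := aF n.
have mC := fin_determined_measurable dC; exists C => //.
have FnE : F n `<=` \bigcup_n E n by rewrite -FE => w Fw; exists n.
have mX : measurable ((F n `\` C) `|` (C `\` F n)).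
  by apply: measurableU; exact: measurableD.
rewrite (@le_lt_trans _ _ (Pr (((F n `\` C) `|` (C `\` F n)) `|`
  ((\bigcup_n E n) `\` F n))))//.
  apply: Pr_le => //.
  - by apply: measurableU; exact: measurableD.
  - by apply: measurableU => //; exact: measurableD.
  - move=> w /= [[Ew Cw]|[Cw Ew]].
      by have [Fw|Fw] := pselect (F n w); [left; left|right].
    by left; right; split=> // /FnE.
rewrite (le_lt_trans (PrU_le _ _))//; first exact: measurableD.
by rewrite (splitr e) ltrD// PrD.
Qed.

(** The sets approximable by cylinders form a sigma-algebra, which contains the
    cylinders. *)
Lemma measurable_approximable (C : set Sh) : measurable C -> approximable C.
Proof.
have sa : sigma_algebra setT approximable.
  split; first by apply: approximable_det; exists 0%N.
    by move=> E aE; rewrite setTD; exact: approximableC.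
  exact: approximable_bigcup.
rewrite borel_fin_determined; apply: (smallest_sub sa) => {}C.
exact: approximable_det.
Qed.

(** Each of the finitely many cells is approximated by a cylinder set; where all
    the approximations are right, the label can be read off a prefix. *)
Lemma approximable_partition m (xi : Sh -> 'I_m) e :
  finite_partition xi -> 0 < e ->
  exists n (g : {ffun 'I_n -> A} -> 'I_m),
    Pr [set w | xi w != g (head_word n w)] < e.
Proof.
move=> mxi e0.
have em0 : 0 < e / m.+1%:R by rewrite divr_gt0// ltr0n.
have /choice[C HC] : forall i, exists C, fin_determined C /\
    Pr ((xi @^-1` [set i] `\` C) `|` (C `\` xi @^-1` [set i])) < e / m.+1%:R.
  by move=> i; have [_ /(_ _ em0)[C]] := measurable_approximable (mxi i); exists C.
have /choice[N HN] : forall i, exists n, forall w w', agree n w w' ->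
    C i w -> C i w' by move=> i; have [] := HC i.
pose n := \max_i N i.
have iC i w w' : agree n w w' -> C i w -> C i w'.
  by move=> h; apply: HN; apply: agree_leq h; exact: leq_bigmax.
pose g (u : {ffun 'I_n -> A}) :=
  odflt (xi point) [pick i | `[< C i (ext u) >]].
exists n, g.
pose E i := (xi @^-1` [set i] `\` C i) `|` (C i `\` xi @^-1` [set i]).
have mE i : measurable (E i).
  have mC := fin_determined_measurable (HC i).1.
  by apply: measurableU; exact: measurableD.
have sub : [set w | xi w != g (head_word n w)] `<=` \bigcup_(i in setT) E i.
  move=> w /= xig; apply: contrapT => nE; move/eqP: xig; apply.
  have CE i : C i (ext (head_word n w)) <-> xi w = i.
    have wE : agree n w (ext (head_word n w)).
      by apply/head_word_agree; rewrite extK.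
    split=> h.
      apply: contrapT => xiw; apply: nE; exists i => //; right; split=> //.
      by apply: iC h; exact: agree_sym.
    apply: contrapT => nC; apply: nE; exists i => //; left; split=> //.
    by move=> Ci; apply: nC; apply: iC Ci.
  rewrite /g; case: pickP => [i /asboolP/CE//|/(_ (xi w))].
  by move=> /asboolP; rewrite CE.
have mS : measurable [set w | xi w != g (head_word n w)].
  rewrite (_ : mkset _ = \bigcup_(i in setT)
      (xi @^-1` [set i] `&` head_word n @^-1` [set u | i != g u])).
    apply: fin_bigcup_measurable => [|i _]; first exact: finite_finset.
    by apply: measurableI => //; exact: measurable_head_word.
  by apply/seteqP; split=> [w h|w [i _ [/= <-]]//]; exists (xi w).
rewrite -lte_fin -PrE//.
rewrite (@le_lt_trans _ _ (\sum_(i < m) (e / m.+1%:R)%:E)%E)//.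
  rewrite (@le_trans _ _ (mu (\bigcup_(i in setT) E i)))//.
    apply: le_measure; rewrite ?inE//.
    by apply: fin_bigcup_measurable => //; exact: finite_finset.
  rewrite (_ : \bigcup_(i in setT) E i = \big[setU/set0]_(i < m) E i).
    apply: (@le_trans _ _ (\sum_(i < m) mu (E i))%E).
      suff [] : measurable (\big[setU/set0]_(i < m) E i) /\
        (mu (\big[setU/set0]_(i < m) E i) <= \sum_(i < m) mu (E i))%E by [].
      apply: (big_ind2 (fun a b => measurable a /\ (mu a <= b)%E)) => //=.
      - by rewrite measure0.
      - move=> x1 x2 y1 y2 [mx1 h1] [my1 h2]; split; first exact: measurableU.
        by rewrite (le_trans (measureU2 _ _ _))// leeD.
    apply: lee_sum => i _; rewrite PrE// lee_fin ltW//.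
    by have [] := HC i.
  apply/seteqP; split=> w; rewrite -bigcup_seq /=.
    by move=> [i _ Ei]; exists i => //=; rewrite mem_index_enum.
  by move=> [i _ Ei]; exists i.
rewrite sumEFin lte_fin sumr_const card_ord -[ltLHS]mulr_natr -mulrA gtr_pMr//.
by rewrite mulrC ltr_pdivrMr ?ltr0n// mul1r ltr_nat.
Qed.
End approximation.

(** * Entropy of an invariant measure *)

Section shift_invariance.
Variables (R : realType) (T : finType) (S : {set T}) (S0 : S != finset.set0).
Local Notation A := (alphabet S0).
Local Notation Sh := (fullshift A).

Lemma iter_shift l (w : Sh) i : iter l (@left_shift A) w i = w (l + i)%N.
Proof.
elim: l w i => // l IH w i.
by rewrite iterSr IH /left_shift addSn.
Qed.

Lemma agree_shift l n (w w' : Sh) : agree (l + n) w w' ->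
  agree n (iter l (@left_shift A) w) (iter l (@left_shift A) w').
Proof. by move=> ww' i lin; rewrite !iter_shift ww'// ltn_add2l. Qed.

Lemma fin_determined_fin_measurable (I : finType) (V : Sh -> I) n :
  (forall w w', agree n w w' -> V w = V w') -> fin_measurable V.
Proof.
move=> HV i; apply: fin_determined_measurable; exists n => w w' ww' /= <-.
by rewrite (HV _ _ ww').
Qed.

Lemma fin_measurable_head n : fin_measurable (@head_word _ _ S0 n).
Proof. by move=> u; exact: measurable_head_word. Qed.

Lemma measurable_shift l (E : set Sh) : measurable E ->
  measurable (iter l (@left_shift A) @^-1` E).
Proof.
move=> mE; rewrite -[X in measurable X]setTI; move: E mE.
suff : measurable_fun setT (iter l (@left_shift A) : Sh -> Sh).
  by move=> h E mE; apply: h.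
apply: (measurability (@fin_determined _ _ S0)).
  exact: borel_fin_determined.
move=> _ [C [n Hn] <-]; rewrite setTI; apply: fin_determined_measurable.
by exists (l + n)%N => w w' /agree_shift; exact: Hn.
Qed.

Variable mu : probability Sh R.
Hypothesis mu_inv : invariant_measure (@left_shift A) mu.

Lemma Pr_shift l (E : set Sh) : measurable E ->
  Pr mu (iter l (@left_shift A) @^-1` E) = Pr mu E.
Proof.
elim: l => // l IH mE; rewrite -IH//; congr fine.
rewrite -[RHS]mu_inv; last exact: measurable_shift.
by congr (mu _); apply/funext => w; rewrite /preimage /mkset -iterSr.
Qed.

Lemma Ev_shift (I : finType) (V : Sh -> I) l g : fin_measurable V ->
  Ev mu (V \o iter l (@left_shift A)) g = Ev mu V g.
Proof.
move=> mV; apply: eq_bigr => i _; congr (_ * _).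
by rewrite comp_preimage Pr_shift.
Qed.
End shift_invariance.

Lemma ln_prod (R : realType) (I : finType) (F : I -> R) :
  (forall i, 0 < F i) -> ln (\prod_i F i) = \sum_i ln (F i).
Proof.
move=> F0; suff [] : 0 < \prod_i F i /\ ln (\prod_i F i) = \sum_i ln (F i) by [].
apply: (big_rec2 (fun x y => 0 < x /\ ln x = y)) => [|i y x _ [y0 <-]].
  by rewrite ln1.
by split; [rewrite mulr_gt0|rewrite lnM ?posrE].
Qed.

Section entropy_upper.
Variables (R : realType) (T : finType) (S : {set T}) (S0 : S != finset.set0).
Local Notation A := (alphabet S0).
Local Notation Sh := (fullshift A).
Local Notation sigma := (@left_shift A).
Variable mu : probability Sh R.
Hypothesis mu_inv : invariant_measure sigma mu.
Variables (n0 : nat) (q0 : {ffun 'I_n0 -> A} -> R).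
Hypothesis n0_gt0 : (0 < n0)%N.
Hypothesis q0_gt0 : forall v, 0 < q0 v.
Hypothesis q0_sum : \sum_v q0 v = 1.
Let H0 := - Ev mu (@head_word _ _ S0 n0) (fun v => ln (q0 v)).

Section step.
Variables (m' k : nat).
Let m := m'.+1.
Variables (xi : Sh -> 'I_m) (g : {ffun 'I_k -> A} -> 'I_m) (del : R).
Hypothesis mxi : finite_partition xi.
Hypothesis del01 : 0 < del < 1.
Variables (n r : nat).
Hypothesis rbig : (n + k <= r * n0)%N.

(** The conditional law of a true label given its guess: the guess is right except
    for a uniform noise of total mass [del], which keeps all masses positive. *)
Let kap (x y : 'I_m) : R := del / m%:R + (1 - del) * (x == y)%:R.

Let kap_gt0 x y : 0 < kap x y.
Proof.
have /andP[d0 d1] := del01.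
by rewrite ltr_pwDl ?divr_gt0 ?ltr0n ?mulr_ge0// subr_ge0 ltW.
Qed.

Let kap_sum y : \sum_x kap x y = 1.
Proof.
have -> : \sum_x kap x y =
    \sum_(x < m) del / m%:R + \sum_(x < m) (1 - del) * (x == y)%:R.
  by rewrite -big_split.
have -> : \sum_(x < m) (1 - del) * (x == y)%:R = 1 - del.
  rewrite (bigD1 y)//= eqxx mulr1 big1 ?addr0// => x /negbTE ->.
  by rewrite mulr0.
rewrite sumr_const card_ord -[_ *+ _]mulr_natr divfK ?pnatr_eq0//.
by rewrite addrC subrK.
Qed.

Let X (w : Sh) : {ffun 'I_n -> 'I_m} := [ffun i : 'I_n => xi (iter i sigma w)].
Let Z (w : Sh) : {ffun 'I_r -> {ffun 'I_n0 -> A}} :=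
  [ffun t : 'I_r => head_word n0 (iter (t * n0) sigma w)].
Let dec (z : {ffun 'I_r -> {ffun 'I_n0 -> A}}) : Sh := fun j =>
  if insub (j %/ n0)%N : option 'I_r is Some t then ext (z t) (j %% n0)%N
  else point.
Let y (i : nat) z := g (head_word k (iter i sigma (dec z))).

Let decZ w : agree (r * n0) w (dec (Z w)).
Proof.
move=> j jr; rewrite /dec insubT; first by rewrite ltn_divLR.
move=> h /=; rewrite /ext insubT ?ltn_mod// => h2 /=.
by rewrite !ffunE /= iter_shift -divn_eq.
Qed.

Let yZ (i : 'I_n) w : y i (Z w) = g (head_word k (iter i sigma w)).
Proof.
congr g; apply/head_word_agree/agree_sym/agree_shift/(agree_leq _ (decZ w)).
by rewrite (leq_trans _ rbig)// leq_add2r ltnW.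
Qed.

Let q (v : {ffun 'I_n -> 'I_m} * {ffun 'I_r -> {ffun 'I_n0 -> A}}) : R :=
  \prod_t q0 (v.2 t) * \prod_(i < n) kap (v.1 i) (y i v.2).

Let q_gt0 v : 0 < q v.
Proof. by rewrite mulr_gt0// prodr_gt0. Qed.

Let q_sum : \sum_v q v = 1.
Proof.
rewrite -(pair_bigA _ (fun x z => q (x, z)))/= exchange_big/=.
rewrite (eq_bigr (fun z : {ffun 'I_r -> {ffun 'I_n0 -> A}} => \prod_t q0 (z t))).
  rewrite -(bigA_distr_bigA (fun (t : 'I_r) v => q0 v))/=.
  by rewrite big1.
move=> z _; rewrite /q /= -mulr_sumr.
rewrite -(bigA_distr_bigA (fun (i : 'I_n) x => kap x (y i z)))/=.
by rewrite [X in _ * X]big1 ?mulr1.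
Qed.

Let mX : fin_measurable X.
Proof.
move=> x; rewrite (_ : _ @^-1` _ = \bigcap_(i in [set: 'I_n])
   (iter i sigma @^-1` (xi @^-1` [set x i]))).
  apply: fin_bigcap_measurable => [|i _]; first exact: finite_finset.
  by apply: measurable_shift; exact: mxi.
apply/seteqP; split=> w /=; first by move=> <- i _ /=; rewrite ffunE.
by move=> h; apply/ffunP => i; rewrite ffunE; exact: h.
Qed.

Let mZ : fin_measurable Z.
Proof.
apply: (@fin_determined_fin_measurable _ _ _ _ _ (r * n0)) => w w' ww'.
apply/ffunP => t; rewrite !ffunE; apply/head_word_agree/agree_shift.
by apply: agree_leq ww'; rewrite addnC -mulSn leq_mul2r ltn_ord orbT.
Qed.

Let joinE : join_entropy sigma mu xi n = - Ev mu X (fun x => ln (Pr mu (X @^-1` [set x]))).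
Proof.
congr (- _); rewrite /Ev (reindex (fun t : n.-tuple 'I_m => [ffun i => tnth t i])).
  apply: eq_bigr => t _; rewrite /Pr.
  suff -> : join_atom sigma xi t = X @^-1` [set [ffun i => tnth t i]] by [].
  apply/seteqP; split=> w /= h.
    by apply/ffunP => i; rewrite !ffunE h.
  by move=> i; move/ffunP : h => /(_ i); rewrite !ffunE.
exists (fun f : {ffun 'I_n -> 'I_m} => [tuple f i | i < n]).
  by move=> t _; apply: eq_from_tnth => i; rewrite tnth_mktuple ffunE.
by move=> f _; apply/ffunP => i; rewrite ffunE tnth_mktuple.
Qed.

Let mg : fin_measurable (fun w : Sh => g (head_word k w)).
Proof. by apply: fin_measurable_comp; exact: fin_measurable_head. Qed.

Let Ekap : - Ev mu (fun w => (xi w, g (head_word k w)))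
    (fun v => ln (kap v.1 v.2)) <=
  - ln (1 - del) +
  Pr mu [set w | xi w != g (head_word k w)] * - ln (del / m%:R).
Proof.
have /andP[d0 d1] := del01.
have mV := fin_measurable_pair mxi mg.
set V := fun w => _.
pose h (v : 'I_m * 'I_m) := v.1 != v.2.
pose l b : R := ln (1 - del) + (nat_of_bool b)%:R * ln (del / m%:R).
have : Ev mu V (l \o h) <= Ev mu V (fun v => ln (kap v.1 v.2)).
  apply: ler_sum => -[a b] _ /=; apply: ler_wpM2l; first exact: Pr_ge0.
  rewrite /l /h /kap /=; have [_|ab] := eqVneq a b; rewrite /= ?mul0r ?mul1r ?mulr1.
    rewrite addr0 ler_ln ?posrE ?subr_gt0// ?lerDr ?divr_ge0// ?ltW//.
    by rewrite addr_gt0 ?subr_gt0 ?divr_gt0 ?ltr0n.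
  by rewrite mulr0 addr0 gerDr ln_le0// lerBlDr lerDl ltW.
rewrite Ev_comp// => hle.
rewrite lerNl opprD opprK -mulrN opprK.
apply: le_trans hle; rewrite /Ev big_bool /l /= mul1r mul0r addr0.
have := Pr_sum1 mu (fin_measurable_comp h mV); rewrite big_bool /= => e.
rewrite mulrDr -addrA (addrC (_ * ln (del / _))) addrA -mulrDl e mul1r.
by rewrite lerD2l.
Qed.

(** The Gibbs inequality for the joint law of the labels [X] and of the [r]
    consecutive words [Z] of length [n0], against the law [q] under which these
    words are independent with law [q0] and the labels are noisy copies of the
    guesses [y] made from the words.  Invariance makes each word contribute [H0]
    and each label the same error term. *)
Lemma join_entropy_le : join_entropy sigma mu xi n <= r%:R * H0 +
  n%:R * (- ln (1 - del) +
  Pr mu [set w | xi w != g (head_word k w)] * - ln (del / m%:R)).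
Proof.
rewrite joinE (le_trans (entropy_le_joint mu mX mZ))//.
set V := fun w => (X w, Z w).
have mV : fin_measurable V by exact: fin_measurable_pair.
rewrite (le_trans (gibbs (q := q) _ _ _))//.
- by move=> v; exact: Pr_ge0.
- by rewrite q_sum Pr_sum1.
rewrite -/(Ev mu V (fun v => ln (q v))).
have -> : Ev mu V (fun v => ln (q v)) =
    \sum_(t < r) Ev mu V (fun v => ln (q0 (v.2 t))) +
    \sum_(i < n) Ev mu V (fun v => ln (kap (v.1 i) (y i v.2))).
  rewrite /Ev exchange_big/= [X in _ = _ + X]exchange_big/= -big_split/=.
  apply: eq_bigr => v _; rewrite /q lnM ?posrE ?prodr_gt0//.
  by rewrite !ln_prod// mulrDr !mulr_sumr.
rewrite opprD lerD//.
  rewrite -sumrN (eq_bigr (fun=> H0)).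
    by rewrite sumr_const card_ord mulr_natl.
  move=> t _; congr (- _).
  rewrite (Ev_comp mu (fun v : _ * {ffun 'I_r -> {ffun 'I_n0 -> A}} => v.2 t)
    (fun u => ln (q0 u)) mV).
  rewrite -[RHS](Ev_shift mu_inv (t * n0) _ (@fin_measurable_head _ _ S0 n0)).
  by apply: Ev_eq => w /=; rewrite ffunE.
rewrite -sumrN mulr_natl -[X in _ *+ X]card_ord -sumr_const.
apply: ler_sum => i _; apply: le_trans Ekap; rewrite lerN2.
rewrite -(Ev_shift mu_inv i); last exact: fin_measurable_pair.
rewrite (Ev_comp mu (fun v : {ffun 'I_n -> 'I_m} * _ => (v.1 i, y i v.2))
  (fun v => ln (kap v.1 v.2)) mV).
rewrite le_eqVlt; apply/orP; left; apply/eqP/Ev_eq => w /=.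
by rewrite yZ ffunE.
Qed.
End step.
End entropy_upper.

(** * The measure of maximal entropy *)

Section max_entropy.
Variables (R : realType) (T : finType) (S : {set T}) (S0 : S != finset.set0).
Local Notation A := (alphabet S0).
Local Notation Sh := (fullshift A).
Local Notation sigma := (@left_shift A).
Local Notation N := #|{: A}|.

Definition uniform_words (mu : probability Sh R) := forall n (v : {ffun 'I_n -> A}),
  Pr mu (@head_word _ _ S0 n @^-1` [set v]) = N%:R ^- n.

Lemma alphabet_gt0 : (0 < N)%N.
Proof. by apply/card_gt0P; exists point. Qed.

Let N_gt0 : 0 < N%:R :> R. Proof. by rewrite ltr0n alphabet_gt0. Qed.

Lemma head_word_cyl n (v : {ffun 'I_n -> A}) :
  head_word n @^-1` [set v] = [set w : Sh | mkseq w (size (mkseq (ext v) n)) = mkseq (ext v) n].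
Proof.
rewrite size_mkseq; apply/seteqP; split => w /=.
  by move=> <-; apply/head_word_mkseq; rewrite extK.
by move/head_word_mkseq; rewrite extK.
Qed.

(** Cylinder sets are stable by intersection and generate the Borel sets. *)
Lemma measure_ext_words (mu nu : probability Sh R) :
  (forall n v, Pr mu (head_word n @^-1` [set v]) =
               Pr nu (@head_word _ _ S0 n @^-1` [set v])) ->
  forall E, measurable E -> mu E = nu E.
Proof.
move=> munu; apply: (measure_unique (@fin_determined _ _ S0) (fun=> setT)).
- exact: borel_fin_determined.
- exact: fin_determinedI.
- by move=> _; exists 0%N.
- by apply/seteqP; split => // w _; exists 0%N.
- move=> C dC; have mC := fin_determined_measurable dC.
  apply: etrans (PrE mu mC) _; apply: etrans _ (esym (PrE nu mC)).
  congr (_%:E); have [n [P CE]] := fin_determinedE dC.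
  rewrite (Pr_split mu (@fin_measurable_head _ _ S0 n))//.
  rewrite (Pr_split nu (@fin_measurable_head _ _ S0 n))//.
  apply: eq_bigr => v _; rewrite CE -preimage_setI.
  have [Pv|Pv] := pselect (P v).
    by rewrite (_ : P `&` [set v] = [set v])//; apply/setIidPr => _ ->.
  rewrite (_ : P `&` [set v] = set0) ?preimage_set0 ?Pr0//.
  by apply/seteqP; split=> // u [Pu /= uv]; apply: Pv; rewrite -uv.
- by move=> _; rewrite -ge0_fin_numE ?fin_num_measure.
Qed.

Let measurable_fun_shift : measurable_fun setT (sigma : Sh -> Sh).
Proof. by move=> _ E mE; rewrite setTI; exact: (@measurable_shift _ _ _ 1). Qed.

Lemma invariant_of_words (mu : probability Sh R) :
  (forall n v, Pr mu (sigma @^-1` (head_word n @^-1` [set v])) =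
               Pr mu (@head_word _ _ S0 n @^-1` [set v])) ->
  invariant_measure sigma mu.
Proof.
move=> Hmu E mE.
pose X : {mfun Sh >-> Sh} := @mfun_Sub _ _ Sh Sh sigma (mem_set measurable_fun_shift).
by apply: (@measure_ext_words (distribution mu X) mu).
Qed.

(** The Bernoulli measure with equal weights. *)
Lemma uniform_measure_exists : exists2 mu : probability Sh R,
  uniform_words mu & invariant_measure sigma mu.
Proof.
have [|||mu Hmu] := @measure_of_masses R T S S0 (fun s => N%:R ^- size s).
- by move=> s; rewrite invr_ge0 exprn_ge0.
- by rewrite expr0 invr1.
- move=> s; rewrite (eq_bigr (fun=> N%:R ^- (size s).+1)); last first.
    by move=> a _; rewrite size_rcons.
  rewrite sumr_const -[RHS]mulr_natr exprSr invfM -mulrA mulVf ?mulr1//.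
  by rewrite lt0r_neq0.
have mu_unif : uniform_words mu.
  by move=> n v; rewrite head_word_cyl Hmu size_mkseq.
exists mu => //; apply: invariant_of_words => n v.
pose h (u : {ffun 'I_n.+1 -> A}) : {ffun 'I_n -> A} := [ffun i => u (lift ord0 i)].
have -> : sigma @^-1` (head_word n @^-1` [set v]) =
    (h \o @head_word _ _ S0 n.+1) @^-1` [set v].
  have <- : head_word n \o sigma = h \o @head_word _ _ S0 n.+1 by apply/funext =>
    w; apply/ffunP => i; rewrite !ffunE.
  by [].
rewrite Pr_comp; last exact: fin_measurable_head.
under eq_bigr do rewrite mu_unif.
pose cns (a : A) : {ffun 'I_n.+1 -> A} :=
  [ffun i => if unlift ord0 i is Some j then v j else a].
rewrite (reindex cns) /=; last first.
  exists (fun u : {ffun 'I_n.+1 -> A} => u ord0) => [a _|u].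
    by rewrite ffunE unlift_none.
  rewrite inE => /eqP hu; apply/ffunP => i; rewrite ffunE.
  by case: unliftP => [j ->|->//]; rewrite -hu ffunE.
rewrite (eq_bigl predT); last first.
  by move=> a; apply/eqP/ffunP => i; rewrite !ffunE liftK.
rewrite sumr_const mu_unif -[LHS]mulr_natr exprSr invfM -mulrA mulVf ?mulr1//.
by rewrite lt0r_neq0.
Qed.

(** The partition according to the first letter has entropy exactly [ln N]. *)
Lemma entropy_uniform_ge (mu : probability Sh R) : uniform_words mu ->
  ((ln N%:R)%:E <= entropy sigma mu)%E.
Proof.
move=> mu_unif; apply: ereal_sup_ubound.
exists N, (fun w : Sh => enum_rank (w 0%N)); split.
  move=> i; apply: (@fin_determined_fin_measurable _ _ S0 _ _ 1) => w w' ww'.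
  by rewrite ww'.
congr (_%:E); apply/esym/lim_near_cst => //; exists 1%N => // n /= n_gt0.
have PE (t : n.-tuple 'I_N) :
    Pr mu (join_atom sigma (fun w : Sh => enum_rank (w 0%N)) t) = N%:R ^- n.
  rewrite -(mu_unif n [ffun i => enum_val (tnth t i)]); congr Pr.
  apply/seteqP; split=> w /= h.
    by apply/ffunP => i; rewrite !ffunE -h enum_rankK iter_shift addn0.
  move=> i; rewrite iter_shift addn0; move/ffunP : h => /(_ i).
  by rewrite !ffunE => ->; rewrite enum_valK.
rewrite /join_entropy (eq_bigr (fun=> N%:R ^- n * ln (N%:R ^- n))); last first.
  by move=> t _; rewrite -(PE t).
rewrite sumr_const card_tuple card_ord -[_ *+ (N ^ n)]mulr_natl mulrA natrX mulfV ?mul1r; last first.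
  by rewrite expf_neq0// lt0r_neq0.
rewrite lnV ?posrE ?exprn_gt0// opprK lnXn// -[_ *+ n]mulr_natr mulfK// pnatr_eq0.
by rewrite -lt0n.
Qed.

(** If the words of length [n0] are not equidistributed, then [q0], the half-way
    point between their law and the uniform one, has cross entropy [H0] strictly
    below [n0 * ln N].  By [join_entropy_le] every partition then has entropy at
    most [H0 / n0] up to an arbitrarily small error, hence strictly less than
    the entropy of the uniform measure. *)
Lemma max_entropy_uniform (mu : probability Sh R) :
  max_entropy_measure sigma mu -> uniform_words mu.
Proof.
move=> [mu_inv mu_max] n0 v0.
have [nu nu_unif nu_inv] := uniform_measure_exists.
apply: contrapT => pv0.
pose p v := Pr mu (@head_word _ _ S0 n0 @^-1` [set v]).
have n0_gt0 : (0 < n0)%N.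
  case: n0 v0 pv0 {p} => // v0 []; rewrite expr0 invr1 -[RHS](PrT mu).
  by congr Pr; apply/seteqP; split=> // w _ /=; apply/ffunP => -[].
pose u : R := N%:R ^- n0.
have u0 : 0 < u by rewrite invr_gt0 exprn_gt0.
have p0 v : 0 <= p v by exact: Pr_ge0.
have psum : \sum_v p v = 1 by rewrite Pr_sum1//; exact: fin_measurable_head.
have usum : \sum_(v : {ffun 'I_n0 -> A}) u = 1.
  rewrite sumr_const card_ffun card_ord -[LHS]mulr_natr natrX mulVf//.
  by rewrite expf_neq0// lt0r_neq0.
(* Half-way to the uniform law, hence positive everywhere. *)
pose q0 v := (p v + u) / 2.
have q0_gt0 v : 0 < q0 v by rewrite divr_gt0// ltr_wpDl.
have q0_sum : \sum_v q0 v = 1.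
  by rewrite -mulr_suml big_split/= psum usum; lra.
pose H0 := - Ev mu (@head_word _ _ S0 n0) (fun v => ln (q0 v)).
have H0_lt : H0 < n0%:R * ln N%:R.
  rewrite (lt_le_trans (gibbs_uniform_strict u0 p0 _ _))//.
  - by rewrite psum usum.
  - by exists v0; apply/eqP.
  rewrite -mulr_suml psum mul1r lnV ?posrE ?exprn_gt0// opprK lnXn//.
  by rewrite mulr_natl.
have H0_ge0 : 0 <= H0.
  rewrite oppr_ge0 sumr_le0// => v _; rewrite mulr_ge0_le0 ?Pr_ge0// ln_le0//.
  by rewrite -q0_sum (bigD1 v)//= lerDl sumr_ge0// => w _; exact: ltW.
have n0R : 0 < n0%:R :> R by rewrite ltr0n.
pose h := H0 / n0%:R.
have h_lt : h < ln N%:R by rewrite ltr_pdivrMr// mulrC.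
have h0 : 0 <= h by rewrite divr_ge0// ltW.
pose e := (ln N%:R - h) / 3.
have e0 : 0 < e by rewrite divr_gt0// subr_gt0.
suff hle m (xi : Sh -> 'I_m) : finite_partition xi ->
    partition_entropy sigma mu xi <= h + 2 * e.
  have : ((ln N%:R)%:E <= (h + 2 * e)%:E)%E.
    rewrite (le_trans (entropy_uniform_ge nu_unif))// (le_trans (mu_max _ nu_inv))//.
    by apply: ge_ereal_sup => _ [m [xi [mxi ->]]]; rewrite lee_fin hle.
  rewrite lee_fin leNgt => /negP; apply.
  by rewrite /e; lra.
case: m xi => [xi|m xi mxi]; first by case: (xi point).
(* The noise level is chosen so that each label costs at most [e / 2]. *)
pose del := 1 - expR (- (e / 2)).
have e20 : 0 < e / 2 by rewrite divr_gt0.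
have del01 : 0 < del < 1.
  rewrite subr_gt0 gtrBl expR_gt0 andbT -[ltRHS]expR0 ltr_expR.
  by rewrite oppr_lt0.
have ldel : - ln (1 - del) = e / 2 by rewrite /del subKr expRK opprK.
have /andP[d0 d1] := del01.
have l0 : 0 <= - ln (del / m.+1%:R).
  rewrite oppr_ge0 ln_le0// ler_pdivrMr ?ltr0n// mul1r (le_trans (ltW d1))//.
  by rewrite ler1n.
have eta0 : 0 < e / 2 / (1 - ln (del / m.+1%:R)).
  by rewrite divr_gt0// ltr_pwDl.
have [k [g Hg]] := approximable_partition mu mxi eta0.
pose K := (k%:R / n0%:R + 1) * H0.
have key n : join_entropy sigma mu xi n <= n%:R * h + K + n%:R * e.
  (* Enough words of length [n0] to read the guesses of the [n] labels. *)
  have rb : (n + k <= ((n + k) %/ n0).+1 * n0)%N by rewrite ltnW// ltn_ceil.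
  rewrite (le_trans (join_entropy_le mu_inv n0_gt0 q0_gt0 q0_sum g mxi del01 rb))//.
  rewrite -/H0 lerD//.
    have -> : n%:R * h + K = ((n + k)%:R / n0%:R + 1) * H0.
      rewrite /K /h natrD; field; exact: lt0r_neq0.
    rewrite ler_wpM2r// -addn1 natrD lerD2r ler_pdivlMr// -natrM ler_nat.
    exact: leq_trunc_div.
  rewrite ler_wpM2l// ldel [leRHS](splitr e) lerD2l.
  rewrite (le_trans (ler_wpM2r l0 (ltW Hg)))// -[leLHS]mulrA ler_piMr//; first exact: ltW.
  rewrite mulrC ltW// ltr_pdivrMr ?mul1r ?ltr_pwDl//.
rewrite /partition_entropy; set U := (fun n => _).
have [cU|nU] := pselect (cvg (U x @[x --> \oo])); last first.
  by rewrite (dvgP nU) addr_ge0// mulr_ge0// ltW.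
apply: limr_le => //.
have [M _ HM] : \forall n \near \oo, K / e <= n%:R :> R.
  exact: nbhs_infty_ger.
exists M.+1 => // n /= Mn; have n_gt0 : (0 : R) < n%:R.
  by rewrite ltr0n (leq_trans _ Mn).
rewrite /U ler_pdivrMr// (le_trans (key n))//.
have : K <= n%:R * e by rewrite -ler_pdivrMr// HM//= ltnW.
by lra.
Qed.
End max_entropy.

(** * Large deviations by counting *)

Section chernoff.
Variable R : realType.

Lemma expR_le_quad (x : R) : `|x| <= 2^-1 -> expR x <= 1 + x + 2 * x ^+ 2.
Proof.
rewrite ler_norml => /andP[x1 x2].
have p : 0 < 1 - x by lra.
have h : 1 - x <= expR (- x) by exact: expR_ge1Dx.
have F0 : 0 < expR (- x) by exact: expR_gt0.
rewrite -(ler_pM2r F0) expRxMexpNx_1.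
have q0 : 0 <= 1 + x + 2 * x ^+ 2 by nra.
apply: le_trans (ler_wpM2l q0 h).
have : 0 <= x ^+ 2 * (1 - 2 * x) by rewrite mulr_ge0 ?sqr_ge0//; lra.
nra.
Qed.

(** The function [th |-> mean of expR (th * f)] is 1 at 0, with derivative the
    mean of [f], which is negative. *)
Lemma chernoff_weight (T : finType) (V : {pred T}) (f : T -> R) :
  \sum_(v in V) f v < 0 ->
  exists th rho, [/\ 0 < th, 0 < rho < 1 &
    \sum_(v in V) expR (th * f v) <= rho * #|V|%:R].
Proof.
move=> fneg; pose s := - \sum_(v in V) f v.
have s0 : 0 < s by rewrite oppr_gt0.
pose Q := \sum_(v in V) f v ^+ 2; pose B := \sum_(v in V) `|f v| + 1.
have Q0 : 0 <= Q by rewrite sumr_ge0// => v _; exact: sqr_ge0.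
have B0 : 0 < B by rewrite ltr_wpDl// sumr_ge0.
(* The parameter [th = D^-1] is small enough for the quadratic bound on [expR],
   and for the quadratic term to be at most half of the linear one. *)
pose D := 2 * B + 4 * Q / s; have D0 : 0 < D.
  by rewrite ltr_pwDl ?mulr_gt0// divr_ge0 ?mulr_ge0// ltW.
pose th := D^-1; have th0 : 0 < th by rewrite invr_gt0.
have thB : th * B <= 2^-1.
  rewrite mulrC ler_pdivrMr// /D mulrDr mulKf ?pnatr_eq0// lerDl.
  by rewrite mulr_ge0// divr_ge0 ?mulr_ge0// ltW.
have thQ : th * (2 * Q) <= s / 2.
  rewrite mulrC ler_pdivrMr// /D mulrDr.
  have -> : s / 2 * (4 * Q / s) = 2 * Q by field; exact: lt0r_neq0.
  by rewrite lerDr !mulr_ge0// ltW.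
have sumle : \sum_(v in V) expR (th * f v) <= #|V|%:R - th * s / 2.
  apply: (@le_trans _ _ (\sum_(v in V) (1 + th * f v + 2 * (th * f v) ^+ 2))).
    apply: ler_sum => v Vv; apply: expR_le_quad.
    rewrite normrM gtr0_norm//; apply: le_trans thB; apply: ler_wpM2l; first exact: ltW.
    by rewrite /B (bigD1 v)//= -addrA lerDl addr_ge0// sumr_ge0.
  rewrite !big_split/= sumr_const -mulr_sumr.
  have -> : \sum_(v in V) 2 * (th * f v) ^+ 2 = th * (th * (2 * Q)).
    rewrite /Q !mulr_sumr; apply: eq_bigr => v _; ring.
  rewrite -addrA lerD2l -[\sum_(v in V) f v]opprK -/s mulrN.
  have := ler_wpM2l (ltW th0) thQ; lra.
have V0 : 0 < #|V|%:R :> R.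
  rewrite ltr0n lt0n; apply: contraTN fneg => /eqP/card0_eq V0.
  by rewrite big_pred0// ltxx.
exists th, (1 - th * s / 2 / #|V|%:R); split=> //; last first.
  by rewrite mulrBl mul1r divfK// gt_eqF.
apply/andP; split.
  have : 0 < \sum_(v in V) expR (th * f v).
    have [v Vv] : exists v, v \in V by apply/card_gt0P; rewrite -(ltr0n R).
    rewrite (bigD1 v)//=; apply: ltr_pwDl; first exact: expR_gt0.
    by apply: sumr_ge0 => w _; exact: expR_ge0.
  move=> /lt_le_trans /(_ sumle) h.
  by rewrite subr_gt0 ltr_pdivrMr// mul1r -subr_gt0.
by rewrite gtrBl !divr_gt0// mulr_gt0.
Qed.

(** Markov's inequality for [expR (th * sum)], whose sum over a product of sets
    factors. *)
Lemma chernoff_count (I T : finType) (F : I -> {pred T}) (J : {pred I})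
    (V : {pred T}) (f : T -> R) (th rho : R) :
  0 < th -> 0 <= rho -> (forall t, t \in J -> F t =i V) ->
  \sum_(v in V) expR (th * f v) <= rho * #|V|%:R ->
  #|[pred c : {ffun I -> T} | (c \in family F) &&
      (0 <= \sum_(t in J) f (c t))]|%:R <=
  (\prod_t #|F t|%:R) * rho ^+ #|J|.
Proof.
move=> th0 rho0 FJ Vle.
rewrite -[X in X%:R <= _]sum1_card natr_sum.
apply: (@le_trans _ _ (\sum_(c : {ffun I -> T} | c \in family F)
   \prod_t (if t \in J then expR (th * f (c t)) else 1))).
  rewrite big_mkcond [leRHS]big_mkcond/=; apply: ler_sum => c _.
  rewrite inE; case: ifP => [/andP[-> h]|_].
    rewrite -big_mkcond/= -expR_sum -mulr_sumr.
    by rewrite -expR0 ler_expR mulr_ge0// ltW.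
  case: ifP => // _; apply: prodr_ge0 => t _.
  by case: ifP => // _; exact: expR_ge0.
rewrite -(bigA_distr_big_dep (fun t => F t)
  (fun t v => if t \in J then expR (th * f v) else 1))/=.
rewrite -[X in rho ^+ X]sum1_card -prodrXr.
rewrite [X in _ * X]big_mkcond -big_split/=.
apply: ler_prod => t _; case: ifP => tJ.
  rewrite (eq_bigl _ _ (FJ t tJ)) sumr_ge0 => [|v _]; last exact: expR_ge0.
  by rewrite expr1 (eq_card (FJ t tJ)) mulrC.
by rewrite mulr1 sumr_const ler0n lexx.
Qed.
End chernoff.

(** * Birkhoff sums over the words of a factor *)

Section birkhoff_sums.
Variables (R : realType) (T : finType) (S : {set T}) (S0 : S != finset.set0).
Local Notation A := (alphabet S0).
Local Notation Sh := (fullshift A).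
Local Notation sigma := (@left_shift A).

Definition bsum (phi : Sh -> R) n (w : Sh) : R := \sum_(l < n) phi (iter l sigma w).

Lemma bsumD phi m n w :
  bsum phi (m + n) w = bsum phi m w + bsum phi n (iter m sigma w).
Proof.
rewrite /bsum big_split_ord/=; congr (_ + _); apply: eq_bigr => i _.
by rewrite addnC iterD.
Qed.

Lemma bsumN phi n w : bsum (fun w => - phi w) n w = - bsum phi n w.
Proof. exact: sumrN. Qed.

Lemma bsum_blocks phi K k w :
  bsum phi (K * k) w = \sum_(t < K) bsum phi k (iter (t * k) sigma w).
Proof.
elim: K => [|K IH]; first by rewrite mul0n /bsum !big_ord0.
by rewrite mulSnr bsumD IH big_ord_recr.
Qed.

Definition blockcat k (v : nat -> Sh) : Sh := fun i => v (i %/ k)%N (i %% k)%N.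

Lemma blockcat_agree k v t : (0 < k)%N ->
  agree k (iter (t * k) sigma (blockcat k v)) (v t).
Proof.
move=> k0 i ik; rewrite iter_shift /blockcat divnMDl// modnMDl.
by rewrite divn_small// modn_small// addn0.
Qed.

Section phi.
Variables (phi : Sh -> R) (B : R).
Hypothesis phi_bnd : forall w, `|phi w| <= B.

Lemma bsum_bound n w : `|bsum phi n w| <= n%:R * B.
Proof.
rewrite (le_trans (ler_norm_sum _ _ _))//.
rewrite (le_trans (ler_sum _ (G := fun=> B) _))//.
by rewrite sumr_const card_ord mulr_natl.
Qed.

(** Uniform continuity alone makes the oscillation of a Birkhoff sum on a cylinder
    small compared with its length: only the last few terms are not controlled.
    The bound [1 <= eta * k] absorbs the unit losses of [lift_sup_adherent]. *)
Lemma bsum_osc (phi_cont : continuous phi) eta : 0 < eta ->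
  exists k, [/\ (0 < k)%N, 1 <= eta * k%:R &
    forall w w', agree k w w' ->
      `|bsum phi k w - bsum phi k w'| <= eta * k%:R].
Proof.
move=> eta0; have e20 : 0 < eta / 2 by rewrite divr_gt0.
have [n Hn] := continuous_unif phi_cont e20.
have B0 : 0 <= B by exact: le_trans (phi_bnd point).
have [M _ HM] : \forall j \near \oo, (2 * (2 * n%:R * B + 1)) / eta <= j%:R :> R.
  exact: nbhs_infty_ger.
pose k := (M.+1 + n)%N.
have kM : 2 * (2 * n%:R * B + 1) <= eta * k%:R.
  by rewrite -ler_pdivrMl// mulrC HM//= /k addSn ltnW// ltnS leq_addr.
have nB : 0 <= 2 * n%:R * B by rewrite !mulr_ge0.
exists k; split => //; first by lra.
move=> w w' ww'; rewrite /k !bsumD opprD addrACA.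
have h1 : `|bsum phi M.+1 w - bsum phi M.+1 w'| <= k%:R * (eta / 2).
  rewrite /bsum -sumrB (le_trans (ler_norm_sum _ _ _))//.
  rewrite (le_trans (ler_sum _ (G := fun=> eta / 2) _))//.
    move=> i _; apply/ltW/Hn/agree_shift/agree_leq/ww'.
    by rewrite /k leq_add2r ltnW.
  rewrite sumr_const card_ord -[leLHS]mulr_natl ler_wpM2r ?ler_nat ?leq_addr//.
  exact: ltW.
rewrite (le_trans (ler_normD _ _))// (le_trans (lerD h1 (ler_normB _ _)))//.
have := bsum_bound n (iter M.+1 sigma w).
have := bsum_bound n (iter M.+1 sigma w').
by rewrite -/k; lra.
Qed.
End phi.

Section maximal_lift.
Variable e : A -> A.

(** The map [e] is idempotent and stands for a factor of the shift: its fixed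
    letters are the letters of the factor, and [c] ranges over words of the
    factor. *)
Definition fiber k (c : {ffun 'I_k -> A}) : set Sh :=
  [set w | forall i : 'I_k, e (w i) = e (c i)].

Definition lift_sup (phi : Sh -> R) k (c : {ffun 'I_k -> A}) : R :=
  sup [set bsum phi k w | w in fiber c].

Definition fixed_words k : {pred {ffun 'I_k -> A}} :=
  ffun_on [pred a | e a == a].

(** The condition on words that links dimension and measures; [lift_sup] is
    averaged over all the words of the factor, with equal weights. *)
Definition upper_mean (phi : Sh -> R) (alpha : R) := forall k,
  #|[pred a | e a == a]|%:R ^+ k * (k%:R * alpha) <=
  \sum_(c in @fixed_words k) lift_sup phi c.

Variables (phi : Sh -> R) (B : R).
Hypothesis phi_bnd : forall w, `|phi w| <= B.

Lemma lift_has_sup k (c : {ffun 'I_k -> A}) :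
  has_sup [set bsum phi k w | w in fiber c].
Proof.
split; first by exists (bsum phi k (ext c)), (ext c) => // i;
  have /ffunP/(_ i) := extK c; rewrite ffunE => ->.
exists (k%:R * B) => _ [w _ <-].
by rewrite (le_trans (ler_norm _))//; exact: bsum_bound.
Qed.

Lemma bsum_le_lift k (c : {ffun 'I_k -> A}) w : fiber c w -> bsum phi k w <= lift_sup phi c.
Proof. by move=> cw; apply: ub_le_sup; [exact: (lift_has_sup c).2|exists w]. Qed.

Lemma lift_sup_adherent k (c : {ffun 'I_k -> A}) :
  exists2 w, fiber c w & lift_sup phi c - 1 < bsum phi k w.
Proof.
have [_ [w cw <-] h] := sup_adherent ltr01 (lift_has_sup c).
by exists w.
Qed.
End maximal_lift.

(** The first index at which [g] has come down to [x + D]. *)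
Lemma discrete_ivt (g : nat -> R) K x D d : 0 <= d -> 0 <= D ->
  x - D <= g 0%N -> g K <= x + D -> (forall s, `|g s.+1 - g s| <= d) ->
  exists2 s, (s <= K)%N & `|g s - x| <= D + d.
Proof.
move=> d0 D0 g0 gK gd; have ex : exists s, g s <= x + D by exists K.
case: (ex_minnP ex) => -[|s] gs smin.
  by exists 0%N => //; rewrite ler_norml; apply/andP; split; lra.
exists s.+1; first exact: smin.
have xs : x + D < g s by rewrite ltNge; apply/negP => /smin; rewrite ltnn.
by have := gd s; rewrite !ler_norml => /andP[h1 h2]; apply/andP; split; lra.
Qed.

Section good_words.
Variables (e : A -> A) (ee : forall a, e (e a) = e a).
Variables (phi : Sh -> R) (B alpha eta : R) (k : nat).
Hypothesis phi_bnd : forall w, `|phi w| <= B.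
Hypothesis up : upper_mean e phi alpha.
Hypothesis dn : upper_mean e (fun w => - phi w) (- alpha).
Hypothesis eta0 : 0 < eta.
Hypothesis k0 : (0 < k)%N.
Hypothesis eta1 : 1 <= eta * k%:R.
Hypothesis osc : forall w w', agree k w w' ->
  `|bsum phi k w - bsum phi k w'| <= eta * k%:R.

Let De : {pred A} := [pred a | e a == a].
Let N := #|De|.

Lemma fixed_gt0 : (0 < N)%N.
Proof. by apply/card_gt0P; exists (e point); rewrite inE ee. Qed.

Let NR : 0 < N%:R :> R. Proof. by rewrite ltr0n fixed_gt0. Qed.

Lemma card_fixed_words j : #|@fixed_words e j| = (N ^ j)%N.
Proof. by rewrite card_ffun_on card_ord. Qed.

Let bad_few (psi : Sh -> R) (be : R) : upper_mean e psi be ->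
  exists K0, forall K, (K0 <= K)%N ->
  4 * #|[pred c : {ffun 'I_K -> {ffun 'I_k -> A}} |
      (c \in family (fun=> @fixed_words e k)) &&
      (0 <= \sum_(t < K) (k%:R * be - eta * k%:R - lift_sup e psi (c t)))]|%:R <=
  N%:R ^+ (k * K) :> R.
Proof.
move=> ub; pose f (c : {ffun 'I_k -> A}) := k%:R * be - eta * k%:R - lift_sup e psi c.
have fneg : \sum_(c in @fixed_words e k) f c < 0.
  rewrite /f big_split/= sumr_const card_fixed_words sumrN subr_lt0.
  apply: lt_le_trans (ub k); rewrite -[_ *+ (N ^ k)]mulr_natl natrX ltr_pM2l ?exprn_gt0//.
  by rewrite gtrBl mulr_gt0// ltr0n.
have [th [rho [th0 /andP[rho0 rho1] Hw]]] := chernoff_weight fneg.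
have [K0 _ HK0] : \forall K \near \oo, rho ^+ K < 4^-1.
  have := @cvg_expr R rho; rewrite gtr0_norm// => /(_ rho1)/cvgrPdist_lt.
  move=> /(_ 4^-1); rewrite invr_gt0 => /(_ (ltr0n _ 4)).
  by apply: filterS => K; rewrite sub0r normrN ger0_norm// exprn_ge0// ltW.
exists K0 => K KK0.
have := @chernoff_count R 'I_K _ (fun=> @fixed_words e k) predT
  (@fixed_words e k) f th rho th0 (ltW rho0) (fun _ _ _ => erefl) Hw.
rewrite prodr_const card_ord card_fixed_words -natrX -expnM => h.
have := HK0 K KK0; rewrite /= => hr.
rewrite mulrC -ler_pdivlMr//; apply: le_trans h _.
rewrite natrX ler_wpM2l ?exprn_ge0//; last exact: ltW.
Qed.

(** By [chernoff_count], for large [K], at most a quarter of the [K]-tuples of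
    words have too small a sum of [lift_sup phi], and at most a quarter too small
    a sum of [lift_sup (- phi)].  For the others, replacing the maximal lifts by
    the minimal lifts one word after the other moves the Birkhoff sum by bounded
    steps from above [K * k * alpha] to below it, up to small errors, so that
    some mixture is close to it.  One such lift is kept for each tuple, whence
    the separation. *)
Lemma good_words : exists K0, forall K, (K0 <= K)%N ->
  exists V : {pred {ffun 'I_(K * k) -> A}}, [/\
    forall w, head_word (K * k) w \in V ->
      `|bsum phi (K * k) w - (K * k)%:R * alpha| <= 4 * eta * (K * k)%:R,
    forall u v, u \in V -> v \in V -> (forall i, e (u i) = e (v i)) -> u = v &
    (N ^ (K * k) <= 2 * #|V|)%N].
Proof.
have [K1 HK1] := bad_few up; have [K2 HK2] := bad_few dn.
have B0 : 0 <= B by exact: le_trans (phi_bnd point).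
have [K3 _ HK3] : \forall j \near \oo, 2 * B / eta <= j%:R :> R.
  exact: nbhs_infty_ger.
exists (maxn K1 (maxn K2 K3)) => K; rewrite !geq_max => /and3P[/HK1 b1 /HK2 b2 K3K].
have KB : 2 * B <= eta * K%:R by rewrite -ler_pdivrMl// mulrC HK3.
have k0R : 0 < k%:R :> R by rewrite ltr0n.
pose f1 (c : {ffun 'I_k -> A}) := k%:R * alpha - eta * k%:R - lift_sup e phi c.
pose f2 (c : {ffun 'I_k -> A}) :=
  k%:R * - alpha - eta * k%:R - lift_sup e (fun w => - phi w) c.
pose fam : {pred {ffun 'I_K -> {ffun 'I_k -> A}}} := family (fun=> @fixed_words e k).
pose G : {pred {ffun 'I_K -> {ffun 'I_k -> A}}} := [pred c | [&& c \in fam,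
  \sum_(t < K) f1 (c t) < 0 & \sum_(t < K) f2 (c t) < 0]].
have cardG : (N ^ (K * k) <= 2 * #|G|)%N.
  set b1s := [pred c | _] in b1; set b2s := [pred c | _] in b2.
  have h : (#|fam| <= #|b1s| + #|b2s| + #|G|)%N.
    rewrite -(cardID b1s fam) -addnA leq_add//.
      by apply: subset_leq_card; apply/fintype.subsetP => c; rewrite !inE => /andP[].
    rewrite -(cardID b2s [predD fam & b1s]) leq_add//.
      by apply: subset_leq_card; apply/fintype.subsetP => c; rewrite !inE => /andP[].
    apply: subset_leq_card; apply/fintype.subsetP => c.
    rewrite !inE => /and3P[n2 n1 cf]; move: n1 n2; rewrite cf /= -!ltNge.
    by move=> -> ->.
  have cf : #|fam| = (N ^ (k * K))%N.
    have := @card_ffun_on 'I_K _ (@fixed_words e k).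
    by rewrite card_fixed_words card_ord -expnM.
  move: b1 b2 h; rewrite -natrX -natrM ler_nat -natrM ler_nat cf.
  by rewrite [(K * k)%N]mulnC => h1 h2 h3; lia.
have lifts (c : {ffun 'I_K -> {ffun 'I_k -> A}}) : exists x : Sh, c \in G ->
    (forall (t : 'I_K) (i : 'I_k), e (x (t * k + i)%N) = e (c t i)) /\
    forall w, agree (K * k) w x ->
      `|bsum phi (K * k) w - (K * k)%:R * alpha| <= 4 * eta * (K * k)%:R.
  case: (boolP (c \in G)) => [|_]; last by exists point.
  rewrite inE => /and3P[_ g1 g2].
  have /choice[wp Hwp] : forall u : {ffun 'I_k -> A}, exists w,
      fiber e u w /\ lift_sup e phi u - 1 < bsum phi k w.
    by move=> u; have [w] := lift_sup_adherent e phi_bnd u; exists w.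
  have Nphi_bnd w : `|- phi w| <= B by rewrite normrN.
  have /choice[wm Hwm] : forall u : {ffun 'I_k -> A}, exists w,
      fiber e u w /\ lift_sup e (fun w => - phi w) u - 1 < - bsum phi k w.
    move=> u; have [w] := lift_sup_adherent e Nphi_bnd u.
    by rewrite bsumN; exists w.
  pose cn t := if insub t is Some j then c j else [ffun=> point].
  pose v s t := if (t < s)%N then wm (cn t) else wp (cn t).
  have cnE (t : 'I_K) : cn t = c t by rewrite /cn valK.
  (* Minimal lifts on the first [s] words, maximal lifts on the others. *)
  pose g s := \sum_(t < K) bsum phi k (v s t).
  pose D := K%:R * (eta * k%:R + 1).
  have sumK (z : R) : K%:R * z = \sum_(t < K) z.
    by rewrite sumr_const card_ord mulr_natl.
  have d0 : 0 <= 2 * (k%:R * B) by rewrite !mulr_ge0// ltW.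
  have g0 : K%:R * (k%:R * alpha) - D <= g 0%N.
    rewrite /D -mulrBr sumK.
    apply: (@le_trans _ _ (\sum_(t < K) (lift_sup e phi (c t) - 1))).
      rewrite -subr_ge0 -sumrB.
      have := ltW g1; rewrite -oppr_ge0 -sumrN; congr (_ <= _).
      by apply: eq_bigr => t _; rewrite /f1; ring.
    by apply: ler_sum => t _; rewrite -cnE; exact/ltW/(Hwp _).2.
  have gK : g K <= K%:R * (k%:R * alpha) + D.
    rewrite /D -mulrDr sumK.
    apply: (@le_trans _ _ (- \sum_(t < K) (lift_sup e (fun w => - phi w) (c t) - 1))).
      rewrite -sumrN; apply: ler_sum => t _; rewrite /v ltn_ord -cnE lerNr.
      exact/ltW/(Hwm _).2.
    rewrite -subr_ge0 opprK -big_split/=.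
    have := ltW g2; rewrite -oppr_ge0 -sumrN; congr (_ <= _).
    by apply: eq_bigr => t _; rewrite /f2; ring.
  have gstep s : `|g s.+1 - g s| <= 2 * (k%:R * B).
    have vE t : t != s -> v s.+1 t = v s t.
      by move=> ts; rewrite /v ltnS leq_eqVlt (negbTE ts).
    rewrite /g -sumrB; have [sK|Ks] := ltnP s K.
      rewrite (bigD1 (Ordinal sK))//= big1 ?addr0.
        rewrite (le_trans (ler_normB _ _))// mulr2n mulrDl mul1r.
        by rewrite lerD//; exact: bsum_bound.
      by move=> t ts; rewrite vE ?subrr.
    rewrite big1 ?normr0// => t _; rewrite vE ?subrr//.
    by rewrite ltn_eqF// (leq_trans _ Ks).
  have [s sK Hs] : exists2 s, (s <= K)%N &
      `|g s - K%:R * (k%:R * alpha)| <= D + 2 * (k%:R * B).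
    apply: discrete_ivt => //; rewrite mulr_ge0// addr_ge0// mulr_ge0//.
    exact: ltW.
  exists (blockcat k (v s)) => _; split.
    move=> t i; have := blockcat_agree (v s) t k0 (ltn_ord i).
    rewrite iter_shift => ->; rewrite /v cnE; case: ifP => _.
      exact: (Hwm _).1.
    exact: (Hwp _).1.
  move=> w wx; rewrite bsum_blocks natrM.
  have h1 : `|\sum_(t < K) bsum phi k (iter (t * k) sigma w) - g s| <= K%:R * (eta * k%:R).
    rewrite -sumrB (le_trans (ler_norm_sum _ _ _))//.
    rewrite (le_trans (ler_sum _ (G := fun=> eta * k%:R) _))//.
      move=> t _; apply: osc; apply: agree_trans (blockcat_agree (v s) t k0).
      apply: agree_shift; apply: agree_leq wx.
      by rewrite addnC -mulSn leq_mul2r ltn_ord orbT.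
    by rewrite sumr_const card_ord mulr_natl.
  rewrite -mulrA (le_trans (ler_distD (g s) _ _))// (le_trans (lerD h1 Hs))//.
  rewrite /D.
  have K0 : 0 <= K%:R :> R by [].
  have h2 := ler_wpM2l K0 eta1.
  have h3 := ler_wpM2r (ltW k0R) KB.
  lra.
have /choice[x Hx] := lifts.
have idx_subproof (t : 'I_K) (i : 'I_k) : (t * k + i < K * k)%N.
  by rewrite (@leq_trans (t.+1 * k)%N)// ?leq_mul2r ?ltn_ord ?orbT// mulSnr
    ltn_add2l.
pose idx t i := Ordinal (idx_subproof t i).
have xE c : c \in G -> forall t i, e (head_word (K * k) (x c) (idx t i)) = c t i.
  move=> Gc t i; rewrite ffunE (Hx c Gc).1; move: Gc; rewrite inE => /and3P[+ _ _].
  by move=> /familyP/(_ t)/ffun_onP/(_ i); rewrite inE => /eqP.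
pose V : {pred {ffun 'I_(K * k) -> A}} :=
  [pred u | u \in [seq head_word (K * k) (x c) | c in G]].
exists V; split.
- move=> w; rewrite inE => /fintype.imageP[c Gc /= wE]; apply: (Hx c Gc).2.
  exact/head_word_agree.
- move=> u v; rewrite !inE.
  move=> /fintype.imageP[c Gc /= ->] /fintype.imageP[c' Gc' /= ->] h.
  suff -> : c = c' by [].
  by apply/ffunP => t; apply/ffunP => i; rewrite -(xE _ Gc) -(xE _ Gc') h.
- rewrite (leq_trans cardG)// leq_mul2l /=.
  rewrite card_in_image// => c c' Gc Gc' /= h.
  by apply/ffunP => t; apply/ffunP => i; rewrite -(xE _ Gc) -(xE _ Gc') h.
Qed.
End good_words.
End birkhoff_sums.

(** * From invariant measures to averages over words *)

Section integral_fin_valued.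
Variables (R : realType) (disp : measure_display) (X : measurableType disp).
Variable mu : probability X R.

Lemma Rint_Ev (I : finType) (V : X -> I) (g : I -> R) : fin_measurable V ->
  mu.-integrable setT (EFin \o (g \o V)) /\ \int[mu]_w (g (V w)) = Ev mu V g.
Proof.
move=> mV.
pose psi (r : seq I) (w : X) := \sum_(v <- r) g v * \1_(V @^-1` [set v]) w.
have psiE : g \o V = psi (index_enum I).
  apply/funext => w; rewrite /psi (bigD1 (V w))//= big1 ?addr0.
    by rewrite indicE mem_set// mulr1.
  by move=> v vV; rewrite indicE memNset ?mulr0//= => e; rewrite e eqxx in vV.
have ii v : mu.-integrable setT (EFin \o (\1_(V @^-1` [set v]) : X -> R)).
  by apply: integrable_indic => //; rewrite setTI -ge0_fin_numE// fin_num_measure.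
suff [h1 h2] : mu.-integrable setT (EFin \o psi (index_enum I)) /\
  \int[mu]_w (psi (index_enum I) w) =
  \sum_(v <- index_enum I) Pr mu (V @^-1` [set v]) * g v.
  by rewrite psiE; split=> //; rewrite -[LHS]/(\int[mu]_w ((g \o V) w)) psiE.
elim: (index_enum I) => [|v r [IH1 IH2]].
  rewrite big_nil /psi; split.
    under [X in integrable _ _ (_ \o X)]eq_fun do rewrite big_nil.
    exact: integrable0.
  under eq_Rintegral do rewrite big_nil.
  by rewrite Rintegral_cst// mul0r.
have iv : mu.-integrable setT (EFin \o (fun w => g v * \1_(V @^-1` [set v]) w)).
  exact: (integrableZl measurableT (g v) (ii v)).
have e : psi (v :: r) = (fun w => g v * \1_(V @^-1` [set v]) w + psi r w).
  by apply/funext => w; rewrite /psi big_cons.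
rewrite e; split; first exact: (integrableD _ iv IH1).
rewrite RintegralD// RintegralZl// big_cons; congr (_ + _) => //.
by rewrite mulrC; congr (_ * _); rewrite /Rintegral integral_indic// setIT.
Qed.
End integral_fin_valued.

Section continuous_integral.
Variables (R : realType) (T : finType) (S : {set T}) (S0 : S != finset.set0).
Local Notation A := (alphabet S0).
Local Notation Sh := (fullshift A).
Local Notation sigma := (@left_shift A).

Lemma continuous_integrable (mu : probability Sh R) (phi : Sh -> R) :
  continuous phi -> mu.-integrable setT (EFin \o phi).
Proof.
move=> cphi; have [B B0 HB] := continuous_bounded cphi.
apply: measurable_bounded_integrable => //.
- by rewrite -ge0_fin_numE// fin_num_measure.
- apply: (measurability _ (RGenOInfty.measurableE R)) => _ [_ [x ->] <-]; rewrite setTI; apply: sub_sigma_algebra.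
  have /continuousP h := cphi; apply: h; exact: interval_open.
- exists B; split; first exact: num_real.
  by move=> y By w _; apply: le_trans (HB w) _; exact: ltW.
Qed.

(** Integrals of continuous functions are estimated through the cylinder functions
    above them. *)
Lemma Rint_le_Ev (mu : probability Sh R) (phi : Sh -> R) (I : finType)
    (V : Sh -> I) (g : I -> R) :
  continuous phi -> fin_measurable V -> (forall w, phi w <= g (V w)) ->
  \int[mu]_w phi w <= Ev mu V g.
Proof.
move=> cphi mV le; have [i1 <-] := Rint_Ev mu g mV.
by apply: le_Rintegral => //; exact: continuous_integrable.
Qed.

Lemma RintN (mu : probability Sh R) (phi : Sh -> R) : continuous phi ->
  \int[mu]_w (- phi w) = - \int[mu]_w phi w.
Proof.
move=> cphi; under eq_Rintegral do rewrite -mulN1r.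
by rewrite RintegralZl// ?mulN1r//; exact: continuous_integrable.
Qed.

Lemma Ev_le (mu : probability Sh R) (I : finType) (V : Sh -> I) (f g : I -> R) :
  (forall i, f i <= g i) -> Ev mu V f <= Ev mu V g.
Proof.
by move=> fg; apply: ler_sum => i _; rewrite ler_wpM2l// Pr_ge0.
Qed.

Lemma Ev_cst (mu : probability Sh R) (I : finType) (V : Sh -> I) (c : R) :
  fin_measurable V -> Ev mu V (fun=> c) = c.
Proof. by move=> mV; rewrite /Ev -mulr_suml Pr_sum1// mul1r. Qed.

Lemma EvD (mu : probability Sh R) (I : finType) (V : Sh -> I) (f g : I -> R) :
  Ev mu V (fun i => f i + g i) = Ev mu V f + Ev mu V g.
Proof. by rewrite /Ev -big_split; apply: eq_bigr => i _; rewrite mulrDr. Qed.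

Lemma EvN (mu : probability Sh R) (I : finType) (V : Sh -> I) (f : I -> R) :
  Ev mu V (fun i => - f i) = - Ev mu V f.
Proof. by rewrite /Ev -sumrN; apply: eq_bigr => i _; rewrite mulrN. Qed.

Lemma Ev_sum (mu : probability Sh R) (I J : finType) (V : Sh -> I)
    (f : J -> I -> R) :
  Ev mu V (fun i => \sum_j f j i) = \sum_j Ev mu V (f j).
Proof.
by rewrite /Ev exchange_big; apply: eq_bigr => i _; rewrite mulr_sumr.
Qed.

Section to_upper_mean.
Variables (e : A -> A) (ee : forall a, e (e a) = e a).
Variables (mu : probability Sh R) (mu_inv : invariant_measure sigma mu).
Local Notation N := #|[pred a | e a == a]|.
Hypothesis mu_fib : forall k (c : {ffun 'I_k -> A}), c \in @fixed_words _ _ S0 e k ->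
  Pr mu (fiber e c) = N%:R ^- k.

(** By invariance [k] times the integral is the integral of the [k]-th Birkhoff
    sum, which is at most [lift_sup] of the word that the sequence lies over, and
    that word is equidistributed. *)
Lemma upper_mean_integral (phi : Sh -> R) : continuous phi ->
  upper_mean e phi (\int[mu]_w phi w).
Proof.
move=> cphi k; have [B B0 phi_bnd] := continuous_bounded cphi.
have N0 : 0 < N%:R :> R by rewrite ltr0n fixed_gt0.
pose Z (w : Sh) : {ffun 'I_k -> A} := [ffun i : 'I_k => e (w i)].
have mZ : fin_measurable Z.
  apply: (@fin_determined_fin_measurable _ _ S0 _ _ k) => w w' ww'.
  by apply/ffunP => i; rewrite !ffunE ww'.
have EZ : Ev mu Z (@lift_sup _ _ _ S0 e phi k) =
    N%:R ^- k * \sum_(c in @fixed_words _ _ S0 e k) lift_sup e phi c.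
  rewrite mulr_sumr [RHS]big_mkcond/=; apply: eq_bigr => c _.
  case: ifPn => ck.
    congr (_ * _); rewrite -(mu_fib ck); congr Pr.
    apply/seteqP; split=> w /= h.
      by move=> i; rewrite -h ffunE ee.
    apply/ffunP => i; rewrite ffunE h; move/ffun_onP : ck => /(_ i).
    by rewrite inE => /eqP.
  rewrite [X in Pr _ X](_ : _ = set0) ?Pr0 ?mul0r//.
  apply/seteqP; split=> // w /= Zw; move/negP : ck; apply; rewrite -Zw.
  by apply/ffun_onP => i; rewrite ffunE inE ee.
suff : k%:R * \int[mu]_w phi w <= Ev mu Z (@lift_sup _ _ _ S0 e phi k).
  by rewrite EZ [leRHS]mulrC ler_pdivlMr ?exprn_gt0// mulrC.
apply/ler_addgt0Pr => eps eps0.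
have [n Hn] : exists n, forall w w', agree n w w' ->
    `|phi w - phi w'| < eps / (2 * (k%:R + 1)).
  by apply: continuous_unif => //; rewrite divr_gt0// mulr_gt0// ltr_wpDl.
set eps' := eps / (2 * (k%:R + 1)) in Hn.
have epsE : k%:R * (2 * eps') <= eps.
  have k10 : 0 < k%:R + 1 :> R by rewrite ltr_wpDl.
  have -> : k%:R * (2 * eps') = eps * (k%:R / (k%:R + 1)).
    by rewrite /eps'; field; exact: lt0r_neq0.
  by rewrite ler_piMr ?ltW// ltr_pdivrMr// mul1r ltrDl.
pose W := @head_word _ _ S0 (k + n).
have mW : fin_measurable W by exact: fin_measurable_head.
pose f (v : {ffun 'I_n -> A}) := phi (ext v) + eps'.
have h1 : \int[mu]_w phi w <= Ev mu (@head_word _ _ S0 n) f.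
  apply: Rint_le_Ev => //; first exact: fin_measurable_head.
  move=> w; rewrite -lerBlDl (le_trans (ler_norm _))//.
  by apply/ltW/Hn/head_word_agree; rewrite extK.
pose F (l : 'I_k) (u : {ffun 'I_(k + n) -> A}) :=
  f (head_word n (iter l sigma (ext u))).
have hl (l : 'I_k) : Ev mu (@head_word _ _ S0 n) f = Ev mu W (F l).
  rewrite -[LHS](Ev_shift mu_inv l _ (@fin_measurable_head _ _ S0 n)).
  rewrite (Ev_comp mu (fun u => head_word n (iter l sigma (ext u))) f mW).
  apply: Ev_eq => w /=; apply/head_word_agree/agree_shift.
  apply: (@agree_leq _ _ _ _ (k + n)); first by rewrite leq_add2r ltnW.
  by apply/head_word_agree; rewrite extK.
have -> : k%:R * \int[mu]_w phi w = \sum_(l < k) \int[mu]_w phi w.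
  by rewrite sumr_const card_ord mulr_natl.
apply: (@le_trans _ _ (Ev mu W (fun u => lift_sup e phi (Z (ext u)) + eps))).
  rewrite (le_trans (ler_sum _ (G := fun l => Ev mu W (F l)) _))//.
    by move=> l _; rewrite -hl.
  rewrite -Ev_sum; apply: Ev_le => u.
  apply: (@le_trans _ _ (\sum_(l < k) (phi (iter l sigma (ext u)) + 2 * eps'))).
    apply: ler_sum => l _; rewrite /F /f.
    set w := iter l sigma _; have : `|phi (ext (head_word n w)) - phi w| < eps'.
      by apply/Hn/head_word_agree; rewrite extK.
    by rewrite ltr_norml => /andP[_]; lra.
  rewrite big_split/= sumr_const card_ord -[_ *+ k]mulr_natl lerD//.
  by apply: (bsum_le_lift phi_bnd) => i; rewrite ffunE ee.
rewrite EvD Ev_cst// (Ev_comp mu (fun u => Z (ext u)) _ mW).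
rewrite le_eqVlt; apply/orP; left; apply/eqP; congr (_ + _).
apply: Ev_eq => w /=; apply/ffunP => i; rewrite !ffunE; congr e.
have /head_word_agree -> // : head_word (k + n) (ext (head_word (k + n) w)) = head_word (k + n) w.
  by rewrite extK.
by rewrite ltn_addr.
Qed.
End to_upper_mean.
End continuous_integral.

(** * From averages over words to invariant measures *)

Section ultralimit.
Variable R : realType.

Lemma ultra_cvg_bounded (U : set_system nat) (u : nat -> R) (B : R) :
  UltraFilter U -> (forall n, `|u n| <= B) -> exists l : R, u @ U --> l.
Proof.
move=> UU uB; have Ic := @segment_compact R (- B) B.
have UI : (u @ U) [set` `[- B, B]].
  by apply: nearW => n /=; rewrite in_itv /= -ler_norml.
have [l [_ cl]] := Ic (u @ U) _ UI.
exists l => V Vl; have [//|UnV] := @in_ultra_setVsetC _ U (u @^-1` V) UU.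
have [x [nVx Vx]] := cl (~` V) V UnV Vl.
by [].
Qed.
End ultralimit.

Section functional_limit.
Variables (R : realType) (T : finType) (S : {set T}) (S0 : S != finset.set0).
Local Notation A := (alphabet S0).
Local Notation Sh := (fullshift A).
Local Notation sigma := (@left_shift A).
Variable p : nat -> (Sh -> R) -> R.
Hypothesis pD : forall k f g, p k (fun w => f w + g w) = p k f + p k g.
Hypothesis pZ : forall k c f, p k (fun w => c * f w) = c * p k f.
Hypothesis p_mono : forall k f g, (forall w, f w <= g w) -> p k f <= p k g.
Hypothesis p1 : forall k, p k (fun=> 1) = 1.

Let p_cst k c : p k (fun=> c) = c.
Proof. by rewrite -[RHS]mulr1 -(p1 k) -pZ; congr p; apply/funext => w; rewrite mulr1. Qed.

Let p_bound k f B : (forall w, `|f w| <= B) -> `|p k f| <= B.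
Proof.
move=> fB; rewrite ler_norml -{1}(p_cst k (- B)) -{2}(p_cst k B).
by apply/andP; split; apply: p_mono => w; have := fB w; rewrite ler_norml => /andP[].
Qed.

(** The limit of the functionals along an ultrafilter is linear and positive, so
    its values on the indicators of cylinders are consistent masses. *)
Lemma functional_limit : exists mu : probability Sh R,
  forall n (g : {ffun 'I_n -> A} -> R) l,
    (\forall k \near \oo, p k (g \o @head_word _ _ S0 n) <= l) ->
    Ev mu (@head_word _ _ S0 n) g <= l.
Proof.
have [U [UU oU]] := @ultraFilterLemma nat \oo _.
have /choice[pl Hpl] : forall f : Sh -> R, exists l : R, (exists B, forall w, `|f w| <= B) ->
    p k f @[k --> U] --> l.
  move=> f; have [[B fB]|nB] := pselect (exists B, forall w, `|f w| <= B).
    have [l Hl] := @ultra_cvg_bounded R U (fun k => p k f) B UU (fun k => p_bound k fB).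
    by exists l.
  by exists 0.
have plE f l : (exists B, forall w, `|f w| <= B) -> p k f @[k --> U] --> l -> pl f = l.
  by move=> bf fl; apply: (cvg_unique _ (Hpl f bf) fl).
have plD f g : (exists B, forall w, `|f w| <= B) -> (exists B, forall w, `|g w| <= B) ->
    pl (fun w => f w + g w) = pl f + pl g.
  move=> bf bg; apply: plE.
    have [B fB] := bf; have [C gC] := bg; exists (B + C) => w.
    by rewrite (le_trans (ler_normD _ _))// lerD.
  under eq_fun do rewrite pD.
  exact: cvgD (Hpl f bf) (Hpl g bg).
have plZ c f : (exists B, forall w, `|f w| <= B) -> pl (fun w => c * f w) = c * pl f.
  move=> bf; apply: plE.
    have [B fB] := bf; exists (`|c| * B) => w.
    by rewrite normrM ler_wpM2l.
  under eq_fun do rewrite pZ.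
  by apply: cvgM (Hpl f bf); exact: cvg_cst.
have pl_ge0 f : (exists B, forall w, `|f w| <= B) -> (forall w, 0 <= f w) -> 0 <= pl f.
  move=> bf f0; apply: (cvgr_to_ge (Hpl f bf)); apply: nearW => k.
  by rewrite -[leLHS](p_cst k); exact: p_mono.
have pl_sum (I : finType) (h : I -> Sh -> R) : (forall i, exists B, forall w, `|h i w| <= B) ->
    pl (fun w => \sum_i h i w) = \sum_i pl (h i).
  move=> bh; suff [] : (exists B, forall w, `|\sum_i h i w| <= B) /\
    pl (fun w => \sum_i h i w) = \sum_i pl (h i) by [].
  elim: (index_enum I) => [|i r [[B IHB] IH]].
    split; first by exists 0 => w; rewrite big_nil normr0.
    rewrite big_nil; under eq_fun do rewrite big_nil.
    apply: plE; first by exists 0 => w; rewrite normr0.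
    by under eq_fun do rewrite p_cst; exact: cvg_cst.
  split.
    have [C hC] := bh i; exists (C + B) => w.
    by rewrite big_cons (le_trans (ler_normD _ _))// lerD.
  under eq_fun do rewrite big_cons.
  by rewrite big_cons -IH plD//; exists B.
pose ind s (w : Sh) : R := (mkseq w (size s) == s)%:R.
have bind s : exists B, forall w, `|ind s w| <= B.
  by exists 1 => w; rewrite /ind; case: eqP => _; rewrite ?normr0 ?normr1.
have [|||mu Hmu] := @measure_of_masses R T S S0 (fun s => pl (ind s)).
- by move=> s; apply: pl_ge0 => // w; rewrite /ind ler0n.
- apply: plE => //; rewrite (_ : ind [::] = fun=> 1); last exact/funext.
  by under eq_fun do rewrite p1; exact: cvg_cst.
- move=> s; rewrite -pl_sum//; congr pl; apply/funext => w.
  rewrite /ind; under eq_bigr do rewrite size_rcons mkseqS eqseq_rcons.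
  case: eqP => _; last by rewrite big1.
  rewrite (bigD1 (w (size s)))//= eqxx big1 ?addr0// => a /negbTE.
  by rewrite eq_sym => ->.
exists mu => n g l Hl.
have bg : exists B, forall w, `|(g \o @head_word _ _ S0 n) w| <= B.
  exists (\sum_u `|g u|) => w /=.
  by rewrite (bigD1 (head_word n w))//= lerDl sumr_ge0.
have <- : pl (g \o @head_word _ _ S0 n) = Ev mu (@head_word _ _ S0 n) g.
  rewrite /Ev.
  have -> : g \o @head_word _ _ S0 n =
      fun w => \sum_u g u * ind (mkseq (ext u) n) w.
    apply/funext => w /=; rewrite (bigD1 (head_word n w))//= big1 ?addr0.
      rewrite /ind size_mkseq (_ : _ == _) ?mulr1//.
      by apply/eqP/head_word_mkseq; rewrite extK.
    move=> u uw; rewrite /ind size_mkseq; case: eqP => [/head_word_mkseq h|]; rewrite ?mulr0//.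
    by move: uw; rewrite h extK eqxx.
  rewrite pl_sum.
    apply: eq_bigr => u _; rewrite plZ// mulrC; congr (_ * _).
    by rewrite -Hmu head_word_cyl.
  move=> u; have [B HB] := bind (mkseq (ext u) n); exists (`|g u| * B) => w.
  by rewrite normrM ler_wpM2l.
by apply: (cvgr_to_le (Hpl _ bg)); exact: oU.
Qed.
End functional_limit.

Section from_upper_mean.
Variables (R : realType) (T : finType) (S : {set T}) (S0 : S != finset.set0).
Local Notation A := (alphabet S0).
Local Notation Sh := (fullshift A).
Local Notation sigma := (@left_shift A).
Variables (e : A -> A) (ee : forall a, e (e a) = e a).
Local Notation N := #|[pred a | e a == a]|.
Local Notation fixed_words k := (@fixed_words _ _ S0 e k).

(** Positions [l] to [l + n - 1] are imposed and all the others free. *)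
Lemma card_fixed_prescribed k l n (d : {ffun 'I_n -> A}) : (l + n <= k)%N ->
  d \in fixed_words n ->
  (#|[pred c : {ffun 'I_k -> A} | (c \in fixed_words k) &&
     [forall i : 'I_n, forall j : 'I_k, (j == l + i :> nat) ==> (c j == d i)]]| * N ^ n =
   N ^ k)%N.
Proof.
move=> lnk dn.
pose F (j : 'I_k) : {pred A} := [pred a | (e a == a) &&
  [forall i : 'I_n, (j == l + i :> nat) ==> (a == d i)]].
have -> : #|[pred c : {ffun 'I_k -> A} | (c \in fixed_words k) &&
     [forall i : 'I_n, forall j : 'I_k, (j == l + i :> nat) ==> (c j == d i)]]| =
   #|(family F : {pred {ffun 'I_k -> A}})|.
  apply: eq_card => c; rewrite !inE; apply/andP/familyP => [[cf h] j|h].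
    rewrite inE; have /ffun_onP/(_ j) := cf; rewrite inE => -> /=.
    by apply/forallP => i; move: h => /forallP/(_ i)/forallP/(_ j).
  split.
    by apply/ffun_onP => j; have := h j; rewrite !inE => /andP[].
  by apply/forallP => i; apply/forallP => j; have := h j; rewrite inE => /andP[_ /forallP/(_ i)].
rewrite -sum1_card.
have -> : (\sum_(c in (family F : {pred {ffun 'I_k -> A}})) 1 = \prod_(j < k) #|F j|)%N.
  under [RHS]eq_bigr do rewrite -sum1_card.
  rewrite (bigA_distr_big_dep (fun j => F j) (fun _ _ => 1%N))/=.
  by apply: eq_bigr => c _; rewrite big1.
have FE (j : 'I_k) : #|F j| = if (l <= j < l + n)%N then 1%N else N.
  case: ifP => jl.
    have jn : (j - l < n)%N by lia.
    rewrite -(card1 (d (Ordinal jn))); apply: eq_card => a; rewrite !inE.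
    apply/andP/eqP => [[_ /forallP/(_ (Ordinal jn))]|->].
      by move=> /implyP h; apply/eqP/h; apply/eqP => /=; lia.
    have /ffun_onP/(_ (Ordinal jn)) := dn; rewrite inE => ->; split => //.
    apply/forallP => i; apply/implyP => /eqP ji; apply/eqP; congr (d _).
    by apply: val_inj => /=; lia.
  apply: eq_card => a; rewrite !inE; rewrite (_ : [forall i, _]) ?andbT//.
  by apply/forallP => i; apply/implyP => /eqP ji; have := ltn_ord i; lia.
rewrite (eq_bigr _ (fun j _ => FE j)).
have -> : (N ^ n = \prod_(j < k) if (l <= j < l + n)%N then N else 1)%N.
  rewrite -(big_mkord xpredT (fun j => if (l <= j < l + n)%N then N else 1%N)).
  rewrite (@big_cat_nat _ _ _ (l + n))//= (@big_cat_nat _ _ _ l) ?leq_addr//=.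
  rewrite big_nat big1 ?mul1n => [|j jl]; last by case: ifP => //; lia.
  rewrite (big_nat _ _ (l + n) k) [X in (_ = _ * X)%N]big1 ?muln1 => [|j jl]; last first.
    by case: ifP => //; lia.
  rewrite big_nat (eq_bigr (fun=> N)) => [|j ->//].
  by rewrite -big_nat prod_nat_const_nat addKn.
rewrite -big_split/= (eq_bigr (fun=> N)).
  by rewrite prod_nat_const card_ord.
by move=> j _; case: ifP; rewrite ?mul1n ?muln1.
Qed.

Let NR : 0 < N%:R :> R. Proof. by rewrite ltr0n fixed_gt0. Qed.

(** The integral of [f] against the mean of the empirical measures of length
    [k.+1] at the chosen lifts [x c], over all the words [c] of the factor. *)
Definition lift_avg k (x : {ffun 'I_k.+1 -> A} -> Sh) (f : Sh -> R) : R :=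
  N%:R ^- k.+1 * \sum_(c in fixed_words k.+1) (k.+1%:R^-1 * bsum f k.+1 (x c)).

Lemma lift_avgD k x f g : @lift_avg k x (fun w => f w + g w) =
  lift_avg x f + lift_avg x g.
Proof.
rewrite /lift_avg -mulrDr -big_split/=; congr (_ * _); apply: eq_bigr => c _.
by rewrite -mulrDr /bsum big_split.
Qed.

Lemma lift_avgZ k x a f : @lift_avg k x (fun w => a * f w) = a * lift_avg x f.
Proof.
rewrite /lift_avg mulrCA; congr (_ * _); rewrite mulr_sumr; apply: eq_bigr => c _.
by rewrite mulrCA; congr (_ * _); rewrite /bsum mulr_sumr.
Qed.

Lemma lift_avg_mono k x f g : (forall w, f w <= g w) ->
  @lift_avg k x f <= lift_avg x g.
Proof.
move=> fg; rewrite ler_wpM2l ?invr_ge0 ?exprn_ge0//; apply: ler_sum => c _.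
by rewrite ler_wpM2l ?invr_ge0//; apply: ler_sum.
Qed.

Lemma lift_avg1 k x : @lift_avg k x (fun=> 1) = 1.
Proof.
rewrite /lift_avg (eq_bigr (fun=> 1)); last first.
  by move=> c _; rewrite /bsum sumr_const card_ord mulVf// pnatr_eq0.
by rewrite sumr_const card_fixed_words natrX mulVf// expf_neq0// lt0r_neq0.
Qed.

Lemma lift_avg_cst k x c : @lift_avg k x (fun=> c) = c.
Proof.
rewrite -[RHS]mulr1 -(lift_avg1 x) -lift_avgZ; congr lift_avg.
by apply/funext => w; rewrite mulr1.
Qed.

(** The Birkhoff sum of [f \o sigma - f] telescopes. *)
Lemma lift_avg_shift k x f B : (forall w, `|f w| <= B) ->
  @lift_avg k x (fun w => f (sigma w) - f w) <= 2 * B / k.+1%:R.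
Proof.
move=> fB; rewrite -[leRHS](lift_avg_cst x) /lift_avg.
rewrite ler_wpM2l ?invr_ge0 ?exprn_ge0//; apply: ler_sum => c _.
rewrite ler_wpM2l ?invr_ge0// [leRHS]/bsum sumr_const card_ord -[leRHS]mulr_natl.
rewrite mulrC divfK ?pnatr_eq0//.
have -> : bsum (fun w => f (sigma w) - f w) k.+1 (x c) =
    f (iter k.+1 sigma (x c)) - f (x c).
  rewrite /bsum; elim: k.+1 => [|j IH]; first by rewrite big_ord0 subrr.
  by rewrite big_ord_recr IH /=; ring.
have := fB (iter k.+1 sigma (x c)); have := fB (x c).
by rewrite !ler_norml => /andP[h1 h2] /andP[h3 h4]; lra.
Qed.

Lemma Ev_ind (mu : probability Sh R) (I : finType) (V : Sh -> I) (P : pred I) :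
  fin_measurable V -> Ev mu V (fun i => (P i)%:R) = Pr mu [set w | P (V w)].
Proof.
move=> mV.
have -> : [set w | P (V w)] = (P \o V) @^-1` [set true] by [].
rewrite Pr_comp// /Ev [RHS]big_mkcond/=; apply: eq_bigr => i _.
by case: (P i); rewrite ?mulr1 ?mulr0.
Qed.

(** The words of the factor are all averaged with the same weight, so a prescribed
    word is seen at a given position with the right frequency; only the last [n]
    positions of each segment escape this count. *)
Lemma lift_avg_fiber k n (x : {ffun 'I_k.+1 -> A} -> Sh) (d : {ffun 'I_n -> A}) :
  (forall c, fiber e c (x c)) -> (n <= k.+1)%N -> d \in fixed_words n ->
  `|lift_avg x (fun w => [forall i : 'I_n, e (w i) == d i]%:R) - N%:R ^- n|
  <= n%:R / k.+1%:R :> R.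
Proof.
move=> fx nk dn; set f : Sh -> R := fun w => _.
pose a l : R := N%:R ^- k.+1 * \sum_(c in fixed_words k.+1) f (iter l sigma (x c)).
have aE l : (l + n <= k.+1)%N -> a l = N%:R ^- n :> R.
  move=> lnk; have := card_fixed_prescribed lnk dn.
  move=> /(congr1 (fun j => j%:R : R)); rewrite natrM !natrX => h.
  rewrite /a; have -> : \sum_(c in fixed_words k.+1) f (iter l sigma (x c)) =
     #|[pred c : {ffun 'I_k.+1 -> A} | (c \in fixed_words k.+1) &&
     [forall i : 'I_n, forall j : 'I_k.+1, (j == l + i :> nat) ==> (c j == d i)]]|%:R.
    rewrite -sum1_card natr_sum big_mkcond [RHS]big_mkcond/=.
    apply: eq_bigr => c _; rewrite [in RHS]inE; case: ifP => // cf /=.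
    have cfix (j : 'I_k.+1) : e (c j) = c j.
      by move/ffun_onP : cf => /(_ j); rewrite inE => /eqP.
    have iff : [forall i : 'I_n, e (iter l sigma (x c) i) == d i] <->
      [forall i : 'I_n, forall j : 'I_k.+1, (j == l + i :> nat) ==> (c j == d i)].
      split => /forallP h'; apply/forallP => i.
        apply/forallP => j; apply/implyP => /eqP ji.
        have e1 : iter l sigma (x c) i = x c j by rewrite iter_shift ji.
        by move: (h' i); rewrite e1 fx cfix.
      have lk : (l + i < k.+1)%N by rewrite (leq_trans _ lnk)// ltn_add2l.
      move: (h' i) => /forallP/(_ (Ordinal lk)); rewrite eqxx /= => /eqP <-.
      by rewrite iter_shift (fx c (Ordinal lk)) cfix.
    case: ifP => [/iff.2|/negbT/negP nh]; rewrite /f; first by move=> ->.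
    by case: (boolP [forall i : 'I_n, e (iter l sigma (x c) i) == d i]) => // /iff.1.
  have Nn m : N%:R ^+ m != 0 :> R by rewrite expf_neq0// lt0r_neq0.
  by apply: (mulIf (Nn n)); rewrite -mulrA h !mulVf.
have a01 l : 0 <= a l <= 1.
  apply/andP; split.
    rewrite mulr_ge0 ?invr_ge0 ?exprn_ge0//; apply: sumr_ge0 => c _.
    by rewrite /f ler0n.
  rewrite /a mulrC ler_pdivrMr ?exprn_gt0// mul1r.
  apply: (@le_trans _ _ (\sum_(c in fixed_words k.+1) 1)).
    by apply: ler_sum => c _; rewrite /f; case: [forall _, _].
  by rewrite sumr_const card_fixed_words// natrX.
have -> : lift_avg x f = k.+1%:R^-1 * \sum_(0 <= l < k.+1) a l.
  rewrite /lift_avg -mulr_sumr mulrCA; congr (_ * _).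
  by rewrite big_mkord -mulr_sumr /bsum exchange_big.
have n01 : 0 <= (N%:R ^- n : R) /\ (N%:R ^- n : R) <= 1.
  split; first by rewrite invr_ge0 exprn_ge0.
  rewrite invf_le1 ?exprn_gt0// exprn_ege1//.
  by rewrite ler1n fixed_gt0.
rewrite -[X in _ - X](mulKf (x := k.+1%:R)) ?pnatr_eq0// -mulrBr normrM.
rewrite ger0_norm ?invr_ge0// mulrC ler_wpM2r ?invr_ge0//.
have -> : k.+1%:R * N%:R ^- n = \sum_(0 <= l < k.+1) N%:R ^- n :> R.
  by rewrite big_mkord sumr_const card_ord mulr_natl.
rewrite -sumrB (le_trans (ler_norm_sum _ _ _))//.
rewrite (@big_cat_nat _ _ _ (k.+1 - n))//= ?leq_subr//.
rewrite big_nat big1 ?add0r; last first.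
  move=> l /andP[_ h]; rewrite aE ?subrr ?normr0//; lia.
rewrite (le_trans (ler_sum _ (G := fun=> 1) _))//.
  move=> l _; have := a01 l; rewrite ler_norml; lra.
by rewrite big_const_nat iter_addr addr0 subKn.
Qed.

Lemma continuous_opp_fun (phi : Sh -> R) : continuous phi ->
  continuous (fun w => - phi w).
Proof. by move=> cphi w; exact: (cvgN (@cphi w)). Qed.

Lemma norm_near (x l d eps : R) : `|x - l| <= d -> d <= eps ->
  x <= l + eps /\ - x <= - (l - eps).
Proof. by rewrite ler_norml => /andP[h1 h2] h3; split; lra. Qed.

(** The weight is 0 or 1 when one endpoint is already close to [al], and otherwise
    makes the mixture equal to [al]. *)
Lemma mix_exists (x y al d : R) : 0 <= d -> al - d <= x -> y <= al + d ->
  exists t, 0 <= t <= 1 /\ `|t * x + (1 - t) * y - al| <= d.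
Proof.
move=> d0 hx hy; have [x1|x1] := leP x (al + d).
  exists 1; rewrite lexx ler01 subrr mul1r mul0r addr0 ler_norml.
  by split=> //; apply/andP; split; lra.
have [y1|y1] := leP (al - d) y.
  exists 0; rewrite lexx ler01 subr0 mul1r mul0r add0r ler_norml.
  by split=> //; apply/andP; split; lra.
have xy : 0 < x - y by lra.
exists ((al - y) / (x - y)); split.
  by rewrite divr_ge0 ?ler_pdivrMr ?mul1r//=; lra.
have -> : (al - y) / (x - y) * x + (1 - (al - y) / (x - y)) * y - al = 0.
  by field; exact: lt0r_neq0.
by rewrite normr0.
Qed.

Lemma lift_avg_ge (phi : Sh -> R) alpha k (x : {ffun 'I_k.+1 -> A} -> Sh) :
  upper_mean e phi alpha ->
  (forall c, lift_sup e phi c - 1 < bsum phi k.+1 (x c)) ->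
  alpha - k.+1%:R^-1 <= lift_avg x phi.
Proof.
move=> up hx; rewrite /lift_avg mulrC ler_pdivlMr ?exprn_gt0//.
rewrite -mulr_sumr mulrC ler_pdivlMl// mulrCA mulrBr mulfV ?pnatr_eq0//.
apply: (@le_trans _ _ (\sum_(c in fixed_words k.+1) (lift_sup e phi c - 1))).
  rewrite sumrB sumr_const card_fixed_words// natrX mulrBr mulr1 lerD2r.
  exact: up.
by apply: ler_sum => c _; exact: ltW.
Qed.

(** The averages over maximal lifts are at least [alpha] and those over minimal
    lifts at most [alpha], up to [k.+1%:R^-1]; a mixture of the two is close to
    [alpha].  A limit of these mixtures is invariant by [lift_avg_shift] and has
    the right masses over the factor by [lift_avg_fiber]. *)
Lemma invariant_of_upper_mean (phi : Sh -> R) alpha : continuous phi ->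
  upper_mean e phi alpha -> upper_mean e (fun w => - phi w) (- alpha) ->
  exists mu : probability Sh R, [/\ invariant_measure sigma mu,
    forall k (c : {ffun 'I_k -> A}), c \in fixed_words k ->
      Pr mu (fiber e c) = N%:R ^- k &
    \int[mu]_w phi w = alpha].
Proof.
move=> cphi up dn; have [B B0 phi_bnd] := continuous_bounded cphi.
have Nphi_bnd w : `|- phi w| <= B by rewrite normrN.
have exp k (c : {ffun 'I_k.+1 -> A}) : exists w,
    fiber e c w /\ lift_sup e phi c - 1 < bsum phi k.+1 w.
  by have [w] := lift_sup_adherent e phi_bnd c; exists w.
have exm k (c : {ffun 'I_k.+1 -> A}) : exists w,
    fiber e c w /\ lift_sup e (fun w => - phi w) c - 1 <
      bsum (fun w => - phi w) k.+1 w.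
  by have [w] := lift_sup_adherent e Nphi_bnd c; exists w.
pose wp k c := sval (cid (exp k c)); pose wm k c := sval (cid (exm k c)).
have Hwp k c := svalP (cid (exp k c)); have Hwm k c := svalP (cid (exm k c)).
have avgN k (x : {ffun 'I_k.+1 -> A} -> Sh) f :
    lift_avg x (fun w => - f w) = - lift_avg x f.
  rewrite -mulN1r -lift_avgZ; congr lift_avg; apply/funext => w.
  by rewrite mulN1r.
have /choice[t Ht] : forall k, exists t, 0 <= t <= 1 /\
  `|t * lift_avg (wp k) phi + (1 - t) * lift_avg (wm k) phi - alpha| <= k.+1%:R^-1.
  move=> k; apply: mix_exists; first by rewrite invr_ge0.
    by apply: lift_avg_ge => // c; exact: (Hwp k c).2.
  rewrite -lerN2 opprD -avgN.
  by apply: lift_avg_ge => // c; exact: (Hwm k c).2.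
pose p k f := t k * lift_avg (wp k) f + (1 - t k) * lift_avg (wm k) f.
have t0 k : 0 <= t k by have [/andP[]] := Ht k.
have t1 k : 0 <= 1 - t k by have [/andP[_]] := Ht k; rewrite subr_ge0.
have pD k f g : p k (fun w => f w + g w) = p k f + p k g.
  by rewrite /p !lift_avgD; ring.
have pZ k c f : p k (fun w => c * f w) = c * p k f.
  by rewrite /p !lift_avgZ; ring.
have pN k f : p k (fun w => - f w) = - p k f by rewrite /p !avgN; ring.
have p_mono k f g : (forall w, f w <= g w) -> p k f <= p k g.
  by move=> fg; rewrite /p lerD// ler_wpM2l// lift_avg_mono.
have p1 k : p k (fun=> 1) = 1 by rewrite /p !lift_avg1//; ring.
have p_cst k c : p k (fun=> c) = c.
  by rewrite -[RHS]mulr1 -(p1 k) -pZ; congr p; apply/funext => w; rewrite mulr1.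
have p_near k f l d : `|lift_avg (wp k) f - l| <= d ->
    `|lift_avg (wm k) f - l| <= d -> `|p k f - l| <= d.
  move=> h1 h2; have -> : p k f - l = t k * (lift_avg (wp k) f - l) +
      (1 - t k) * (lift_avg (wm k) f - l) by rewrite /p; ring.
  rewrite (le_trans (ler_normD _ _))// !normrM (ger0_norm (t0 k)) (ger0_norm (t1 k)).
  have := ler_wpM2l (t0 k) h1; have := ler_wpM2l (t1 k) h2; lra.
have [mu Hmu] := functional_limit pD pZ p_mono p1.
have EvE n (g : {ffun 'I_n -> A} -> R) l (d : R) :
    (\forall k \near \oo, `|p k (g \o @head_word _ _ S0 n) - l| <= d / k.+1%:R) ->
    Ev mu (@head_word _ _ S0 n) g = l.
  move=> H; have small eps : 0 < eps -> \forall k \near \oo, d / k.+1%:R <= eps.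
    move=> eps0; have : \forall k \near \oo, d / eps <= k%:R by exact: nbhs_infty_ger.
    apply: filterS => k; rewrite ler_pdivrMr// => h.
    rewrite ler_pdivrMr// mulrC (le_trans h)// ler_wpM2r ?ler_nat//.
    exact: ltW.
  apply/le_anti/andP; split; apply/ler_addgt0Pr => eps eps0.
    apply: Hmu; near=> k.
    have h1 : `|p k (g \o @head_word _ _ S0 n) - l| <= d / k.+1%:R by near: k.
    have h2 : d / k.+1%:R <= eps by near: k; exact: small.
    exact: (norm_near h1 h2).1.
  rewrite -lerBlDr -lerN2 -EvN; apply: Hmu; near=> k.
  have h1 : `|p k (g \o @head_word _ _ S0 n) - l| <= d / k.+1%:R by near: k.
  have h2 : d / k.+1%:R <= eps by near: k; exact: small.
  have -> : p k ((fun i => - g i) \o @head_word _ _ S0 n) =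
    - p k (g \o @head_word _ _ S0 n) by rewrite -pN.
  exact: (norm_near h1 h2).2.
have int_le psi beta : continuous psi -> (forall k, p k psi <= beta + k.+1%:R^-1) ->
    \int[mu]_w psi w <= beta.
  move=> cpsi Hp; apply/ler_addgt0Pr => eps eps0.
  have e30 : 0 < eps / 3 by rewrite divr_gt0.
  have [n Hn] := continuous_unif cpsi e30.
  have osc w : `|psi w - psi (ext (head_word n w))| < eps / 3.
    by apply/Hn/head_word_agree; rewrite extK.
  apply: (@le_trans _ _ (Ev mu (@head_word _ _ S0 n) (fun u => psi (ext u) + eps / 3))).
    apply: Rint_le_Ev => //; first exact: fin_measurable_head.
    by move=> w; have := osc w; rewrite ltr_norml; lra.
  apply: Hmu; near=> k.
  apply: (@le_trans _ _ (p k (fun w => psi w + 2 * (eps / 3)))).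
    by apply: p_mono => w /=; have := osc w; rewrite ltr_norml; lra.
  rewrite (pD k psi (fun=> _)) p_cst.
  have h : k.+1%:R^-1 <= eps / 3.
    rewrite -[leRHS]invrK lef_pV2 ?posrE ?invr_gt0//.
    have h : (eps / 3)^-1 <= k%:R by near: k; exact: nbhs_infty_ger.
    by rewrite (le_trans h)// ler_nat.
  by move: (Hp k) h; set z := k.+1%:R^-1; move: z => z; lra.
exists mu; split.
- apply: invariant_of_words => n v.
  pose f (w : Sh) : R := (head_word n w == v)%:R.
  have fB w : `|f w| <= 1 by rewrite /f; case: eqP; rewrite ?normr0 ?normr1.
  have NfB w : `|- f w| <= 1 by rewrite normrN.
  pose g1 (u : {ffun 'I_n.+1 -> A}) : R := f (sigma (ext u)).
  pose g2 (u : {ffun 'I_n.+1 -> A}) : R := f (ext u).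
  have h1 w : head_word n (sigma (ext (head_word n.+1 w))) = head_word n (sigma w).
    apply/head_word_agree => i lin; rewrite /left_shift.
    have /head_word_agree -> // : head_word n.+1 (ext (head_word n.+1 w)) = head_word n.+1 w.
    by rewrite extK.
  have h2 w : head_word n (ext (head_word n.+1 w)) = head_word n w.
    apply/head_word_agree/(@agree_leq _ _ _ _ n.+1) => //.
    by apply/head_word_agree; rewrite extK.
  have gE : (fun u => g1 u + - g2 u) \o @head_word _ _ S0 n.+1 =
      fun w => f (sigma w) - f w.
    by apply/funext => w; rewrite /g1 /g2 /f /= h1 h2.
  have avg0 k x : `|@lift_avg k x (fun w => f (sigma w) - f w)| <= 2 * 1 / k.+1%:R.
    rewrite ler_norml (lift_avg_shift x fB) andbT lerNl -avgN.
    have := lift_avg_shift x NfB; congr (_ <= _); congr lift_avg.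
    by apply/funext => w; ring.
  have : Ev mu (@head_word _ _ S0 n.+1) (fun u => g1 u + - g2 u) = 0.
    apply: (EvE _ _ _ (2 * 1)); apply: nearW => k; rewrite gE.
    by apply: p_near; rewrite subr0 avg0.
  rewrite EvD EvN => /eqP; rewrite subr_eq0 => /eqP.
  rewrite !Ev_ind; try exact: fin_measurable_head.
  move=> h; apply: etrans (etrans h _); congr Pr; apply/seteqP; split => w /=.
  + by move=> hw; rewrite h1 hw eqxx.
  + by rewrite h1 => /eqP.
  + by rewrite h2 => /eqP.
  + by move=> hw; rewrite h2 hw eqxx.
- move=> n d dfw.
  pose g (u : {ffun 'I_n -> A}) : R := [forall i : 'I_n, e (u i) == d i]%:R.
  have <- : Ev mu (@head_word _ _ S0 n) g = N%:R ^- n.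
    apply: (EvE _ _ _ n%:R); exists n => // k /= nk.
    have gE : g \o @head_word _ _ S0 n = fun w => [forall i : 'I_n, e (w i) == d i]%:R.
      apply/funext => w; rewrite /g /=; congr (nat_of_bool _)%:R.
      by apply: eq_forallb => i; rewrite ffunE.
    rewrite gE; apply: p_near; apply: lift_avg_fiber => //; try exact: leqW.
      by move=> c; exact: (Hwp k c).1.
    by move=> c; exact: (Hwm k c).1.
  rewrite Ev_ind; last exact: fin_measurable_head.
  have dfix i : e (d i) = d i by move/ffun_onP : dfw => /(_ i); rewrite inE => /eqP.
  congr Pr; apply/seteqP; split => w /= h.
    by apply/forallP => i; rewrite ffunE h dfix.
  by move=> i; rewrite dfix; move/forallP : h => /(_ i); rewrite ffunE => /eqP.
- apply/le_anti/andP; split.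
    apply: int_le => // k; have [_] := Ht k; rewrite -/(p k phi).
    by move=> h; have [] := norm_near h (lexx _).
  rewrite -lerN2 -RintN//; apply: int_le; first exact: continuous_opp_fun.
  move=> k; rewrite pN; have [_] := Ht k; rewrite -/(p k phi).
  by move=> h; have [_] := norm_near h (lexx _); rewrite opprB addrC.
Unshelve. all: by end_near. Qed.
End from_upper_mean.

(** * Codes and distances on the sponge *)

Section geometry.
Variables (R : realType) (d : nat) (a : 'I_d -> nat).
Hypothesis a_ge2 : forall q, (2 <= a q)%N.
Variables (D : {set digit a}) (D0 : D != finset.set0).
Local Notation A := (alphabet D0).
Local Notation Sh := (fullshift A).
Local Notation PI := (@Pi R d a D D0).

Definition dig (q : 'I_d) (w : Sh) (n : nat) : nat := val (w n) q.

(** The integer whose expansion in base [a q] consists of the first [L] digits. *)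
Fixpoint digit_code (q : 'I_d) (w : Sh) (L : nat) : nat :=
  if L is L'.+1 then (digit_code q w L' * a q + dig q w L')%N else 0%N.

Lemma dig_lt q w n : (dig q w n < a q)%N.
Proof. exact: ltn_ord. Qed.

Lemma digit_code_lt q w L : (digit_code q w L < a q ^ L)%N.
Proof.
elim: L => // L IH /=; rewrite expnSr.
have := dig_lt q w L; move: IH; set c := digit_code _ _ _; set M := (_ ^ L)%N => cM gL.
by rewrite (@leq_trans ((c.+1) * a q)%N)// ?leq_mul2r ?cM ?orbT// mulSnr ltn_add2l.
Qed.

Lemma digit_code_inj q w w' L : digit_code q w L = digit_code q w' L ->
  forall n, (n < L)%N -> dig q w n = dig q w' n.
Proof.
elim: L => // L IH /= h n; rewrite ltnS leq_eqVlt.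
have a0 : (0 < a q)%N by rewrite (leq_trans _ (a_ge2 q)).
have h1 : dig q w L = dig q w' L.
  have := congr1 (modn^~ (a q)) h.
  by rewrite /= !modnMDl !modn_small ?dig_lt.
move=> /orP[/eqP->//|]; apply: IH.
have := congr1 (divn^~ (a q)) h.
by rewrite /= !divnMDl// !divn_small ?dig_lt// !addn0.
Qed.

Definition coord (q : 'I_d) (w : Sh) : R :=
  limn (series (fun n => (val (w n) q)%:R / (a q)%:R ^+ n.+1 : R)).

Section coord_bounds.
Variables (q : 'I_d) (w : Sh).
Let u n : R := (dig q w n)%:R / (a q)%:R ^+ n.+1.

Let aR : 0 < (a q)%:R :> R.
Proof. by rewrite ltr0n (leq_trans _ (a_ge2 q)). Qed.

Let uS n : series u n.+1 = series u n + u n.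
Proof. by rewrite /series /= big_nat_recr. Qed.

Let series_code L : series u L = (digit_code q w L)%:R / (a q)%:R ^+ L.
Proof.
elim: L => [|L IH]; first by rewrite /series /= big_geq// mul0r.
rewrite uS IH /= natrD natrM /u exprS.
by field; rewrite expf_neq0 ?lt0r_neq0//= lt0r_neq0.
Qed.

Let series_le L n : (L <= n)%N -> series u n <= ((digit_code q w L).+1)%:R / (a q)%:R ^+ L.
Proof.
move=> Ln; suff h : series u n + (a q)%:R ^- n <= ((digit_code q w L).+1)%:R / (a q)%:R ^+ L.
  by rewrite (le_trans _ h)// lerDl invr_ge0 exprn_ge0// ltW.
rewrite -(subnK Ln); elim: (n - L)%N => [|m IH].
  by rewrite add0n series_code -natr1 mulrDl mul1r.
rewrite (le_trans _ IH)// addSn uS -addrA lerD2l.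
rewrite /u -[X in _ + X]mul1r -mulrDl natr1 ler_pdivrMr ?exprn_gt0//.
rewrite exprS mulrCA mulVf ?mulr1; last by rewrite expf_neq0// lt0r_neq0.
by rewrite ler_nat dig_lt.
Qed.

Let series_ndec : nondecreasing_seq (series u).
Proof.
apply/nondecreasing_seqP => n; rewrite uS lerDl.
by rewrite /u divr_ge0// exprn_ge0// ltW.
Qed.

Lemma coord_bounds L : (digit_code q w L)%:R <= coord q w * (a q)%:R ^+ L <= ((digit_code q w L).+1)%:R.
Proof.
have cv : cvgn (series u).
  apply: nondecreasing_is_cvgn => //; exists (((digit_code q w 0).+1)%:R / (a q)%:R ^+ 0).
  by move=> _ [n _ <-]; exact: series_le.
have aL : 0 < (a q)%:R ^+ L :> R by rewrite exprn_gt0.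
apply/andP; split.
  by rewrite -ler_pdivrMr// -series_code; exact: nondecreasing_cvgn_le.
rewrite -ler_pdivlMr//.
by apply: limr_le => //; exists L => // n /= Ln; exact: series_le.
Qed.
End coord_bounds.

(** The least level at which the intervals of the [q]-th coordinate are at most
    [2^-n] long. *)
Definition lev (q : 'I_d) n := up_log (a q) (2 ^ n).

Lemma lev_ge q n : (2 ^ n <= a q ^ lev q n)%N.
Proof. exact: up_logP. Qed.

Lemma lev_lt q n : (a q ^ lev q n <= a q * 2 ^ n)%N.
Proof.
rewrite /lev; case: n => [|n]; first by rewrite expn0 up_log1 expn0 muln1 ltnW.
have h : (1 < 2 ^ n.+1)%N by rewrite -{1}(expn0 2) ltn_exp2l.
have L0 : (0 < up_log (a q) (2 ^ n.+1))%N by rewrite up_log_gt0 a_ge2.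
by rewrite -(prednK L0) expnS leq_mul2l ltnW ?orbT// up_log_gtn.
Qed.

Definition same_codes n (w w' : Sh) :=
  forall q, digit_code q w (lev q n) = digit_code q w' (lev q n).

Lemma same_codes_dist n w w' : same_codes n w w' ->
  mdist (PI w) (PI w') <= 2 ^- n.
Proof.
move=> h; rewrite (le_trans (torus_dist_le _ _))//.
rewrite [leLHS]/Num.norm /= mx_normrE; apply/bigmax_leP; split => /=.
  by rewrite invr_ge0 exprn_ge0.
move=> [i q] _ /=; rewrite !mxE -!/(coord q _).
have := coord_bounds q w (lev q n); have := coord_bounds q w' (lev q n).
rewrite (h q); set c := (digit_code _ _ _)%:R; set M := _ ^+ _ => b1 b2.
have M0 : 0 < M by rewrite exprn_gt0// ltr0n (leq_trans _ (a_ge2 q)).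
have MM : 2 ^+ n <= M by rewrite /M -!natrX ler_nat lev_ge.
apply: (@le_trans _ _ M^-1); last by rewrite lef_pV2 ?posrE// exprn_gt0.
rewrite -(ler_pM2r M0) mulVf ?gt_eqF// -{1}(gtr0_norm M0) -normrM mulrBl.
move: b1 b2; rewrite -natr1 -/c ler_norml; lra.
Qed.

(** Codes are compared on the circle: two codes that are neither equal nor
    neighbours, also cyclically modulo [a q ^ L], leave a whole interval between
    the coordinates. *)
Lemma far_codes_dist (q : 'I_d) L w w' :
  (2 <= `|digit_code q w L - digit_code q w' L| <= a q ^ L - 2)%N ->
  (a q)%:R ^- L <= mdist (PI w) (PI w') :> R.
Proof.
move=> far; rewrite /mdist /= /torus_dist.
apply: lb_le_inf; first exact: (torus_dists_has_inf _ _).1.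
move=> _ [x [y [/to_torus_eq/forallP/(_ q) xw /to_torus_eq/forallP/(_ q) yw ->]]].
rewrite !mxE -!/(coord q _) in xw yw.
have le1 : `|x ord0 q - y ord0 q| <= `|x - y|.
  rewrite [leRHS]/Num.norm /= mx_normrE; apply/bigmax_geP; right => /=.
  by exists (ord0, q) => //; rewrite !mxE.
apply: le_trans le1.
have [z zE] : exists z : int, x ord0 q - y ord0 q = coord q w - coord q w' + z%:~R.
  have := rpredB xw yw => /intrP[z zE]; exists z; rewrite -zE; ring.
rewrite zE.
have := coord_bounds q w L; have := coord_bounds q w' L.
set c := digit_code q w L in far *; set c' := digit_code q w' L in far *.
set M := (a q)%:R ^+ L => b1 b2.
have M0 : 0 < M by rewrite exprn_gt0// ltr0n (leq_trans _ (a_ge2 q)).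
rewrite -(ler_pM2r M0) mulVf ?gt_eqF// -{1}(gtr0_norm M0) -normrM.
have h : 2 <= `|(c%:Z - c'%:Z + (a q ^ L)%N%:Z * z)%:~R| :> R.
  rewrite -intr_norm -[2]/(2%:~R) ler_int.
  have : (c < a q ^ L)%N by exact: digit_code_lt.
  have : (c' < a q ^ L)%N by exact: digit_code_lt.
  move: far; set m := (a q ^ L)%N => far c'm cm.
  (* Multiples of [m] shift the code by at least its whole range. *)
  have [z0|[z1|z1]] : z = 0 \/ (1 <= z) \/ (z <= -1) by lia.
  - rewrite z0 mulr0 addr0; move: far; clear; lia.
  - have mz : m%:Z <= m%:Z * z by rewrite ler_peMr.
    by move: far cm c'm mz; move: (m%:Z * z) => mz; clear; lia.
  - have mz : m%:Z * z <= - m%:Z by rewrite -[leRHS]mulrN1 ler_wpM2l.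
    by move: far cm c'm mz; move: (m%:Z * z) => mz; clear; lia.
have : (c%:Z - c'%:Z + (a q ^ L)%N%:Z * z)%:~R =
   (coord q w - coord q w' + z%:~R) * M -
   ((coord q w * M - c%:R) - (coord q w' * M - c'%:R)) :> R.
  rewrite intrD intrM intrB /M -!pmulrn natrX; ring.
move=> e; rewrite e in h.
move: b1 b2 h; rewrite -!natr1.
set X := coord q w * M; set Y := coord q w' * M; set Z := (_ + _) * M.
move=> /andP[b1 b2] /andP[b3 b4]; rewrite !ler_normr => /orP[h|h]; apply/orP; [left|right]; lra.
Qed.
(** * Packings and numbers of codes *)

Definition amax := (\max_q a q)%N.

(** A proper colouring of the cycle of length [M] by three colours; the last point
    gets its own colour because [M] may be odd. *)
Definition colour_val (M c : nat) : nat :=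
  if c == M.-1 then 2%N else odd c.

Lemma colour_far M c c' : (c < M)%N -> (c' < M)%N -> c != c' ->
  colour_val M c = colour_val M c' -> (2 <= `|c - c'| <= M - 2)%N.
Proof.
rewrite /colour_val => cM c'M cc'.
case: (c =P M.-1) => h; case: (c' =P M.-1) => h' /= e.
- by move: cc'; rewrite h h' eqxx.
- by move: e; case: (odd c').
- by move: e; case: (odd c).
have ee : odd c = odd c' by move: e; case: (odd c); case: (odd c').
have := odd_double_half c; have := odd_double_half c'; rewrite ee.
move: cc' h h' cM c'M; lia.
Qed.

Definition colour n (w : Sh) : {ffun 'I_d -> 'I_3} :=
  [ffun q => inord (colour_val (a q ^ lev q n) (digit_code q w (lev q n)))].

(** Comparable with [2^-n]; the factor involving [amax] accounts for the length
    of the intervals of level [lev a q n], which may be as small as [2^-n / a q]. *)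
Definition sep_radius n : R := (2 ^+ n * (4 * amax.+1%:R))^-1.

Lemma sep_radius_gt0 n : 0 < sep_radius n.
Proof. by rewrite invr_gt0 !mulr_gt0// exprn_gt0. Qed.

(** Points of the same colour with different codes have, in some coordinate, codes
    that are not neighbours. *)
Lemma same_colour_far n w w' : colour n w = colour n w' -> ~ same_codes n w w' ->
  2 * sep_radius n < mdist (PI w) (PI w').
Proof.
move=> /ffunP col /existsNP[q /eqP qw].
have := col q; rewrite !ffunE => /(congr1 val); rewrite /= !inordK; last 2 first.
- by rewrite /colour_val; case: ifP => // _; case: odd.
- by rewrite /colour_val; case: ifP => // _; case: odd.
move=> cv; have := colour_far (digit_code_lt q w _) (digit_code_lt q w' _) qw cv.
move=> /(far_codes_dist); apply: lt_le_trans.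
have M0 : 0 < (a q)%:R ^+ lev q n :> R.
  by rewrite exprn_gt0// ltr0n (leq_trans _ (a_ge2 q)).
have n0 : 0 < 2 ^+ n :> R by rewrite exprn_gt0.
rewrite /sep_radius ltr_pdivrMr ?mulr_gt0// ltr_pdivlMl//.
apply: (@le_lt_trans _ _ (amax%:R * 2 ^+ n * 2)).
  rewrite ler_pM2r// -!natrX -natrM ler_nat (leq_trans (lev_lt q n))//.
  by rewrite leq_mul2r /amax leq_bigmax orbT.
rewrite [_ * 2 ^+ n]mulrC -mulrA ltr_pM2l// -natr1.
by have : 0 <= amax%:R :> R by []; lra.
Qed.

Lemma mball_disjoint (c c' : torus R d) (r : R) : 2 * r < mdist c c' ->
  mball c r `&` mball c' r = set0.
Proof.
move=> h; apply/seteqP; split=> // x [/= cx c'x].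
have : mdist c c' <= mdist c x + mdist x c' by exact: metric_triangle.
rewrite leNgt => /negP; apply; rewrite (le_lt_trans _ h)//.
by rewrite mulr2n mulrDl mul1r lerD// metric_sym.
Qed.

Lemma packing_size_ge0 s del (G : set (torus R d)) : (0 <= packing_size s del G)%E.
Proof.
apply: ereal_sup_ubound; exists set0, (fun=> to_torus 0), (fun=> 1); split => //.
by rewrite esum_set0.
Qed.

(** One of the [3 ^ d] colour classes has its share of the points, and the balls
    of radius [sep_radius n] around the points of one class are disjoint. *)
Lemma packing_size_ge (I : finType) (P : {pred I}) (x : I -> Sh)
    (G : set (torus R d)) (s del : R) n :
  (forall i, i \in P -> G (PI (x i))) ->
  (forall i j, i \in P -> j \in P -> same_codes n (x i) (x j) -> i = j) ->
  sep_radius n <= del ->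
  ((#|P|%:R / (3 ^ d)%:R * (2 * sep_radius n) `^ s)%:E <= packing_size s del G)%E.
Proof.
move=> PG Pinj rdel.
(* A most frequent colour. *)
pose cl k := [pred i | (i \in P) && (colour n (x i) == k)].
have [k Hk] : exists k, (#|P| <= #|cl k| * 3 ^ d)%N.
  have k0 : {ffun 'I_d -> 'I_3} := [ffun=> ord0].
  exists [arg max_(k > k0) #|cl k|]%N; case: arg_maxnP => // k _ kmax.
  have c3 : #|{ffun 'I_d -> 'I_3}| = (3 ^ d)%N by rewrite card_ffun !card_ord.
  rewrite -c3 mulnC -sum_nat_const.
  rewrite -sum1_card (partition_big (fun i => colour n (x i)) predT)//=.
  by apply: leq_sum => j _; rewrite sum1_card; exact: kmax.
pose r := sep_radius n.
pose e := enum (cl k).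
have nthP (i0 : I) i : (i < size e)%N -> nth i0 e i \in cl k.
  by move=> ie; rewrite -mem_enum mem_nth.
have [P0|/card_gt0P[i0 _]] := posnP #|P|.
  by rewrite P0 mul0r mul0r packing_size_ge0.
apply: (@le_trans _ _ ((size e)%:R * (2 * r) `^ s)%:E).
  rewrite lee_fin ler_wpM2r ?powR_ge0// ler_pdivrMr ?ltr0n ?expn_gt0//.
  by rewrite -natrM ler_nat /e -cardE.
apply: ereal_sup_ubound; exists `I_(size e), (fun i => PI (x (nth i0 e i))), (fun=> r).
split.
- by move=> i /= /(nthP i0); rewrite inE => /andP[/PG].
- by move=> i _; rewrite sep_radius_gt0.
- apply/trivIsetP => i j /= ie je ij; apply: mball_disjoint.
  have := nthP i0 _ ie; have := nthP i0 _ je; rewrite !inE.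
  move=> /andP[Pj /eqP cj] /andP[Pi /eqP ci].
  apply: same_colour_far; first by rewrite ci cj.
  move=> /(Pinj _ _ Pi Pj) /eqP; rewrite nth_uniq ?enum_uniq//.
  exact/negP.
- rewrite esum_fset//; last by move=> i _; rewrite lee_fin powR_ge0.
  rewrite (fsbigE (index_iota 0 (size e))) ?iota_uniq//.
  + rewrite big_mkcond/= (eq_big_nat _ _ (F2 := fun=> ((2 * r) `^ s)%:E)).
      by rewrite sumEFin big_const_nat iter_addr addr0 subn0 mulr_natl.
    by move=> i ie; rewrite mem_set.
  + by move=> i /=; rewrite mem_index_iota.
  + by move=> i /= ie; rewrite mem_index_iota ie.
Qed.

Lemma packing_premeasure_ge0 s (G : set (torus R d)) : (0 <= packing_premeasure s G)%E.
Proof.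
by apply: le_ereal_inf_tmp => _ [del _ <-]; exact: packing_size_ge0.
Qed.
Lemma pow2D (x y : R) : 2 `^ (x + y) = 2 `^ x * 2 `^ y.
Proof. by rewrite powRD// pnatr_eq0 implybT. Qed.

Lemma pow2N n : 2 `^ (- n%:R) = 2 ^- n :> R.
Proof. by rewrite powRN powR_mulrn. Qed.

Lemma pow2_lt1 (x : R) : x < 0 -> 2 `^ x < 1.
Proof.
move=> x0; rewrite /powR pnatr_eq0 -[ltRHS]expR0 ltr_expR.
by rewrite pmulr_llt0// ln_gt0// ltr1n.
Qed.

Lemma dyadic_scale (r : R) N : 0 < r <= 2 ^- N ->
  exists n, [/\ (N <= n)%N, 2 ^- n.+1 < r & r <= 2 ^- n].
Proof.
move=> /andP[r0 rN].
have ex : exists m, 2 ^- m < r.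
  have [m _ Hm] : \forall m \near \oo, r^-1 <= m%:R by exact: nbhs_infty_ger.
  exists m; rewrite -[ltRHS]invrK ltf_pV2 ?posrE ?invr_gt0// ?exprn_gt0//.
  rewrite (le_lt_trans (Hm m (leqnn m)))//= -natrX ltr_nat.
  exact: ltn_expl.
case: (ex_minnP ex) => -[|m] mr mmin.
  have : 2 ^- 0 < 2 ^- N :> R by exact: lt_le_trans rN.
  by rewrite ltf_pV2 ?posrE ?exprn_gt0// expr0 ltNge exprn_ege1// ler1n.
exists m; split=> //.
  rewrite leqNgt; apply/negP => mN.
  have : 2 ^- m.+1 < 2 ^- N :> R by exact: lt_le_trans rN.
  by rewrite ltf_pV2 ?posrE ?exprn_gt0// ltr_eXn2l ?ltr1n// ltnNge mN.
by rewrite leNgt; apply/negP => /mmin; rewrite ltnn.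
Qed.

Lemma geometric_tail (q : R) N M : 0 <= q -> q < 1 ->
  \sum_(N <= n < M) q ^+ n <= q ^+ N / (1 - q).
Proof.
move=> q0 q1; have q1' : 0 < 1 - q by rewrite subr_gt0.
have [MN|NM] := leqP M N.
  by rewrite big_geq// divr_ge0 ?exprn_ge0// ltW.
rewrite ler_pdivlMr//.
suff -> : (\sum_(N <= n < M) q ^+ n) * (1 - q) = q ^+ N - q ^+ M.
  by rewrite gerBl exprn_ge0.
rewrite -(subnKC (ltnW NM)); elim: (M - N)%N => [|m IH].
  by rewrite addn0 big_geq// mul0r subrr.
by rewrite addnS big_nat_recr ?leq_addr//= mulrDl IH exprS; ring.
Qed.

Section counting.
Variables (Y : set Sh) (Tn : nat -> finType) (cd : forall n, Sh -> Tn n).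
Variables (Cn : forall n, {pred Tn n}) (C tau s : R) (n0 : nat).
Hypothesis cd_same : forall n w w', @cd n w = @cd n w' -> same_codes n w w'.
Hypothesis cdY : forall n w, (n0 <= n)%N -> Y w -> @cd n w \in @Cn n.
Hypothesis C0 : 0 < C.
Hypothesis countC : forall n, (n0 <= n)%N -> #|@Cn n|%:R <= C * 2 `^ (n%:R * tau).
Hypothesis s0 : 0 <= s.
Hypothesis taus : tau < s.

Let q := 2 `^ (tau - s).
Let K := C * 2 `^ tau * 2 `^ s.

Let q01 : 0 < q < 1.
Proof.
by rewrite powR_gt0//= pow2_lt1// subr_lt0. Qed.

(** The disjoint balls are sorted by dyadic size.  Two balls with radii larger than
    [2^-(n+1)] have centres with different codes at that scale, so their number is
    bounded by the number of codes, and the sizes add up to a geometric series. *)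
Lemma packing_size_le N : (n0 <= N)%N ->
  (packing_size s (2 ^- N) (PI @` Y) <= (K * (q ^+ N / (1 - q)))%:E)%E.
Proof.
move=> n0N; apply: ge_ereal_sup => _ [I [c [r [cY rN tI ->]]]].
apply: ge_ereal_sup => _ [X [finX XI] <-].
have [e0 Xe0] := (finite_seqP _).1 finX; pose e := undup e0.
have Xe : X = [set` e].
  by rewrite Xe0; apply/seteqP; split=> i /=; rewrite mem_undup.
have eI i : i \in e -> I i by move=> ie; apply: XI; rewrite Xe.
rewrite Xe -fsbig_seq ?undup_uniq//=.
have /choice[wn Hwn] : forall i, exists wn : Sh * nat, I i -> [/\ Y wn.1, PI wn.1 = c i,
    (N <= wn.2)%N, 2 ^- wn.2.+1 < r i & r i <= 2 ^- wn.2].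
  move=> i; have [Ii|nI] := pselect (I i); last by exists (point, 0%N).
  have [w Yw wc] := cY i Ii; have [n [n1 n2 n3]] := dyadic_scale (rN i Ii).
  by exists (w, n).
pose M := (\max_(i <- e) (wn i).2).+1.
rewrite sumEFin lee_fin.
apply: (@le_trans _ _ (\sum_(i <- e) (2 * 2 ^- (wn i).2) `^ s)).
  rewrite big_seq [leRHS]big_seq; apply: ler_sum => i /eI Ii.
  have [_ _ _ _ h] := Hwn i Ii; have /andP[r0 _] := rN i Ii.
  by rewrite ge0_ler_powR// ?nnegrE ?mulr_ge0 ?invr_ge0 ?exprn_ge0 ?(ltW r0)// ler_pM2l.
have -> : \sum_(i <- e) (2 * 2 ^- (wn i).2) `^ s =
    \sum_(N <= n < M) (size [seq i <- e | (wn i).2 == n])%:R * (2 * 2 ^- n) `^ s.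
  transitivity (\sum_(i <- e) \sum_(N <= n < M) (if (wn i).2 == n then (2 * 2 ^- n) `^ s else 0)).
    rewrite big_seq [RHS]big_seq; apply: eq_bigr => i ie.
    have [_ _ h _ _] := Hwn i (eI i ie).
    rewrite (bigD1_seq (wn i).2)/= ?iota_uniq//; last first.
      by rewrite mem_index_iota h /M ltnS; exact: leq_bigmax_seq.
    rewrite eqxx big1 ?addr0// => n ni; rewrite eq_sym (negbTE ni)//.
  rewrite exchange_big/=; apply: eq_bigr => n _.
  rewrite -big_mkcond/= -big_filter big_const_seq count_predT iter_addr addr0.
  by rewrite [RHS]mulr_natl.
apply: (@le_trans _ _ (\sum_(N <= n < M) K * q ^+ n)).
  rewrite big_nat [leRHS]big_nat; apply: ler_sum => n /andP[Nn nM].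
  (* Distinct balls of this size have centres with distinct codes at the next scale. *)
  have cn : (size [seq i <- e | (wn i).2 == n] <= #|@Cn n.+1|)%N.
    rewrite -(size_map (fun i => @cd n.+1 (wn i).1)).
    have cin i : i \in [seq i <- e | (wn i).2 == n] ->
        [/\ I i, Y (wn i).1, PI (wn i).1 = c i & 2 ^- n.+1 < r i].
      rewrite mem_filter => /andP[/eqP <- /eI Ii].
      by have [h1 h2 h3 h4 h5] := Hwn i Ii.
    rewrite cardE; apply: uniq_leq_size.
      rewrite map_inj_in_uniq ?filter_uniq ?undup_uniq// => i j /cin[Ii Yi wi ri] /cin[Ij Yj wj rj].
      move=> /cd_same/(same_codes_dist); rewrite wi wj => dij.
      apply: contrapT => /eqP ij; move/trivIsetP : tI => /(_ _ _ Ii Ij ij).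
      move=> tij.
      suff : (mball (c i) (r i) `&` mball (c j) (r j)) (c j) by rewrite tij.
      split; rewrite /mball /=.
        by rewrite (le_trans dij)// ltW.
      by rewrite mdistxx (le_trans _ (ltW rj))// invr_ge0 exprn_ge0.
    move=> _ /mapP[i /cin[Ii Yi _ _] ->]; rewrite mem_enum; apply: cdY => //.
    by rewrite (leq_trans n0N)// leqW.
  apply: (@le_trans _ _ (C * 2 `^ (n.+1%:R * tau) * (2 * 2 ^- n) `^ s)).
    rewrite ler_wpM2r ?powR_ge0// (le_trans _ (countC _))// ?ler_nat//.
    by rewrite (leq_trans n0N)// leqW.
  rewrite -pow2N -{2}(powRr1 (a := 2))// -pow2D -powRrM /K /q -powR_mulrn ?powR_ge0//.
  rewrite -powRrM -!mulrA -!pow2D le_eqVlt; apply/orP; left; apply/eqP.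
  by congr (_ * (2 `^ _)); rewrite -natr1; ring.
rewrite -mulr_sumr ler_wpM2l ?mulr_ge0 ?powR_ge0 ?(ltW C0)//.
by have /andP[q0 q1] := q01; apply: geometric_tail => //; exact: ltW.
Qed.

Lemma packing_premeasure_eq0 : packing_premeasure s (PI @` Y) = 0%E.
Proof.
have /andP[q0 q1] := q01.
apply/le_anti/andP; split; last exact: packing_premeasure_ge0.
apply/lee_addgt0Pr => eps eps0; rewrite add0e.
have K0 : 0 < K by rewrite !mulr_gt0// powR_gt0.
have q1' : 0 < 1 - q by rewrite subr_gt0.
have [N n0N HN] : exists2 N, (n0 <= N)%N & K * (q ^+ N / (1 - q)) <= eps.
  have := @cvg_expr R q; rewrite gtr0_norm// => /(_ q1)/cvgrPdist_le.
  move=> /(_ (eps * (1 - q) / K)); rewrite divr_gt0 ?mulr_gt0// => /(_ isT)[N _ HN].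
  exists (maxn n0 N); first exact: leq_maxl.
  have := HN (maxn n0 N) (leq_maxr _ _); rewrite /= sub0r normrN ger0_norm ?exprn_ge0 ?(ltW q0)//.
  by rewrite ler_pdivlMr// => h; rewrite mulrA ler_pdivrMr// mulrC.
apply: ereal_inf_le; exists (packing_size s (2 ^- N) (PI @` Y)).
  by exists (2 ^- N) => //=; rewrite invr_gt0 exprn_gt0.
by rewrite (le_trans (packing_size_le n0N))// lee_fin.
Qed.
End counting.
End geometry.

(** * Digit levels and the box dimension *)

Section blocks.
Variables (d : nat).

(** For an index [q], the value [before z f q] is [f] at the preceding index, and
    [z] if [q] is the first one. *)
Definition before (V : Type) (z : V) (f : 'I_d -> V) (i : nat) : V :=
  if i is i'.+1 then oapp f z (insub i') else z.

Lemma before_succ (V : Type) (z : V) f (q : 'I_d) : before z f q.+1 = f q.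
Proof. by rewrite /before valK. Qed.

Variables (q0 : 'I_d) (K : 'I_d -> nat).
Hypothesis K_mono : forall p q : 'I_d, (p <= q)%N -> (K p <= K q)%N.

Lemma before_le (p q : 'I_d) : (p < q)%N -> (K p <= before 0%N K q)%N.
Proof.
case: q => -[|q] qd //= pq; rewrite insubT /=; first exact: ltnW.
by move=> q'd; apply: K_mono.
Qed.

Lemma before_self (q : 'I_d) : (before 0%N K q <= K q)%N.
Proof.
case: q => -[|i] id //; rewrite /before /= insubT /=; first exact: ltnW.
by move=> i'd; apply: K_mono => /=.
Qed.

(** The index [q] of the interval from [K (q - 1)] to [K q] that contains [t]. *)
Definition block (t : nat) : 'I_d :=
  odflt q0 [pick q : 'I_d | (before 0%N K q <= t < K q)%N].

Lemma block_unique (p q : 'I_d) t : (before 0%N K p <= t < K p)%N ->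
  (before 0%N K q <= t < K q)%N -> p = q.
Proof.
move=> /andP[p1 p2] /andP[q1 q2]; apply: val_inj.
case: (ltngtP p q) => // /before_le h.
  by have := leq_trans (leq_trans p2 h) q1; rewrite ltnn.
by have := leq_trans (leq_trans q2 h) p1; rewrite ltnn.
Qed.

Lemma blockE (q : 'I_d) t : (before 0%N K q <= t < K q)%N -> block t = q.
Proof.
move=> h; rewrite /block; case: pickP => [p hp|/(_ q)]; last by rewrite h.
exact: block_unique hp h.
Qed.

Lemma blockP (q' : 'I_d) t : (t < K q')%N ->
  (before 0%N K (block t) <= t < K (block t))%N /\ (block t <= q')%N.
Proof.
move=> tq'; have ex : exists i, (t < before 0%N K i.+1)%N.
  by exists q'; rewrite before_succ.
case: (ex_minnP ex) => i ti imin.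
have id : (i < d)%N.
  by move: ti; rewrite /before; case: insubP => [u ud _ _|//].
pose q := Ordinal id.
have hq : (before 0%N K q <= t < K q)%N.
  have -> : K q = before 0%N K i.+1 by rewrite -(before_succ 0%N K q).
  rewrite ti andbT /=; case: i imin {ti id q} => // i imin.
  by rewrite leqNgt; apply/negP => /imin; rewrite ltnn.
rewrite (blockE hq); split=> //=; apply: imin; by rewrite before_succ.
Qed.

Definition blocks_end := (\max_q K q)%N.

Lemma blocks_endP t : (t < blocks_end)%N -> exists q, (t < K q)%N.
Proof.
move=> h; apply: contrapT => /forallNP nh; move: h; rewrite ltnNge.
by move=> /negP; apply; apply/bigmax_leqP => q _; rewrite leqNgt; apply/negP/nh.
Qed.

Lemma block_eq (q : 'I_d) t : (t < blocks_end)%N ->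
  (block t == q) = (before 0%N K q <= t < K q)%N.
Proof.
move=> /blocks_endP[q' tq']; have [h _] := blockP tq'.
by apply/eqP/idP => [<-//|]; exact: blockE.
Qed.

Lemma big_block (V : Type) (idx : V) (op : Monoid.com_law idx) (F : nat -> V) (q : 'I_d) :
  \big[op/idx]_(t < blocks_end | block t == q) F t =
  \big[op/idx]_(before 0%N K q <= t < K q) F t.
Proof.
have Kq : (K q <= blocks_end)%N by exact: leq_bigmax.
have bq : (before 0%N K q <= K q)%N.
  case: q {Kq} => -[|q] qd //=; rewrite insubT /=; first exact: ltnW.
  by move=> q'd; apply: K_mono => /=.
rewrite (eq_bigl (fun t : 'I_blocks_end => (before 0%N K q <= t < K q)%N)); last first.
  by move=> t; rewrite block_eq.
rewrite -(big_mkord (fun t => before 0%N K q <= t < K q)%N F).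
rewrite big_mkcond (@big_cat_nat _ _ _ (K q))//= [X in op _ X]big_nat.
rewrite [X in op _ X]big1 ?Monoid.mulm1; last first.
  by move=> t /andP[h _]; case: ifP => //; lia.
rewrite (@big_cat_nat _ _ _ (before 0%N K q))//= [X in op X _]big_nat.
rewrite [X in op X _]big1 ?Monoid.mul1m; last first.
  by move=> t h; case: ifP => //; lia.
by rewrite big_nat [RHS]big_nat; apply: eq_bigr => t ->.
Qed.

Lemma card_block (q : 'I_d) :
  #|[pred t : 'I_blocks_end | block t == q]| = (K q - before 0%N K q)%N.
Proof.
rewrite -sum1_card (big_block _ (fun=> 1%N)).
by rewrite sum_nat_const_nat muln1.
Qed.

Lemma prod_block (R : comRingType) (g : 'I_d -> R) :
  \prod_(t < blocks_end) g (block t) = \prod_q g q ^+ (K q - before 0%N K q).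
Proof.
rewrite (partition_big (fun t : 'I_blocks_end => block t) predT)//=.
apply: eq_bigr => q _; rewrite -card_block -prodr_const.
by apply: eq_bigr => t /eqP ->.
Qed.
End blocks.

Section box_dimension.
Variables (R : realType) (d : nat) (a : 'I_d -> nat).
Hypothesis a_ge2 : forall q, (2 <= a q)%N.
Hypothesis a_decr : forall p q : 'I_d, (p < q)%N -> (a q < a p)%N.

(** The reciprocal of the base 2 logarithm of [a q]. *)
Definition lam (q : 'I_d) : R := ln 2 / ln (a q)%:R.
Definition dlam (q : 'I_d) : R := lam q - before 0 lam q.

Let ln2 : 0 < ln 2 :> R. Proof. by rewrite ln_gt0// ltr1n. Qed.
Let lna q : 0 < ln (a q)%:R :> R. Proof. by rewrite ln_gt0// ltr1n a_ge2. Qed.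

Lemma lam_gt0 q : 0 < lam q. Proof. by rewrite divr_gt0. Qed.

Lemma dlam_gt0 q : 0 < dlam q.
Proof.
rewrite /dlam subr_gt0; case: q => -[|q] qd; first exact: lam_gt0.
rewrite /before /= insubT /=; first exact: ltnW.
move=> q'd; rewrite /lam ltr_pM2l// ltf_pV2 ?posrE//.
by rewrite ltr_ln ?posrE ?ltr0n ?ltr_nat ?a_decr// (leq_trans _ (a_ge2 _)).
Qed.

Lemma lev_mono n (p q : 'I_d) : (p <= q)%N -> (lev a p n <= lev a q n)%N.
Proof.
rewrite leq_eqVlt => /orP[/eqP/val_inj->//|pq].
apply: up_log_min; first exact: a_ge2.
apply: leq_trans (lev_ge a_ge2 q n) _.
elim: (lev a q n) => // e IH; rewrite !expnS leq_mul//.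
by apply: ltnW; exact: a_decr.
Qed.

Lemma lev_lower n q : n%:R * lam q <= (lev a q n)%:R.
Proof.
rewrite /lam mulrA ler_pdivrMr// mulr_natl mulr_natl -!lnXn ?ltr0n//.
  rewrite ler_ln ?posrE ?exprn_gt0 ?ltr0n// ?(leq_trans _ (a_ge2 _))//.
  by rewrite -!natrX ler_nat lev_ge.
by rewrite (leq_trans _ (a_ge2 _)).
Qed.

Lemma lev_upper n q : (lev a q n)%:R <= n%:R * lam q + 1.
Proof.
have a0 : (0 : R) < (a q)%:R by rewrite ltr0n (leq_trans _ (a_ge2 _)).
rewrite -(ler_pM2r (lna q)) mulrDl mul1r /lam mulrA divfK ?gt_eqF//.
rewrite mulr_natl mulr_natl -!lnXn// addrC -lnM ?posrE ?exprn_gt0//.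
rewrite ler_ln ?posrE ?mulr_gt0 ?exprn_gt0//.
by rewrite -!natrX -natrM ler_nat lev_lt.
Qed.

(** Consecutive levels [lev a q n] differ by [n * dlam q] up to 1, and [k * K q] is
    within [c] and [c'] of [lev a q n]. *)
Lemma level_gap n k c c' (K : 'I_d -> nat) :
  (forall p q : 'I_d, (p <= q)%N -> (K p <= K q)%N) ->
  (forall q, k * K q <= lev a q n + c)%N -> (forall q, lev a q n <= k * K q + c')%N ->
  forall q, `|(k * (K q - before 0%N K q))%N%:R - n%:R * dlam q| <=
    1 + c%:R + c'%:R.
Proof.
move=> K_mono Kle leK q; rewrite mulnBr natrB ?leq_mul2l ?before_self ?orbT//.
have bnd p : n%:R * lam p - c'%:R <= (k * K p)%N%:R <= n%:R * lam p + 1 + c%:R.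
  have h1 := lev_lower n p; have h2 := lev_upper n p.
  have := Kle p; have := leK p; rewrite -!(ler_nat R) !natrD => h3 h4.
  by apply/andP; split; lra.
have := bnd q; rewrite /dlam mulrBr ler_norml => /andP[b1 b2].
have c0 : 0 <= c%:R :> R by []; have c'0 : 0 <= c'%:R :> R by [].
case: q b1 b2 => -[|i] id b1 b2.
  by rewrite /= muln0 mulr0; apply/andP; split; move: b1 b2; lra.
rewrite /before /= insubT /=; first exact: ltnW.
move=> i'd; have /andP[b3 b4] := bnd (Ordinal i'd).
by apply/andP; split; move: b1 b2 b3 b4; lra.
Qed.

Definition log2 (x : R) := ln x / ln 2.

Lemma log2K x : 0 < x -> 2 `^ log2 x = x.
Proof.
by move=> x0; rewrite /powR pnatr_eq0 /log2 divfK ?gt_eqF// lnK.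
Qed.

Lemma log2_ge0 x : 1 <= x -> 0 <= log2 x.
Proof. by move=> x1; apply: divr_ge0; [exact: ln_ge0|exact: ltW]. Qed.

Lemma exprn_le_pow2 (x y : R) m : 1 <= x -> m%:R <= y -> x ^+ m <= 2 `^ (y * log2 x).
Proof.
move=> x1 my; have x0 : 0 < x by exact: lt_le_trans x1.
rewrite -[x in x ^+ m]log2K// -powR_mulrn ?powR_ge0// -powRrM mulrC.
by rewrite ler_powR ?ler1n// ler_wpM2r// log2_ge0.
Qed.

Lemma exprn_ge_pow2 (x y : R) m : 1 <= x -> y <= m%:R -> 2 `^ (y * log2 x) <= x ^+ m.
Proof.
move=> x1 my; have x0 : 0 < x by exact: lt_le_trans x1.
rewrite -[x in x ^+ m]log2K// -powR_mulrn ?powR_ge0// -powRrM.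
by rewrite ler_powR ?ler1n// [leRHS]mulrC ler_wpM2r// log2_ge0.
Qed.

Lemma exprn_le_pow2_lt1 (x y : R) m : 0 < x -> x <= 1 -> y <= m%:R ->
  x ^+ m <= 2 `^ (y * log2 x).
Proof.
move=> x0 x1 my.
rewrite -[x in x ^+ m]log2K// -powR_mulrn ?powR_ge0// -powRrM mulrC.
rewrite ler_powR ?ler1n// ler_wnM2r// /log2 mulr_le0_ge0 ?ln_le0//.
by rewrite invr_ge0 ltW.
Qed.

Lemma pow2_sum (I : finType) (F : I -> R) : 2 `^ (\sum_i F i) = \prod_i 2 `^ F i.
Proof.
by apply: (big_morph (fun x : R => 2 `^ x)) => [x y|]; rewrite ?pow2D ?powRr0.
Qed.

Variable N : 'I_d -> nat.
(** The box dimension of the sponge when [N q] is the number of letters of the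
    [q]-th factor. *)
Definition box_dim : R := \sum_q dlam q * log2 (N q)%:R.
End box_dimension.

(** * Representatives of the classes of a factor *)

Section projections.
Variables (d : nat) (a : 'I_d -> nat) (D : {set digit a}) (D0 : D != finset.set0).
Local Notation A := (alphabet D0).

(** Encodes the projection [eta j] by an idempotent map of the alphabet itself, so
    that all the factors are handled inside one shift. *)
Definition proj_rep (j : 'I_d) (x : A) : A :=
  odflt x [pick y : A | Defs.eta j (val y) == Defs.eta j (val x)].

Lemma eta_proj_rep j x : Defs.eta j (val (proj_rep j x)) = Defs.eta j (val x).
Proof. by rewrite /proj_rep; case: pickP => [y /eqP|_]. Qed.

Lemma proj_rep_eq j x y : Defs.eta j (val x) = Defs.eta j (val y) -> proj_rep j x = proj_rep j y.
Proof.
rewrite /proj_rep => ->; case: pickP => // h.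
by have := h y; rewrite eqxx.
Qed.

Lemma proj_repK j x : proj_rep j (proj_rep j x) = proj_rep j x.
Proof. by apply: proj_rep_eq; exact: eta_proj_rep. Qed.

Lemma proj_rep_eta j x y : proj_rep j x = proj_rep j y -> Defs.eta j (val x) = Defs.eta j (val y).
Proof. by move=> h; rewrite -(eta_proj_rep j x) h eta_proj_rep. Qed.

Lemma eta_coord (j q : 'I_d) (x y : digit a) : (j <= q)%N -> Defs.eta j x = Defs.eta j y -> x q = y q.
Proof. by move=> jq /ffunP /(_ (exist _ q jq)); rewrite !ffunE. Qed.

Lemma eta_ext (j : 'I_d) (x y : digit a) :
  (forall q : 'I_d, (j <= q)%N -> x q = y q) -> Defs.eta j x = Defs.eta j y.
Proof. by move=> h; apply/ffunP => q; rewrite !ffunE h// (valP q). Qed.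

Lemma proj_rep_coord (j q : 'I_d) (x y : A) : (j <= q)%N ->
  proj_rep j x = proj_rep j y -> val x q = val y q.
Proof. by move=> jq /proj_rep_eta; exact: eta_coord. Qed.

Definition proj_card (j : 'I_d) : nat := #|[pred x | proj_rep j x == x]|.

Lemma proj_card_gt0 j : (0 < proj_card j)%N.
Proof. by apply: fixed_gt0; exact: proj_repK. Qed.
End projections.

(** * Upper bounds for the packing dimension *)

Section packing_dim_upper.
Variables (R : realType) (T : metricType R).

Lemma packing_measure_eq0 s (F : set T) (G : nat -> set T) :
  (forall H : set T, 0 <= packing_premeasure s H)%E ->
  F `<=` \bigcup_i G i -> (forall i, packing_premeasure s (G i) = 0%E) ->
  packing_measure s F = 0%E.
Proof.
move=> p0 FG G0; apply/le_anti/andP; split.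
  apply: ereal_inf_lbound; exists G => //.
  by rewrite eseries0.
apply: le_ereal_inf_tmp => _ [H _ <-]; exact: nneseries_ge0.
Qed.

Lemma packing_dim_le s (F : set T) : 0 <= s -> packing_measure s F = 0%E ->
  (packing_dim F <= s%:E)%E.
Proof. by move=> s0 F0; apply: ereal_inf_lbound; exists s. Qed.
End packing_dim_upper.

Section upper_bound.
Variables (R : realType) (d : nat) (a : 'I_d -> nat).
Hypothesis a_ge2 : forall q, (2 <= a q)%N.
Hypothesis a_decr : forall p q : 'I_d, (p < q)%N -> (a q < a p)%N.
Variables (D : {set digit a}) (D0 : D != finset.set0).
Local Notation A := (alphabet D0).
Local Notation Sh := (fullshift A).
Local Notation sigma := (@left_shift A).
Local Notation PI := (@Pi R d a D D0).
Local Notation N := (@proj_card d a D D0).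
Local Notation tbox := (@box_dim R d a N).

Lemma digit_code_ext q (w w' : Sh) L :
  (forall n, (n < L)%N -> dig q w n = dig q w' n) ->
  digit_code q w L = digit_code q w' L.
Proof.
elim: L => //= L IH h; rewrite IH ?h// => n nL; apply: h.
exact: leq_trans nL _.
Qed.

Section scales.
Variables (j0 : 'I_d) (k : nat) (k_gt0 : (0 < k)%N).

(** The number of blocks of length [k] needed to reach beyond the level of the
    [q]-th coordinate. *)
Definition thr n (q : 'I_d) : nat := (lev a q n %/ k).+1.

Lemma thr_mono n (p q : 'I_d) : (p <= q)%N -> (thr n p <= thr n q)%N.
Proof. by move=> pq; rewrite ltnS leq_div2r// lev_mono. Qed.

Lemma thr_gap n (q : 'I_d) :
  `|(k * (thr n q - before 0%N (thr n) q))%N%:R - n%:R * dlam R a q| <= 1 + k%:R :> R.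
Proof.
have -> : 1 + k%:R = 1 + k%:R + 0%N%:R :> R by rewrite addr0.
apply: level_gap => // [p p'|p|p]; first exact: thr_mono.
  by rewrite /thr mulnS addnC leq_add2r mulnC leq_trunc_div.
by rewrite addn0 mulnC ltnW// ltn_ceil.
Qed.

Lemma thr_gap_lower n (q : 'I_d) : n%:R * (dlam R a q / k%:R) - 2 <=
  (thr n q - before 0%N (thr n) q)%N%:R :> R.
Proof.
have k0 : 0 < k%:R :> R by rewrite ltr0n.
have k1 : 1 <= k%:R :> R by rewrite ler1n.
rewrite -(ler_pM2r k0) mulrBl -mulrA divfK ?gt_eqF// -natrM mulnC.
by have := thr_gap n q; rewrite ler_norml => /andP[]; move: k1; lra.
Qed.

(** The letters of the block of index [t] are projected to the coarsest factor
    that keeps the coordinates seen there at scale [2^-n]. *)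
Definition block_code n (w : Sh) : {ffun 'I_(blocks_end (thr n)) -> {ffun 'I_k -> A}} :=
  [ffun t : 'I_(blocks_end (thr n)) => [ffun i : 'I_k =>
    proj_rep (block j0 (thr n) t) (w (t * k + i)%N)]].

(** The [q]-th digit is needed only before the level of [q], where the projection
    still keeps the coordinate [q]. *)
Lemma block_code_same n w w' : block_code n w = block_code n w' -> same_codes n w w'.
Proof.
move=> h q; apply: digit_code_ext => nu nuq.
have tq : (nu %/ k < thr n q)%N by rewrite /thr ltnS leq_div2r// ltnW.
have tM : (nu %/ k < blocks_end (thr n))%N by rewrite (leq_trans tq)// leq_bigmax.
have ik : (nu %% k < k)%N by rewrite ltn_mod.
move/ffunP : h => /(_ (Ordinal tM)); rewrite !ffunE => /ffunP/(_ (Ordinal ik)).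
rewrite !ffunE /= -divn_eq => h.
have [_ bq] := blockP j0 (thr_mono n) tq.
by rewrite /dig (proj_rep_coord bq h).
Qed.

Section chernoff.
Variables (f : {ffun 'I_k -> A} -> R) (th rho : R).
Hypothesis th_gt0 : 0 < th.
Hypothesis rho01 : 0 < rho <= 1.
Hypothesis f_rho : \sum_(v in @fixed_words _ _ D0 (proj_rep j0) k) expR (th * f v) <=
  rho * #|@fixed_words _ _ D0 (proj_rep j0) k|%:R.
Variables (Y : set Sh) (n0 : nat).
Hypothesis Y_f : forall n w, (n0 <= n)%N -> Y w ->
  0 <= \sum_(before 0%N (thr n) j0 <= t < thr n j0)
    f [ffun i : 'I_k => proj_rep j0 (w (t * k + i)%N)].

Let fam n : {pred {ffun 'I_(blocks_end (thr n)) -> {ffun 'I_k -> A}}} :=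
  family (fun t : 'I_(blocks_end (thr n)) =>
     @fixed_words _ _ D0 (proj_rep (block j0 (thr n) t)) k).

Let Cn n : {pred {ffun 'I_(blocks_end (thr n)) -> {ffun 'I_k -> A}}} :=
  [pred c | (c \in @fam n) &&
  (0 <= \sum_(t < blocks_end (thr n) | block j0 (thr n) t == j0) f (c t))].

Let tau := tbox + dlam R a j0 / k%:R * log2 rho.
Let C := \prod_q 2 `^ ((1 + k%:R) * log2 (N q)%:R) * 2 `^ (- 2 * log2 rho).

Let Cn_code n w : (n0 <= n)%N -> Y w -> block_code n w \in @Cn n.
Proof.
move=> n0n Yw; rewrite inE; apply/andP; split.
  apply/familyP => t; apply/ffun_onP => i.
  by rewrite !ffunE inE proj_repK.
apply: le_trans (Y_f n0n Yw) _.
rewrite -(big_block j0 (thr_mono n) _ (fun t => f [ffun i : 'I_k => proj_rep j0 (w (t * k + i)%N)])).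
rewrite le_eqVlt; apply/orP; left; apply/eqP; apply: eq_bigr => t /eqP tj.
by congr f; rewrite !ffunE tj.
Qed.

Let N1 q : 1 <= (N q)%:R :> R.
Proof. by rewrite ler1n proj_card_gt0. Qed.

Let card_Cn n : #|@Cn n|%:R <= C * 2 `^ (n%:R * tau).
Proof.
have /andP[rho0 rho1] := rho01.
have := @chernoff_count R _ _ (fun t : 'I_(blocks_end (thr n)) =>
     @fixed_words _ _ D0 (proj_rep (block j0 (thr n) t)) k)
   [pred t : 'I_(blocks_end (thr n)) | block j0 (thr n) t == j0] (@fixed_words _ _ D0 (proj_rep j0) k) f th rho
   th_gt0 (ltW rho0).
move=> H; have {H} h := H _ f_rho.
apply: le_trans (h _) _ => [t /eqP->//|].
rewrite (card_block j0 (thr_mono n)).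
under eq_bigr do rewrite card_fixed_words natrX.
rewrite (prod_block j0 (thr_mono n) (fun q => (N q)%:R ^+ k)).
have -> : C * 2 `^ (n%:R * tau) =
    \prod_q 2 `^ ((n%:R * dlam R a q + (1 + k%:R)) * log2 (N q)%:R) *
    2 `^ ((n%:R * (dlam R a j0 / k%:R) - 2) * log2 rho).
  rewrite /C /tau mulrDr pow2D /box_dim mulr_sumr pow2_sum.
  rewrite mulrACA -big_split/= -pow2D; congr (_ * _).
    by apply: eq_bigr => q _; rewrite -pow2D; congr (_ `^ _); ring.
  by congr (_ `^ _); ring.
rewrite ler_pM ?exprn_ge0 ?prodr_ge0 ?(ltW rho0)//.
  apply: ler_prod => q _; rewrite exprn_ge0 ?exprn_ge0//= -exprM.
  apply: exprn_le_pow2 => //; have := thr_gap n q.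
  by rewrite ler_norml => /andP[_]; rewrite lerBlDl.
by apply: exprn_le_pow2_lt1 => //; exact: thr_gap_lower.
Qed.

(** The positions between the levels of [j0 - 1] and [j0] contain about
    [n * dlam j0 / k] blocks of words of the [j0]-th factor; by [chernoff_count]
    the constraint [Y_f] multiplies the number of codes by that power of [rho],
    and the exponent of the count drops from [tbox] to [tau]. *)
Lemma upper_premeasure_eq0 s : 0 <= s -> tau < s -> packing_premeasure s (PI @` Y) = 0%E.
Proof.
move=> s0 taus.
apply: (@packing_premeasure_eq0 R d a a_ge2 D D0 Y _ block_code (fun n => @Cn n) C tau s n0) => //.
- exact: block_code_same.
- by rewrite mulr_gt0 ?prodr_gt0 ?powR_gt0// => q _; exact: powR_gt0.
Qed.
End chernoff.
End scales.

(** The count of codes without constraint: blocks of length 1, [f = 0], [rho = 1]. *)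
Lemma sponge_dim_le (j0 : 'I_d) : (packing_dim (@sponge R d a D D0) <= tbox%:E)%E.
Proof.
have tb0 : 0 <= tbox.
  rewrite sumr_ge0// => q _; rewrite mulr_ge0 ?(ltW (dlam_gt0 _ _ _ _))// log2_ge0//.
  by rewrite ler1n proj_card_gt0.
apply/lee_addgt0Pr => eps eps0; apply: packing_dim_le.
  by rewrite addr_ge0// ltW.
apply: (@packing_measure_eq0 _ _ _ _ (fun=> @sponge R d a D D0)).
- by move=> H; exact: packing_premeasure_ge0.
- by move=> x sx; exists 0%N.
move=> _; have -> : @sponge R d a D D0 = PI @` setT by [].
apply: (@upper_premeasure_eq0 j0 1 isT (fun=> 0) 1 1 ltr01 _ _ _ 0).
- by rewrite ltr01 lexx.
- rewrite (eq_bigr (fun=> 1)) ?sumr_const ?mul1r// => v _.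
  by rewrite ?mulr0 expR0.
- by move=> n w _ _; rewrite big1.
- by rewrite addr_ge0// ltW.
- by rewrite /log2 ln1 mul0r mulr0 addr0 ltrDl.
Qed.

Section level.
Variables (phi : Sh -> R) (alpha B : R) (j0 : 'I_d).
Hypothesis phi_bnd : forall w, `|phi w| <= B.
Local Notation e := (@proj_rep d a D D0 j0).

Lemma bsum_range w k b K : (b <= K)%N ->
  \sum_(b <= t < K) bsum phi k (iter (t * k) sigma w) =
  bsum phi (K * k) w - bsum phi (b * k) w.
Proof.
move=> bK; rewrite !bsum_blocks -!(big_mkord xpredT (fun t => bsum phi k (iter (t * k) sigma w))).
by rewrite [X in _ = X - _](@big_cat_nat _ _ _ b)//= addrAC subrr add0r.
Qed.

Let slow (eps M : R) : set Sh :=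
  [set w | forall n, `|bsum phi n w - n%:R * alpha| <= eps * n%:R + M].

(** Convergence of the averages holds from some rank on, and the earlier sums are
    bounded; so a countable union over [M] covers the level set. *)
Lemma slow_cover eps : 0 < eps ->
  [set w | (fun n => birkhoff_average phi n w) @ \oo --> alpha] `<=`
  \bigcup_M slow eps M%:R.
Proof.
move=> eps0 w /cvgrPdist_le /(_ _ eps0)[n0 _ Hn0].
have al n : `|bsum phi n w - n%:R * alpha| <= n%:R * (B + `|alpha|).
  rewrite (le_trans (ler_normB _ _))// mulrDr lerD//; first exact: bsum_bound.
  by rewrite normrM ger0_norm.
have Bal : 0 <= B + `|alpha| by rewrite addr_ge0//; apply: le_trans (phi_bnd point).
have [M _ HM] : \forall M \near \oo, n0%:R * (B + `|alpha|) <= M%:R.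
  exact: nbhs_infty_ger.
exists M => // n; have [n0n|nn0] := leqP n0 n.
  have := Hn0 n n0n; rewrite /birkhoff_average -/(bsum phi n w) => h.
  case: n n0n h => [|n] n0n h.
    by rewrite /bsum big_ord0 !mul0r subrr normr0 mulr0 add0r.
  have n1 : 0 < n.+1%:R :> R by [].
  rewrite -(ler_pM2l n1) -{1}(gtr0_norm n1) -normrM mulrBr mulVKf ?gt_eqF// in h.
  by rewrite distrC (le_trans h)// mulrC lerDl.
rewrite (le_trans (al n))// (le_trans (_ : _ <= M%:R))//; last first.
  by rewrite lerDr mulr_ge0// ltW.
apply: le_trans (HM M (leqnn M)); rewrite ler_wpM2r// ler_nat ltnW//.
Qed.

(** If the mean of [lift_sup] is less than [k * alpha] for some [k], it is still
    less than [k * (alpha - e')].  A point whose Birkhoff averages tend to [alpha]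
    has, on the long range between the levels of [j0 - 1] and [j0], sums that are
    larger than this mean allows, which [upper_premeasure_eq0] shows to be rare. *)
Lemma level_set_dim_lt : 0 < tbox -> ~ upper_mean e phi alpha ->
  (packing_dim (@level_set R d a D D0 phi alpha) < tbox%:E)%E.
Proof.
move=> tb0 /existsNP[k /negP]; rewrite -ltNge => gap.
have N0 : 0 < (N j0)%:R :> R by rewrite ltr0n proj_card_gt0.
have k_gt0 : (0 < k)%N.
  case: k gap => // gap; exfalso; move: gap; apply/negP; rewrite -leNgt mul0r mulr0.
  apply: sumr_ge0 => c _; apply: le_trans (bsum_le_lift (w := ext c) phi_bnd _).
    by rewrite /bsum big_ord0.
  by case.
have kR : 0 < k%:R :> R by rewrite ltr0n.
pose Nk : R := (N j0)%:R ^+ k; have Nk0 : 0 < Nk by rewrite exprn_gt0.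
set Sg := \sum_(c in _) _ in gap.
(* Half of the gap in the failing condition, per letter. *)
pose e' := (Nk * (k%:R * alpha) - Sg) / (2 * (Nk * k%:R)).
have e'0 : 0 < e' by rewrite divr_gt0 ?subr_gt0// !mulr_gt0.
pose f (c : {ffun 'I_k -> A}) := lift_sup e phi c - k%:R * (alpha - e').
have fneg : \sum_(c in @fixed_words _ _ D0 e k) f c < 0.
  rewrite /f sumrB -/Sg sumr_const card_fixed_words -[_ *+ (_ ^ _)]mulr_natl natrX -/Nk.
  have -> : Nk * (k%:R * (alpha - e')) = (Nk * (k%:R * alpha) + Sg) / 2.
    rewrite /e'; field; by rewrite !gt_eqF.
  by move: gap; rewrite -/Nk; lra.
have [th [rho [th0 /andP[rho0 rho1] frho]]] := chernoff_weight fneg.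
have dl0 := dlam_gt0 R a_ge2 a_decr j0; have l0 := lam_gt0 R a_ge2 j0.
set dl := dlam R a j0 in dl0; set l := lam R a j0 in l0.
pose eps := e' * dl / (4 * l).
have eps0 : 0 < eps.
  apply: divr_gt0; apply: mulr_gt0 => //.
pose tau := tbox + dl / k%:R * log2 rho.
have taut : tau < tbox.
  by rewrite gtrDl pmulr_rlt0 ?divr_gt0// /log2 pmulr_llt0 ?invr_gt0 ?ln_gt0 ?ltr1n// ln_lt0// rho0.
pose s := Num.max 0 ((tau + tbox) / 2).
have s0 : 0 <= s by rewrite le_max lexx.
have taus : tau < s by rewrite lt_max; apply/orP; right; lra.
have stb : s < tbox by rewrite gt_max tb0/=; lra.
apply: (@le_lt_trans _ _ s%:E); last by rewrite lte_fin.
apply: packing_dim_le => //.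
apply: (@packing_measure_eq0 _ _ _ _ (fun M => PI @` slow eps M%:R)).
- by move=> H; exact: packing_premeasure_ge0.
- by move=> _ [w /(slow_cover eps0)[M _ wM] <-]; exists M => //; exists w.
move=> M.
have [n0 _ Hn0] : \forall n \near \oo,
    (2 * k%:R * e' + 2 * eps * (1 + k%:R) + 2 * M%:R) / (dl * e' / 2) <= n%:R :> R.
  exact: nbhs_infty_ger.
apply: (@upper_premeasure_eq0 j0 k k_gt0 f th rho th0 _ frho _ n0) => //.
  by rewrite rho0 ltW.
move=> n w n0n wM; set b := before _ _ _; set K := thr _ _ _.
have bK : (b <= K)%N by apply: before_self; exact: thr_mono.
apply: (@le_trans _ _ (\sum_(b <= t < K)
    (bsum phi k (iter (t * k) sigma w) - k%:R * (alpha - e')))); last first.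
  apply: ler_sum => t _; rewrite /f lerD2r; apply: bsum_le_lift => // i.
  by rewrite ffunE iter_shift proj_repK.
rewrite sumrB bsum_range// sumr_const_nat.
have hK := wM (K * k)%N; have hb := wM (b * k)%N.
have gl := @thr_gap_lower k k_gt0 n j0.
have Kup : (K * k)%:R <= n%:R * l + 1 + k%:R.
  have h1 := lev_upper R a_ge2 n j0; rewrite -/l in h1.
  suff : (K * k <= lev a j0 n + k)%N by rewrite -(ler_nat R) natrD; lra.
  by rewrite /K /thr mulSn addnC leq_add2r leq_trunc_div.
have dle : 0 < dl * e' / 2 by apply: divr_gt0 => //; exact: mulr_gt0.
have := Hn0 n n0n; rewrite /= (ler_pdivrMr _ _ dle) => hn.
rewrite -/b -/K -/dl in gl.
have gl2 : n%:R * dl - 2 * k%:R <= (K * k)%:R - (b * k)%:R.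
  rewrite -natrB ?leq_mul2r ?bK ?orbT// -mulnBl natrM.
  have := ler_wpM2r (ltW kR) gl; rewrite mulrBl; congr (_ <= _).
  by congr (_ - _); rewrite mulrA divfK ?gt_eqF.
have bKR : (b * k)%:R <= (K * k)%:R :> R by rewrite ler_nat leq_mul2r bK orbT.
have -> : (k%:R * (alpha - e')) *+ (K - b) = ((K * k)%:R - (b * k)%:R) * (alpha - e').
  by rewrite -mulr_natl -natrB ?leq_mul2r ?bK ?orbT// -mulnBl natrM mulrA.
have epsl : eps * (n%:R * l) = n%:R * dl * e' / 4.
  by rewrite /eps; field; rewrite gt_eqF.
move: hK hb gl2 Kup bKR hn; set X := (K * k)%:R; set Z := (b * k)%:R.
rewrite !ler_norml => /andP[h1 _] /andP[_ h2] h3 h4 h5 h6.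
have p1 := ler_wpM2l (ltW e'0) h3.
have p2 := ler_wpM2l (ltW eps0) h4.
have p3 := ler_wpM2l (ltW eps0) h5.
move: h1 h2 p1 p2 p3 h6 epsl; set W := bsum _ _ _; set W' := bsum _ _ _.
clearbody eps e'; clear; nra.
Qed.
End level.
End upper_bound.

(** * Lower bound for the packing dimension of a level set *)

Section lower_step.
Variables (R : realType) (d : nat) (a : 'I_d -> nat).
Hypothesis a_ge2 : forall q, (2 <= a q)%N.
Hypothesis a_decr : forall p q : 'I_d, (p < q)%N -> (a q < a p)%N.
Variables (D : {set digit a}) (D0 : D != finset.set0).
Local Notation A := (alphabet D0).
Local Notation Sh := (fullshift A).
Local Notation sigma := (@left_shift A).
Local Notation PI := (@Pi R d a D D0).
Local Notation N := (@proj_card d a D D0).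
Local Notation tbox := (@box_dim R d a N).
Local Notation e := (@proj_rep d a D D0).
Variables (j0 : 'I_d) (phi : Sh -> R) (alpha B : R).
Hypothesis phi_cont : continuous phi.
Hypothesis phi_bnd : forall w, `|phi w| <= B.
Hypothesis up : forall j, upper_mean (e j) phi alpha.
Hypothesis dn : forall j, upper_mean (e j) (fun w => - phi w) (- alpha).

(** The words that the construction may use where the factor [j] is visible: the
    first condition keeps the limit point in the level set, and the other two
    yield many points with different codes. *)
Definition good_family (h eps : R) l (V : 'I_d -> {pred {ffun 'I_l -> A}}) :=
  [/\ forall j w, head_word l w \in V j ->
        `|bsum phi l w - l%:R * alpha| <= eps * l%:R,
      forall j (u v : {ffun 'I_l -> A}), u \in V j -> v \in V j ->
        (forall i, e j (u i) = e j (v i)) -> u = v &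
      forall j, (N j)%:R ^+ l * 2 `^ (- (h * l%:R)) <= #|V j|%:R].

Lemma good_family_exists h eps : 0 < h -> 0 < eps ->
  exists l (V : 'I_d -> {pred {ffun 'I_l -> A}}), (0 < l)%N /\ good_family h eps V.
Proof.
move=> h0 eps0; have e40 : 0 < eps / 4 by rewrite divr_gt0.
have [k [k0 k1 osc]] := bsum_osc phi_bnd phi_cont e40.
have /choice[K0 HK0] : forall j, exists K0, forall K, (K0 <= K)%N ->
  exists V : {pred {ffun 'I_(K * k) -> A}}, [/\
    forall w, head_word (K * k) w \in V ->
      `|bsum phi (K * k) w - (K * k)%:R * alpha| <= 4 * (eps / 4) * (K * k)%:R,
    forall u v, u \in V -> v \in V -> (forall i, e j (u i) = e j (v i)) -> u = v &
    (N j ^ (K * k) <= 2 * #|V|)%N].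
  move=> j; exact: (good_words (@proj_repK _ _ _ D0 j) phi_bnd (up j) (dn j) e40 k0 k1 osc).
have [K1 _ HK1] : \forall K \near \oo, h^-1 <= K%:R by exact: nbhs_infty_ger.
pose K := (maxn (\max_j K0 j) K1).+1.
have /choice[V HV] : forall j, exists V : {pred {ffun 'I_(K * k) -> A}}, [/\
    forall w, head_word (K * k) w \in V ->
      `|bsum phi (K * k) w - (K * k)%:R * alpha| <= 4 * (eps / 4) * (K * k)%:R,
    forall u v, u \in V -> v \in V -> (forall i, e j (u i) = e j (v i)) -> u = v &
    (N j ^ (K * k) <= 2 * #|V|)%N].
  move=> j; apply: HK0; rewrite (leq_trans _ (leqnSn _))//.
  by rewrite (leq_trans _ (leq_maxl _ _))// leq_bigmax.
exists (K * k)%N, V; split; first by rewrite muln_gt0.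
split.
- move=> j w; have [h1 _ _] := HV j => /h1.
  by rewrite mulrCA mulfV ?mulr1 ?pnatr_eq0.
- by move=> j; have [_ h2 _] := HV j.
- move=> j; have [_ _ h3] := HV j.
  have hK : 1 <= h * (K * k)%:R.
    rewrite -ler_pdivrMl// mulr1 (le_trans (HK1 K _)) ?ler_nat ?leq_pmulr//=.
    by rewrite (leq_trans (leq_maxr _ _) (leqnSn _)).
  rewrite powRN ler_pdivrMr ?powR_gt0// -natrX.
  apply: (@le_trans _ _ (2 * #|V j|%:R)); first by rewrite -natrM ler_nat.
  rewrite mulrC ler_wpM2l// -[leLHS](powRr1 (a := 2))//.
  by rewrite ler_powR// ler1n.
Qed.

Section extension.
Variables (s : R) (s0 : 0 <= s) (stb : s < tbox).
Let Lam := \sum_q dlam R a q.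
Let h := (tbox - s) / (2 * Lam).

Let Lam0 : 0 < Lam.
Proof.
rewrite /Lam (bigD1 j0)//=; apply: ltr_pwDl; first exact: dlam_gt0.
by apply: sumr_ge0 => q _; apply/ltW/dlam_gt0.
Qed.

Lemma slack_gt0 : 0 < h.
Proof. by apply: divr_gt0; [rewrite subr_gt0|apply: mulr_gt0]. Qed.

Variables (m l : nat) (l0 : (0 < l)%N) (w : Sh) (eps : R).
Variable V : 'I_d -> {pred {ffun 'I_l -> A}}.
Hypothesis HV : good_family h eps V.

Definition append (v : nat -> {ffun 'I_l -> A}) : Sh :=
  fun i => if (i < m)%N then w i else ext (v ((i - m) %/ l)%N) ((i - m) %% l)%N.

Lemma append_head v : agree m w (append v).
Proof. by move=> i im; rewrite /append im. Qed.

Lemma append_word v t (x : Sh) R' : (t < R')%N -> agree (m + R' * l) (append v) x ->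
  head_word l (iter (m + t * l) sigma x) = v t.
Proof.
move=> tR vx; rewrite -(extK (v t)); apply/head_word_agree => i il.
rewrite iter_shift -vx.
  rewrite /append ifF; last by clear; lia.
  have -> : (m + t * l + i - m = t * l + i)%N by clear; lia.
  by rewrite divnMDl// modnMDl divn_small// modn_small// addn0.
by rewrite -addnA ltn_add2l; move: l0 tR il; clear; nia.
Qed.

Definition admissible (v : nat -> {ffun 'I_l -> A}) := forall t, exists j, v t \in V j.

(** The number of full words of length [l] after a prefix of length [m] that the
    code at scale [2^-n] sees in the [q]-th coordinate. *)
Definition thr_low n (q : 'I_d) : nat := ((lev a q n - m) %/ l)%N.

Lemma thr_low_mono n (p q : 'I_d) : (p <= q)%N -> (thr_low n p <= thr_low n q)%N.
Proof. by move=> pq; rewrite leq_div2r// leq_sub2r// lev_mono. Qed.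

Lemma thr_low_bounds n q :
  (thr_low n q * l <= lev a q n)%N /\ (lev a q n <= thr_low n q * l + m + l)%N.
Proof.
have h1 : (thr_low n q * l <= lev a q n - m)%N by exact: leq_trunc_div.
have h2 : (lev a q n - m < (thr_low n q).+1 * l)%N by rewrite ltn_ceil.
by move: h2; rewrite mulSn; lia.
Qed.

Lemma thr_low_gap n (q : 'I_d) :
  `|(l * (thr_low n q - before 0%N (thr_low n) q))%N%:R - n%:R * dlam R a q| <=
    1 + m%:R + l%:R :> R.
Proof.
have -> : 1 + m%:R + l%:R = 1 + 0%N%:R + (m + l)%N%:R :> R by rewrite natrD; ring.
apply: level_gap => // [p p'|p|p]; first exact: thr_low_mono.
  by have [] := thr_low_bounds n p; rewrite mulnC addn0.
by have [] := thr_low_bounds n p; rewrite mulnC addnA.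
Qed.

(** At scale [2^-n] a word in the range of the factor [j] may be chosen in [V j],
    for all [j].  With the slack [h], half of the gap between [s] and [tbox] is
    lost, and the constant collects the bounded errors on the levels. *)
Lemma card_family_ge n :
  2 `^ (n%:R * ((tbox + s) / 2) -
     (1 + m%:R + l%:R) * \sum_q (log2 (N q)%:R + h)) <=
  #|(family (fun t : 'I_(blocks_end (thr_low n)) => V (block j0 (thr_low n) t)) :
    {pred {ffun 'I_(blocks_end (thr_low n)) -> {ffun 'I_l -> A}}})|%:R :> R.
Proof.
set Cst := 1 + m%:R + l%:R.
have -> : #|(family (fun t : 'I_(blocks_end (thr_low n)) => V (block j0 (thr_low n) t)) :
    {pred {ffun 'I_(blocks_end (thr_low n)) -> {ffun 'I_l -> A}}})|%:R =
    \prod_(t < blocks_end (thr_low n)) #|V (block j0 (thr_low n) t)|%:R :> R.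
  rewrite -sum1_card natr_sum.
  under [RHS]eq_bigr do rewrite -sum1_card natr_sum.
  rewrite (bigA_distr_big_dep (fun t : 'I_(blocks_end (thr_low n)) => V (block j0 (thr_low n) t))
    (fun _ _ => 1))/=.
  by apply: eq_bigr => c _; rewrite big1.
rewrite (prod_block j0 (thr_low_mono n) (fun q => #|V q|%:R)).
have -> : n%:R * ((tbox + s) / 2) - Cst * \sum_q (log2 (N q)%:R + h) =
    \sum_q ((n%:R * dlam R a q - Cst) * log2 (N q)%:R - h * (n%:R * dlam R a q + Cst)).
  have -> : (tbox + s) / 2 = tbox - h * Lam.
    by rewrite /h; field; rewrite gt_eqF.
  rewrite /box_dim /Lam [h * _]mulr_sumr -sumrB !mulr_sumr -sumrB.
  by apply: eq_bigr => q _; ring.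
rewrite pow2_sum; apply: ler_prod => q _; rewrite powR_ge0/=.
have [_ _ /(_ q) hV] := HV; have N1 : 1 <= (N q)%:R :> R by rewrite ler1n proj_card_gt0.
have := thr_low_gap n q; set g := (thr_low n q - _)%N.
rewrite ler_norml => /andP[]; rewrite lerBrDl => g1; rewrite lerBlDl => g2.
apply: (@le_trans _ _ (((N q)%:R ^+ l * 2 `^ (- (h * l%:R))) ^+ g)); last first.
  by rewrite lerXn2r// ?nnegrE ?mulr_ge0 ?exprn_ge0 ?powR_ge0.
rewrite exprMn -exprM pow2D ler_pM ?powR_ge0//.
  exact: exprn_ge_pow2.
rewrite -powR_mulrn ?powR_ge0// -powRrM ler_powR ?ler1n// mulNr lerN2.
by rewrite -mulrA ler_pM2l ?slack_gt0// -natrM.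
Qed.

(** Otherwise [G] meets all the cylinders given by a finite list of good words after
    the prefix [w].  Choosing at scale [2^-n] the word of each position in the
    factor that is visible there gives points of [G] with different codes, and
    there are about [2 `^ (n * (tbox + s) / 2)] of them, so that the packing
    sizes of [G] for the exponent [s] are unbounded. *)
Lemma avoid_exists (G : set (torus R d)) : (packing_premeasure s G < +oo)%E ->
  exists v R', admissible v /\
    forall x, agree (m + R' * l) (append v) x -> ~ G (PI x).
Proof.
move=> Gfin; apply: contrapT => nav.
have hit v R' : exists x, admissible v -> agree (m + R' * l) (append v) x /\ G (PI x).
  have [av|nv] := pselect (admissible v); last by exists point.
  apply: contrapT => nx; apply: nav; exists v, R'; split => // x vx Gx.
  by apply: nx; exists x.
(* Only the words with index below [M n] are chosen; the others are [u0]. *)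
have [u0 u0V] : exists u0, u0 \in V j0.
  apply/card_gt0P; rewrite -(ltr0n R); have [_ _ /(_ j0)] := HV; apply: lt_le_trans.
  by rewrite mulr_gt0 ?powR_gt0// exprn_gt0// ltr0n proj_card_gt0.
pose M n := blocks_end (thr_low n).
pose v n (c : {ffun 'I_(M n) -> {ffun 'I_l -> A}}) t :=
  if insub t is Some t' then c t' else u0.
pose P n : {pred {ffun 'I_(M n) -> {ffun 'I_l -> A}}} :=
  family (fun t : 'I_(M n) => V (block j0 (thr_low n) t)).
have vadm n (c : {ffun 'I_(M n) -> {ffun 'I_l -> A}}) : c \in P n -> admissible (v n c).
  move=> /familyP cP t; rewrite /v; case: insubP => [t' _ _|_]; last by exists j0.
  by exists (block j0 (thr_low n) t'); exact: cP.
(* A point of [G] in the cylinder of the list of words [c]. *)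
pose x n (c : {ffun 'I_(M n) -> {ffun 'I_l -> A}}) := sval (cid (hit (v n c) (M n))).
have Hx n (c : {ffun 'I_(M n) -> {ffun 'I_l -> A}}) : c \in P n ->
    agree (m + M n * l) (append (v n c)) (x n c) /\ G (PI (x n c)).
  by move=> /vadm; exact: (svalP (cid (hit (v n c) (M n)))).
have key n del : sep_radius R a n <= del ->
    ((#|P n|%:R / (3 ^ d)%:R * (2 * sep_radius R a n) `^ s)%:E <= packing_size s del G)%E.
  apply: (@packing_size_ge R d a a_ge2 D D0 _ (P n) (x n)) => [c /Hx[]//|c c' cP c'P sc].
  apply/ffunP => t.
  have [q tq] := blocks_endP (ltn_ord t).
  have [/andP[_ tb] _] := blockP j0 (thr_low_mono n) tq.
  set b := block j0 (thr_low n) t in tb.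
  have [_ sep _] := HV; apply: (sep b).
  - by move/familyP : cP; exact.
  - by move/familyP : c'P; exact.
  move=> i.
  have xE (c1 : {ffun 'I_(M n) -> {ffun 'I_l -> A}}) : c1 \in P n ->
      c1 t i = x n c1 (m + t * l + i)%N.
    move=> /Hx[ag _]; have := append_word (ltn_ord t) ag.
    by rewrite /v valK => <-; rewrite ffunE iter_shift.
  rewrite !xE//; apply/proj_rep_eq/eta_ext => q' bq'.
  apply: val_inj; apply: (digit_code_inj a_ge2 (sc q')).
  rewrite (leq_trans _ (lev_mono a_ge2 a_decr n bq'))//.
  have [hb _] := thr_low_bounds n b.
  have h1 : ((lev a b n - m) %/ l * l <= lev a b n - m)%N by exact: leq_trunc_div.
  have h2 : (t.+1 * l <= thr_low n b * l)%N by rewrite leq_mul2r tb orbT.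
  have := ltn_ord i; move: h1 h2; rewrite -/(thr_low n b) mulSn; lia.
have [_ [del del0 <-] /= Gdel] := ereal_inf_lt Gfin.
have Gdf : packing_size s del G \is a fin_num.
  by rewrite ge0_fin_numE// packing_size_ge0.
pose Cst := (1 + m%:R + l%:R) * \sum_q (log2 (N q)%:R + h).
pose kap : R := (2 * (amax a).+1%:R)^-1.
have kap0 : 0 < kap by rewrite invr_gt0 mulr_gt0.
have sepE n : 2 * sep_radius R a n = 2 `^ (- n%:R) * kap.
  rewrite /sep_radius /kap pow2N.
  have h1 : (2 : R) ^+ n != 0 by rewrite expf_neq0.
  have h2 : (amax a).+1%:R != 0 :> R by rewrite pnatr_eq0.
  set x1 := (amax a).+1%:R in h2 *; set y1 := 2 ^+ n in h1 *.
  by move: x1 y1 h1 h2 => x1 y1 h1 h2; field; rewrite h1 h2.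
pose th := (tbox - s) / 2; have th0 : 0 < th by rewrite divr_gt0// subr_gt0.
pose c0 := 2 `^ (- Cst) / (3 ^ d)%:R * kap `^ s.
have c00 : 0 < c0 by rewrite mulr_gt0 ?divr_gt0 ?powR_gt0// ltr0n expn_gt0.
have lower n : sep_radius R a n <= del -> c0 * 2 `^ (n%:R * th) <= fine (packing_size s del G).
  move=> /key; rewrite -lee_fin fineK//; apply: le_trans; rewrite lee_fin.
  apply: (@le_trans _ _ (2 `^ (n%:R * ((tbox + s) / 2) - Cst) / (3 ^ d)%:R * (2 * sep_radius R a n) `^ s)).
    rewrite sepE powRM ?powR_ge0 ?(ltW kap0)// -powRrM /c0.
    rewrite le_eqVlt; apply/orP; left; apply/eqP.
    have -> : n%:R * ((tbox + s) / 2) - Cst = - Cst + n%:R * th - (- n%:R * s).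
      by rewrite /th; field.
    rewrite !pow2D (powRN 2 (- n%:R * s)).
    have : 2 `^ (- n%:R * s) != 0 by rewrite gt_eqF// powR_gt0.
    by move=> ?; field; rewrite pnatr_eq0 expn_eq0 /=.
  rewrite ler_wpM2r ?powR_ge0// ler_wpM2r ?invr_ge0//.
  exact: card_family_ge.
have [n1 _ Hn1] : \forall n \near \oo, del^-1 <= n%:R by exact: nbhs_infty_ger.
have [n2 _ Hn2] : \forall n \near \oo,
  (fine (packing_size s del G) / c0 + 1) / (th * ln 2) <= n%:R by exact: nbhs_infty_ger.
pose n := maxn n1 n2.
have ln2 : 0 < ln 2 :> R by rewrite ln_gt0// ltr1n.
have rn : sep_radius R a n <= del.
  rewrite -[leRHS]invrK /sep_radius lef_pV2 ?posrE ?invr_gt0 ?mulr_gt0 ?exprn_gt0//.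
  apply: le_trans (Hn1 n (leq_maxl _ _)) _; rewrite -natrX -natrM -natrM ler_nat.
  rewrite (leq_trans (ltnW (ltn_expl n (isT : 1 < 2)%N)))//.
  by rewrite leq_pmulr// muln_gt0.
have := lower n rn; apply/negP; rewrite -ltNge [ltRHS]mulrC -ltr_pdivrMr//.
have := Hn2 n (leq_maxr _ _); rewrite /= ler_pdivrMr ?(mulr_gt0 th0 ln2)// => hn.
apply: (@lt_le_trans _ _ (fine (packing_size s del G) / c0 + 1)); first by rewrite ltrDl.
apply: (le_trans hn); rewrite /powR pnatr_eq0 mulrA.
by rewrite (le_trans _ (expR_ge1Dx _))// lerDr.
Qed.
End extension.
Section below.
Variables (s : R) (s0 : 0 <= s) (stb : s < tbox).
Let h := (tbox - s) / (2 * \sum_q dlam R a q).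
Let B' := B + `|alpha|.

Let h0 : 0 < h. Proof. exact: (slack_gt0 stb). Qed.

Let B'0 : 0 <= B'.
Proof. by rewrite addr_ge0// (le_trans _ (phi_bnd point)). Qed.

Lemma discrepancy_le n w : `|bsum phi n w - n%:R * alpha| <= n%:R * B'.
Proof.
rewrite /bsum mulr_natl -[in X in _ - X](card_ord n) -sumr_const -sumrB.
rewrite (le_trans (ler_norm_sum _ _ _))//.
rewrite mulr_natl -[leRHS]/(B' *+ n) -[in leRHS](card_ord n) -sumr_const.
by apply: ler_sum => i _; rewrite (le_trans (ler_normB _ _))// lerD2r.
Qed.

(** The state of the construction: the prefix of length [m] has discrepancy at most
    [ep * m], and is long enough for an incomplete word of the next list to be
    negligible. *)
Definition extendable m (w : Sh) (ep : R) :=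
  (exists l (V : 'I_d -> {pred {ffun 'I_l -> A}}),
     [/\ (0 < l)%N, good_family h (ep / 4) V & 2 * B' * l%:R <= ep * m%:R]) /\
  forall x, agree m w x -> `|bsum phi m x - m%:R * alpha| <= ep * m%:R.

Lemma append_discrepancy m l w (V : 'I_d -> {pred {ffun 'I_l -> A}}) (ep : R) v K x n :
  (0 < l)%N -> 0 < ep -> good_family h (ep / 4) V -> admissible V v ->
  `|bsum phi m x - m%:R * alpha| <= ep * m%:R ->
  agree (m + K * l) (append m w v) x -> (m <= n <= m + K * l)%N ->
  `|bsum phi n x - n%:R * alpha| <= ep * m%:R + ep / 4 * (n%:R - m%:R) + B' * l%:R.
Proof.
move=> l0 ep0 [good _ _] vadm hm vx /andP[mn nK].
have blk t : (t <= K)%N ->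
    `|bsum phi (m + t * l) x - (m + t * l)%:R * alpha| <= ep * m%:R + ep / 4 * (t * l)%:R.
  elim: t => [|t IH] tK; first by rewrite mul0n addn0 mulr0 addr0.
  have [j vj] := vadm t.
  have := IH (ltnW tK).
  have /good : head_word l (iter (m + t * l) sigma x) \in V j.
    by rewrite (append_word l0 tK vx).
  rewrite mulSn [(l + _)%N]addnC addnA (bsumD phi (m + t * l) l) !natrD.
  set p := bsum _ _ _; set q := bsum _ _ _; set L := l%:R; set T := (t * l)%:R.
  move=> h1 h2.
  have -> : q + p - (m%:R + T + L) * alpha = (q - (m%:R + T) * alpha) + (p - L * alpha).
    by ring.
  by rewrite (le_trans (ler_normD _ _))//; move: h1 h2; lra.
set t := ((n - m) %/ l)%N; set r := ((n - m) %% l)%N.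
have nE : (n = m + t * l + r)%N by rewrite -addnA -divn_eq; lia.
have rl : (r <= l)%N by rewrite ltnW// ltn_mod.
have tK : (t <= K)%N.
  by rewrite /t -(mulnK K l0) leq_div2r// leq_subLR.
have := blk t tK; have := discrepancy_le r (iter (m + t * l) sigma x).
have rB : r%:R * B' <= B' * l%:R by rewrite mulrC ler_wpM2l// ler_nat.
have e1 : 0 <= ep / 4 * r%:R by rewrite mulr_ge0// divr_ge0// ltW.
rewrite nE (bsumD phi (m + t * l) r) !natrD; set p := bsum _ _ _; set q := bsum _ _ _; set T := (t * l)%:R.
move=> h1 h2.
have -> : q + p - (m%:R + T + r%:R) * alpha = (q - (m%:R + T) * alpha) + (p - r%:R * alpha).
  by ring.
by rewrite (le_trans (ler_normD _ _))//; move: h1 h2 rB e1; lra.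
Qed.

Lemma extendable_start : exists m w, (0 < m)%N /\ extendable m w (2 * B' + 1).
Proof.
have ep0 : 0 < 2 * B' + 1 by rewrite ltr_wpDl// mulr_ge0.
have [|l [V [l0 HV]]] := good_family_exists h0 (eps := (2 * B' + 1) / 4).
  by rewrite divr_gt0.
exists l, point; split => //; split.
  by exists l, V; split => //; rewrite ler_wpM2r// lerDl.
move=> x _; rewrite (le_trans (discrepancy_le _ _))// mulrC ler_wpM2r//.
by move: B'0; lra.
Qed.

(** The prefix is extended far enough to leave [G], and far enough for the new
    words to dominate the discrepancy and for the next list to be affordable. *)
Lemma extendable_step m w (ep : R) (G : set (torus R d)) : 0 < ep -> extendable m w ep ->
  (packing_premeasure s G < +oo)%E ->
  exists m' w', [/\ (m < m')%N, agree m w w', extendable m' w' (ep / 2),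
    forall x, agree m' w' x -> ~ G (PI x) &
    forall x n, agree m' w' x -> (m <= n <= m')%N ->
      `|bsum phi n x - n%:R * alpha| <= 3 * ep * n%:R].
Proof.
move=> ep0 [[l [V [l0 HV lm]]] hm] Gfin.
have [v [R' [vadm avoid]]] := avoid_exists s0 stb m l0 w HV Gfin.
have [|l' [V' [l'0 HV']]] := good_family_exists h0 (eps := (ep / 2) / 4).
  by rewrite !divr_gt0.
have [K1 _ HK1] : \forall K \near \oo, 4 * B' * l'%:R / ep <= K%:R by exact: nbhs_infty_ger.
(* The three terms serve to leave [G], to afford the next list, and to make the
   old prefix at most a sixth of the new one. *)
pose K := (R' + K1 + 6 * m).+1.
pose m' := (m + K * l)%N.
have Kl : (K <= K * l)%N by rewrite leq_pmulr.
have m'6 : 6 * m%:R <= m'%:R :> R by rewrite -natrM ler_nat /m' /K; move: Kl; rewrite /K; lia.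
have disc x n : agree m' (append m w v) x -> (m <= n <= m')%N ->
    `|bsum phi n x - n%:R * alpha| <= ep * m%:R + ep / 4 * (n%:R - m%:R) + B' * l%:R.
  move=> ax; apply: (append_discrepancy l0 ep0 HV vadm _ ax).
  apply: hm; apply: agree_trans (append_head w v) _.
  by apply: agree_leq ax; exact: leq_addr.
exists m', (append m w v); split.
- by rewrite /m'; move: Kl; rewrite /K; lia.
- exact: append_head.
- split.
    exists l', V'; split => //.
    have h1 : 4 * B' * l'%:R / ep <= m'%:R.
      apply: (le_trans (HK1 K _)); first by rewrite /= /K; lia.
      by rewrite ler_nat (leq_trans Kl)// leq_addl.
    by move: h1; rewrite ler_pdivrMr//; lra.
  move=> x ax; have := disc x m' ax; rewrite leqnn leq_addr => /(_ isT).
  have := ler_wpM2l (ltW ep0) m'6; have : 0 <= ep * m%:R by rewrite mulr_ge0// ltW.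
  by move: lm; lra.
- move=> x ax; apply: avoid; apply: agree_leq ax.
  by rewrite leq_add2l leq_mul2r; apply/orP; right; rewrite /K; lia.
move=> x n ax nm; apply: (le_trans (disc x n ax nm)).
have /andP[mn _] := nm.
have : ep * m%:R <= ep * n%:R by rewrite ler_wpM2l ?(ltW ep0)// ler_nat.
have : 0 <= ep * m%:R by rewrite mulr_ge0// ltW.
by move: lm; lra.
Qed.

(** A limit of extended prefixes: the [i]-th extension leaves [G i], and the
    precision is halved each time. *)
Lemma level_set_uncovered (G : nat -> set (torus R d)) :
  (forall i, (packing_premeasure s (G i) < +oo)%E) ->
  ~ (level_set phi alpha `<=` \bigcup_i G i).
Proof.
move=> Gfin.
pose ep i : R := (2 * B' + 1) / 2 ^+ i.
have ep0 i : 0 < ep i by rewrite divr_gt0 ?exprn_gt0// ltr_wpDl// mulr_ge0.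
have epS i : ep i.+1 = ep i / 2 by rewrite /ep exprSr invfM mulrA.
have [m0 [w0 [m00 start]]] := extendable_start.
have /choice[F HF] : forall p : nat * (nat * Sh), exists q : nat * Sh,
    extendable p.2.1 p.2.2 (ep p.1) ->
    [/\ (p.2.1 < q.1)%N, agree p.2.1 p.2.2 q.2, extendable q.1 q.2 (ep p.1.+1),
      forall x, agree q.1 q.2 x -> ~ G p.1 (PI x) &
      forall x n, agree q.1 q.2 x -> (p.2.1 <= n <= q.1)%N ->
        `|bsum phi n x - n%:R * alpha| <= 3 * ep p.1 * n%:R].
  move=> [i [m w]] /=; have [ex|nex] := pselect (extendable m w (ep i)); last by exists (m, w).
  have [m' [w' [h1 h2 h3 h4 h5]]] := extendable_step (ep0 i) ex (Gfin i).
  by exists (m', w'); split => //=; rewrite epS.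
pose st := fix st i := if i is i'.+1 then F (i', st i') else (m0, w0).
have stx i : extendable (st i).1 (st i).2 (ep i).
  elim: i => [|i IH]; first by rewrite /ep expr0 divr1.
  by have [_ _ ? _ _] := HF (i, st i) IH.
have stP i := HF (i, st i) (stx i).
have mS i : ((st i).1 < (st i.+1).1)%N by have [] := stP i.
have mi i : (i < (st i).1)%N.
  by elim: i => // i IH; rewrite (leq_ltn_trans IH).
have mono i j : (i <= j)%N -> ((st i).1 <= (st j).1)%N.
  elim: j => [|j IH]; first by rewrite leqn0 => /eqP ->.
  rewrite leq_eqVlt => /orP[/eqP -> //|ij].
  by rewrite (leq_trans (IH ij))// ltnW.
have agr i j : (i <= j)%N -> agree (st i).1 (st i).2 (st j).2.
  elim: j => [|j IH]; first by rewrite leqn0 => /eqP ->.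
  rewrite leq_eqVlt => /orP[/eqP -> //|ij].
  apply: agree_trans (IH ij) _; have [_ ag _ _ _] := stP j.
  by apply: agree_leq ag; exact: mono.
(* The length of the [n.+1]-st prefix exceeds [n], so its letter [n] is final. *)
pose om : Sh := fun n => (st n.+1).2 n.
have omP i : agree (st i).1 (st i).2 om.
  move=> n nm; rewrite /om; have [|/ltnW] := leqP i n.+1; first by move/agr; exact.
  by move/agr => ag; rewrite ag// (ltn_trans _ (mi _)).
have disc i j n : (i <= j)%N -> ((st i).1 <= n <= (st j).1)%N ->
    `|bsum phi n om - n%:R * alpha| <= 3 * ep i * n%:R.
  elim: j => [|j IH] ij /andP[h1 h2].
    move: ij h2; rewrite leqn0 => /eqP i0; move: h1; rewrite {}i0 => h1 h2.
    have -> : n = (st 0).1 by apply/eqP; rewrite eqn_leq h1 h2.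
    have [_ /(_ om (omP 0%N))/le_trans] := stx 0%N; apply.
    by rewrite ler_wpM2r//; have := ep0 0%N; lra.
  have [nj|jn] := leqP n (st j).1.
    have [ij'|ji] := leqP i j; first by apply: IH => //; rewrite h1.
    have jE : i = j.+1 by apply/eqP; rewrite eqn_leq ij ji.
    by move: (leq_trans h1 nj); rewrite jE leqNgt mS.
  move: ij; rewrite leq_eqVlt => /orP[/eqP ij|].
    rewrite ij in h1 *; have -> : n = (st j.+1).1 by apply/eqP; rewrite eqn_leq h1 h2.
    have [_ /(_ om (omP j.+1))/le_trans] := stx j.+1; apply.
    by rewrite ler_wpM2r//; have := ep0 j.+1; lra.
  rewrite ltnS => ij; have [_ _ _ _ /(_ om n (omP j.+1))] := stP j.
  rewrite /= (ltnW jn) h2 => /(_ isT)/le_trans; apply.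
  rewrite ler_wpM2r// ler_wpM2l// /ep ler_wpM2l ?ler_wpDl ?mulr_ge0//.
  by rewrite lef_pV2 ?posrE ?exprn_gt0// ler_eXn2l// ltr1n.
move=> cov.
have /cov[i _] : level_set phi alpha (PI om).
  exists om => //=; apply/cvgrPdist_le => eta eta0.
  have [k _ Hk] : \forall k \near \oo, 3 * (2 * B' + 1) / eta <= k%:R by exact: nbhs_infty_ger.
  have epk : 3 * ep k <= eta.
    rewrite /ep mulrA ler_pdivrMr ?exprn_gt0// [leRHS]mulrC -ler_pdivrMr//.
    by rewrite (le_trans (Hk k (leqnn k)))// -natrX ler_nat ltnW// ltn_expl.
  near=> n.
  have kn : ((st k).1 <= n)%N by near: n; exists (st k).1.
  have n0 : 0 < n%:R :> R by rewrite ltr0n (leq_trans _ kn)// (leq_trans _ (mi k)).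
  have := disc k (maxn k n) n (leq_maxl _ _).
  rewrite kn (leq_trans (ltnW (mi n)))/= ?mono ?leq_maxr// => /(_ isT) hn.
  have -> : alpha - birkhoff_average phi n om = - (n%:R^-1 * (bsum phi n om - n%:R * alpha)).
    by rewrite /birkhoff_average -/(bsum phi n om); field; rewrite gt_eqF.
  rewrite normrN normrM gtr0_norm ?invr_gt0// ler_pdivrMl// (le_trans hn)// mulrC.
  by rewrite ler_wpM2l// ltW.
by have [_ _ _ nG _] := stP i; apply: nG; exact: (omP i.+1).
Unshelve. all: by end_near. Qed.

End below.

(** A set of packing measure zero is covered by sets of finite premeasure. *)
Lemma level_set_dim_ge : (tbox%:E <= packing_dim (@level_set R d a D D0 phi alpha))%E.
Proof.
apply: le_ereal_inf_tmp => _ [s [s0 ms] <-]; rewrite lee_fin leNgt; apply/negP => stb.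
have /ereal_inf_lt[_ [G cov <-] G1] : (packing_measure s (@level_set R d a D D0 phi alpha) < 1)%E.
  by rewrite ms lte_fin.
apply: (@level_set_uncovered s s0 stb G) cov => i.
apply: le_lt_trans (lt_trans G1 (ltry 1)).
have G0 k : (0 <= packing_premeasure s (G k))%E by exact: packing_premeasure_ge0.
rewrite (nneseriesD1 (n := i))//.
by rewrite leeDl// nneseries_ge0.
Qed.

End lower_step.

(** * Level sets of full packing dimension *)

Section main.
Variables (R : realType) (d : nat) (a : 'I_d -> nat).
Variables (D : {set digit a}) (D0 : D != finset.set0).
Local Notation A := (alphabet D0).
Local Notation Sh := (fullshift A).
Local Notation sigma := (@left_shift A).
Local Notation N := (@proj_card d a D D0).
Local Notation tbox := (@box_dim R d a N).
Local Notation e := (@proj_rep d a D D0).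
Local Notation Aj j := (alphabet (eta_imset_neq0 D0 j)).

Lemma packing_dim_subset (F G : set (torus R d)) :
  F `<=` G -> (packing_dim F <= packing_dim G)%E.
Proof.
move=> FG; apply: ereal_inf_le_tmp => _ [s [s0 sG] <-]; exists s => //; split => //.
apply/eqP; rewrite eq_le; apply/andP; split.
  rewrite -[leRHS]sG; apply: ereal_inf_le_tmp => _ [H GH <-]; exists H => //.
  exact: subset_trans GH.
apply: le_ereal_inf_tmp => _ [H _ <-]; apply: nneseries_ge0 => i _ _.
exact: packing_premeasure_ge0.
Qed.

Definition eta_word j n (c : {ffun 'I_n -> A}) : {ffun 'I_n -> Aj j} :=
  [ffun i => eta_alphabet j (c i)].

Lemma eta_alphabet_eq j (x y : A) : eta_alphabet j x = eta_alphabet j y <-> e j x = e j y.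
Proof.
split=> [/(congr1 val)/=|]; first exact: proj_rep_eq.
by move=> /proj_rep_eta xy; apply: val_inj.
Qed.

Lemma fiberE j n (c : {ffun 'I_n -> A}) :
  fiber (e j) c = @chi d a D D0 j @^-1` (head_word n @^-1` [set eta_word j c]).
Proof.
apply/seteqP; split => w /=.
  by move=> wc; apply/ffunP => i; rewrite !ffunE; apply/eta_alphabet_eq/wc.
by move=> /ffunP wc i; apply/eta_alphabet_eq; have := wc i; rewrite !ffunE.
Qed.

(** The letters of the factor correspond to the letters fixed by [proj_rep j]. *)
Lemma eta_alphabet_lift j (y : Aj j) : exists2 x : A, e j x = x & eta_alphabet j x = y.
Proof.
have /imsetP[x0 x0D yE] := valP y.
exists (e j (exist _ x0 x0D)); first exact: proj_repK.
by apply: val_inj; rewrite /= yE; exact: (eta_proj_rep j (exist _ x0 x0D)).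
Qed.

Lemma eta_word_lift j n (v : {ffun 'I_n -> Aj j}) :
  exists2 c, c \in fixed_words (e j) (k:=n) & eta_word j c = v.
Proof.
have /choice[f Hf] : forall y : Aj j, exists x : A, e j x = x /\ eta_alphabet j x = y.
  by move=> y; have [x] := eta_alphabet_lift y; exists x.
exists [ffun i => f (v i)].
  by apply/ffun_onP => i; rewrite ffunE inE; apply/eqP; exact: (Hf _).1.
by apply/ffunP => i; rewrite !ffunE; exact: (Hf _).2.
Qed.

Lemma card_eta_alphabet j : #|{: Aj j}| = N j.
Proof.
rewrite /proj_card -(card_in_image (f := @eta_alphabet d a D D0 j)).
  apply: eq_card => y; rewrite inE; apply/esym/fintype.imageP.
  by have [x ex <-] := eta_alphabet_lift y; exists x => //; rewrite inE ex.
move=> x y; rewrite !inE => /eqP ex /eqP ey /eta_alphabet_eq.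
by rewrite ex ey.
Qed.

Lemma measurable_chi j : measurable_fun setT (@chi d a D D0 j).
Proof.
apply: (measurability _ (borel_fin_determined (eta_imset_neq0 D0 j))).
move=> _ [E [n En] <-]; rewrite setTI; apply: fin_determined_measurable.
exists n => w w' ww' /=; apply: En => i ni; rewrite /chi; congr eta_alphabet.
exact: ww'.
Qed.

(** Together with [uniform_pushforward]: projecting to the uniform measure of the
    [j]-th factor means that all the words over this factor have equal mass. *)
Lemma pushforward_uniform j (mu : probability Sh R) (nu : probability (fullshift (Aj j)) R) :
  uniform_words nu ->
  (forall k c, c \in fixed_words (e j) (k:=k) -> Pr mu (fiber (e j) c) = (N j)%:R ^- k) ->
  forall E, measurable E -> pushforward mu (@chi d a D D0 j) E = nu E.
Proof.
move=> nu_u mu_u.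
pose X : {mfun Sh >-> fullshift (Aj j)} := mfun_Sub (mem_set (@measurable_chi j)).
pose mu' : probability (fullshift (Aj j)) R := distribution mu X.
move=> E mE; apply: (@measure_ext_words _ _ _ _ mu' nu) => // n v.
rewrite nu_u card_eta_alphabet; have [c cf <-] := eta_word_lift v.
by rewrite -(mu_u _ _ cf) fiberE.
Qed.

Lemma uniform_pushforward j (mu : probability Sh R) (nu : probability (fullshift (Aj j)) R) :
  uniform_words nu ->
  (forall E, measurable E -> pushforward mu (@chi d a D D0 j) E = nu E) ->
  forall k (c : {ffun 'I_k -> A}), Pr mu (fiber (e j) c) = (N j)%:R ^- k.
Proof.
move=> nu_u mu_nu k c; rewrite fiberE -card_eta_alphabet -(nu_u _ (eta_word j c)).
by rewrite /Pr -mu_nu//; exact: measurable_head_word.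
Qed.

Lemma upper_mean0 j : upper_mean (e j) (fun _ : Sh => 0 : R) 0.
Proof.
move=> k; rewrite mulr0 mulr0; apply: sumr_ge0 => c _.
have [B0 cB] : (forall w : Sh, `|0 : R| <= 0) /\ fiber (e j) c (ext c).
  by split => [w|i]; rewrite ?normr0//; rewrite /ext valK.
rewrite (le_trans _ (bsum_le_lift (phi := fun=> 0) B0 cB))//.
by rewrite /bsum big1.
Qed.

Lemma level_setN (phi : Sh -> R) alpha :
  @level_set R d a D D0 (fun w => - phi w) (- alpha) = level_set phi alpha.
Proof.
have avgN psi w : birkhoff_average (fun w : Sh => - psi w) ^~ w =
    (fun n => - birkhoff_average psi n w) :> (nat -> R).
  by apply/funext => n; rewrite /birkhoff_average sumrN mulrN.
apply/seteqP; split => _ [w /= wa <-]; exists w => //=.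
  rewrite -[alpha]opprK (_ : (fun n => _) = (fun n => - - birkhoff_average phi n w)).
    by apply: cvgN; rewrite -avgN.
  by apply/funext => n; rewrite opprK.
by rewrite avgN; exact: cvgN.
Qed.

Hypothesis a_ge2 : forall q, (2 <= a q)%N.
Hypothesis a_decr : forall p q : 'I_d, (p < q)%N -> (a q < a p)%N.
Variable j0 : 'I_d.

(** The sponge is the level set of the function 0. *)
Lemma packing_dim_sponge : packing_dim (@sponge R d a D D0) = tbox%:E.
Proof.
apply/eqP; rewrite eq_le sponge_dim_le//=.
have h0 : (fun _ : Sh => - 0) = (fun=> 0) :> (Sh -> R) by apply/funext => w; rewrite oppr0.
have := @level_set_dim_ge R d a a_ge2 a_decr D D0 j0 (fun=> 0) 0 0.
move=> h; apply: le_trans (h _ _ _ _) _.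
- exact: (@cst_continuous Sh R 0).
- by move=> w; rewrite normr0.
- exact: upper_mean0.
- by rewrite h0 oppr0; exact: upper_mean0.
apply: packing_dim_subset => _ [w _ <-]; by exists w.
Qed.

Lemma packing_dim_full_iff (phi : Sh -> R) alpha :
  continuous phi ->
  packing_dim (@level_set R d a D D0 phi alpha) = tbox%:E
  /\ attainable phi alpha <->
  exists mu : 'I_d -> probability Sh R, forall j,
     [/\ invariant_measure sigma (mu j),
         forall k c, c \in fixed_words (e j) (k:=k) -> Pr (mu j) (fiber (e j) c) = (N j)%:R ^- k &
         \int[mu j]_w phi w = alpha].
Proof.
move=> phi_cont; have [B B0 phi_bnd] := continuous_bounded phi_cont.
have Nphi_cont := continuous_opp_fun phi_cont.
have Nphi_bnd w : `|- phi w| <= B by rewrite normrN.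
split=> [[dimE [mu mu_inv muE]]|[mu Hmu]].
  suff up j : upper_mean (e j) phi alpha /\ upper_mean (e j) (fun w => - phi w) (- alpha).
    have /choice[nu Hnu] : forall j, exists nu : probability Sh R,
       [/\ invariant_measure sigma nu,
         forall k c, c \in fixed_words (e j) (k:=k) -> Pr nu (fiber (e j) c) = (N j)%:R ^- k &
         \int[nu]_w phi w = alpha].
      move=> j; have [up1 up2] := up j.
      exact: (invariant_of_upper_mean (@proj_repK _ _ _ D0 j) phi_cont up1 up2).
    by exists nu.
  have term0 q : 0 <= dlam R a q * log2 (N q)%:R.
    by rewrite mulr_ge0 ?log2_ge0 ?ler1n ?proj_card_gt0// ltW// dlam_gt0.
  have : 0 <= tbox by apply: sumr_ge0 => q _; exact: term0.
  rewrite le_eqVlt => /orP[/eqP tbox0|tbox_gt0]; last first.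
    split; apply: contrapT => nup.
      have := level_set_dim_lt a_ge2 a_decr phi_bnd tbox_gt0 nup.
      by rewrite dimE ltxx.
    have := level_set_dim_lt a_ge2 a_decr Nphi_bnd tbox_gt0 nup.
    by rewrite level_setN dimE ltxx.
  (* A sum of nonnegative terms vanishes, so every factor has a single letter. *)
  have N1 : N j = 1%N.
    have : dlam R a j * log2 (N j)%:R = 0.
      apply/eqP; rewrite eq_le term0 andbT tbox0 /box_dim (bigD1 j)//= lerDl.
      by apply: sumr_ge0 => q _; exact: term0.
    move/eqP; rewrite mulf_eq0 gt_eqF ?dlam_gt0//= /log2 mulf_eq0 invr_eq0.
    have ln2 : ln 2 != 0 :> R by rewrite gt_eqF// ln_gt0// ltr1n.
    rewrite (negbTE ln2) orbF ln_eq0 ?ltr0n ?proj_card_gt0//.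
    by rewrite pnatr_eq1 => /eqP.
  have mu_fib k (c : {ffun 'I_k -> A}) : c \in fixed_words (e j) (k:=k) ->
      Pr mu (fiber (e j) c) = (N j)%:R ^- k.
    move=> _; rewrite N1 expr1n invr1 (_ : fiber _ _ = setT) ?/Pr ?probability_setT//.
    apply/seteqP; split => // w _ i.
    have /card_le1_eqP : (N j <= 1)%N by rewrite N1.
    by apply; rewrite inE proj_repK.
  have := upper_mean_integral (@proj_repK _ _ _ D0 j) mu_inv mu_fib Nphi_cont.
  have := upper_mean_integral (@proj_repK _ _ _ D0 j) mu_inv mu_fib phi_cont.
  by rewrite RintN// muE.
have intE j : \int[mu j]_w phi w = alpha by have [] := Hmu j.
split; last by exists (mu j0); [have [] := Hmu j0|exact: intE].
apply/eqP; rewrite eq_le; apply/andP; split.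
  apply: le_trans (sponge_dim_le R a_ge2 a_decr D0 j0); apply: packing_dim_subset.
  by move=> _ [w _ <-]; exists w.
apply: (level_set_dim_ge a_ge2 a_decr j0 phi_cont phi_bnd) => j.
  have [mu_inv mu_fib _] := Hmu j.
  have := upper_mean_integral (@proj_repK _ _ _ D0 j) mu_inv mu_fib phi_cont.
  by rewrite intE.
have [mu_inv mu_fib _] := Hmu j.
have := upper_mean_integral (@proj_repK _ _ _ D0 j) mu_inv mu_fib Nphi_cont.
by rewrite RintN// intE.
Qed.
End main.

Theorem corollary3 (R : realType) (d : nat) (a : 'I_d -> nat)
    (d_gt0 : (0 < d)%N)
    (a_ge2 : forall q, (2 <= a q)%N)
    (a_decr : forall p q : 'I_d, (p < q)%N -> (a q < a p)%N)
    (D : {set digit a}) (D0 : D != finset.set0)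
    (b : forall k : 'I_d, probability (Sigma_ D0 k) R)
    (b_mme : forall k, max_entropy_measure (@left_shift _) (b k))
    (phi : Sigma D0 -> R) (phi_cont : continuous phi) :
  (exists2 alpha : R, attainable phi alpha &
     packing_dim (level_set phi alpha) = packing_dim (@sponge R d a D D0))
  <->
  (exists mu : 'I_d -> probability (Sigma D0) R,
     [/\ forall j, invariant_measure (@left_shift _) (mu j),
         forall j A, measurable A ->
           pushforward (mu j) (@chi d a D D0 j) A = b j A &
         forall i j, \int[mu i]_w phi w = \int[mu j]_w phi w]).
Proof.
pose j0 := Ordinal d_gt0.
have b_unif k : uniform_words (b k) by exact: max_entropy_uniform (b_mme k).
have iff := packing_dim_full_iff a_ge2 a_decr j0 _ phi_cont.
rewrite (packing_dim_sponge R D0 a_ge2 a_decr j0); split.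
  move=> [alpha att dimE]; have /iff[mu Hmu] := conj dimE att.
  exists mu; split=> [j|j E mE|i j].
  - by have [] := Hmu j.
  - by have [_ mu_fib _] := Hmu j; exact: pushforward_uniform (b_unif j) mu_fib E mE.
  - by have [_ _ ->] := Hmu i; have [_ _ ->] := Hmu j.
move=> [mu [mu_inv mu_b mu_int]].
have [_ full] := iff (\int[mu j0]_w phi w).
have [|dimE att] := full; last by exists (\int[mu j0]_w phi w).
exists mu => j; split=> [|k c _|]; [exact: mu_inv| |exact: mu_int].
exact: (uniform_pushforward (b_unif j) (mu_b j)).
Qed.
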